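(* Let $d\ge2$ and let $\sigma:\mathbb{R}^d\to\mathbb{R}$ be a bounded, almost everywhere continuous function with compact support such that $\int_{\mathbb{R}^d}\sigma(x)\,dx<0$. Let $\{\xi_n\}_{n\ge1}$ be a decreasing sequence of positive numbers with $\xi_n\searrow0$, and for each $n$ let $\sigma_n:\xi_n\mathbb{Z}^d\to\mathbb{R}$ be $\sigma_n(x):=\xi_n^{-d}\int_{x+[-\xi_n/2,\xi_n/2]^d}\sigma(y)\,dy$. Assume $R>0$ is such that $\operatorname{supp}\sigma\subset B(0,R)$ and $\operatorname{supp}\sigma_n\subset B(0,R)$ for all $n$. Then, in the sense of distributions on $\mathbb{R}^d$, $$\operatorname{GDS}_R^{\xi_n}(\sigma_n)\to\operatorname{Bal}_R(\sigma,0)\quad\text{as }n\to\infty.$$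
   Context: Discrete setting on $\xi\mathbb{Z}^d$: $y'\sim y$ means $y'$ is one of the $2d$ lattice neighbours of $y$; $\Delta f(y)=\frac{1}{2d\xi^2}\sum_{y'\sim y}(f(y')-f(y))$; toppling at $x$ is $T_x\eta(y):=\eta(y)+\eta_+(x)\xi^2\Delta\delta_x(y)$ (remove the positive mass at $x$ and distribute it equally to the $2d$ neighbours). For a bounded finitely supported $\tau:\xi\mathbb{Z}^d\to\mathbb{R}$ with $\operatorname{supp}\tau\subset\hat B_R:=B(0,R)\cap\xi\mathbb{Z}^d$, take any sequence of points of $\hat B_R$ in which each point of $\hat B_R$ occurs infinitely often and topple successively at these points; the resulting configurations converge pointwise to a limit configuration, independent of the chosen sequence, called $\operatorname{GDS}^\xi_R(\tau)$. It is identified with the signed measure $\xi^d\sum_{x\in\xi\mathbb{Z}^d}\operatorname{GDS}^\xi_R(\tau)(x)\,\delta_x$ on $\mathbb{R}^d$ ($\delta_x$ the Dirac measure). Continuous setting: for a compactly supported signed Radon measure $\sigma$ on $\mathbb{R}^d$, $U^\sigma$ denotes its Newtonian potential normalized so that $-\Delta U^\sigma=2d\,\sigma$ in the sense of distributions. Let $V^{\sigma,R}$ be the largest element of $\{V\in\mathcal{D}'(\mathbb{R}^d): V\le U^\sigma \text{ in }\mathbb{R}^d,\ \Delta V\ge0\text{ in }B(0,R)\}$ (which exists). The partial balayage is $\operatorname{Bal}_R(\sigma,0):=-\frac{1}{2d}\Delta V^{\sigma,R}$, a signed Radon measure. Here $\sigma$ is identified with the measure $\sigma(x)\,dx$. 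*)

(* Defs.v *)
From HB Require Import structures.
From mathcomp Require Import all_boot all_order all_algebra.
From mathcomp Require Import all_classical all_reals all_analysis.
Set Implicit Arguments. Unset Strict Implicit. Unset Printing Implicit Defensive.
Import Order.TTheory GRing.Theory Num.Theory.
Import numFieldNormedType.Exports.
Local Open Scope classical_set_scope.
Local Open Scope ring_scope.

Section Defs.
Variables (R : realType) (d : nat).

Definition evec (i : 'I_d) : 'rV[R]_d := delta_mx 0 i.

Definition enorm (x : 'rV[R]_d) : R := Num.sqrt (\sum_(i < d) x 0 i ^+ 2).
Definition oball (r : R) : set 'rV[R]_d := [set x | enorm x < r].

(** d-dimensional Lebesgue integral, computed as the iterated one-dimensional
    Lebesgue integral (by Fubini this is the Lebesgue integral over R^d for
    every integrable function). *)
Fixpoint iterint (n : nat) (g : seq R -> R) : R :=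
  match n with
  | 0 => g [::]
  | n'.+1 => Rintegral (@lebesgue_measure R) setT
               (fun t : R => iterint n' (fun s => g (t :: s)))
  end.
Definition intRd (f : 'rV[R]_d -> R) : R :=
  iterint d (fun s => f (\row_(i < d) nth 0 s i)).

Definition lebesgue_null (N : set 'rV[R]_d) : Prop :=
  forall eps : R, 0 < eps -> exists a b : nat -> 'rV[R]_d,
    (forall n i, a n 0 i <= b n 0 i) /\
    N `<=` \bigcup_n [set x | forall i, a n 0 i <= x 0 i <= b n 0 i] /\
    forall m, \sum_(n < m) \prod_(i < d) (b n 0 i - a n 0 i) <= eps.

(** Newtonian potential, normalized so that - Delta U^sigma = 2d sigma. *)
Definition omega_d : R := d%:R * intRd (fun x => if enorm x < 1 then 1 else 0).
Definition fundsol (x : 'rV[R]_d) : R :=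
  if d == 2%N then - (2 * pi)^-1 * ln (enorm x)
  else (enorm x) `^ (2 - d%:R) / ((d%:R - 2) * omega_d).
Definition newton_pot (sigma : 'rV[R]_d -> R) (x : 'rV[R]_d) : R :=
  (2 * d%:R) * intRd (fun y => fundsol (x - y) * sigma y).

Definition partial (i : 'I_d) (f : 'rV[R]_d -> R) : 'rV[R]_d -> R :=
  fun x => 'D_(evec i) f x.
Definition iterpartial (s : seq 'I_d) (f : 'rV[R]_d -> R) : 'rV[R]_d -> R :=
  foldr partial f s.
Definition smooth (f : 'rV[R]_d -> R) : Prop :=
  forall s : seq 'I_d, continuous (iterpartial s f) /\
    forall i x, derivable (iterpartial s f) x (evec i).
Definition test_fun (f : 'rV[R]_d -> R) : Prop :=
  smooth f /\ exists r : R, forall x, r <= enorm x -> f x = 0.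
Definition test_fun_in_ball (r0 : R) (f : 'rV[R]_d -> R) : Prop :=
  smooth f /\ exists r : R, r < r0 /\ forall x, r <= enorm x -> f x = 0.
Definition Lap (f : 'rV[R]_d -> R) : 'rV[R]_d -> R :=
  fun x => \sum_(i < d) iterpartial [:: i; i] f x.

(** Distributions: linear functionals on test functions, continuous for the
    usual inductive-limit topology (seminorm estimates on each ball). Only the
    values on test functions are meaningful. *)
Definition distribution (T : ('rV[R]_d -> R) -> R) : Prop :=
  (forall (a : R) f g, test_fun f -> test_fun g ->
     T (fun x => a * f x + g x) = a * T f + T g) /\
  (forall r : R, exists (C : R) (N : nat), forall f M, test_fun f ->
     (forall x, r <= enorm x -> f x = 0) ->
     (forall s : seq 'I_d, (size s <= N)%N ->
        forall x, `|iterpartial s f x| <= M) ->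
     `|T f| <= C * M).

Definition bal_candidate (sigma : 'rV[R]_d -> R) (rad : R)
  (V : ('rV[R]_d -> R) -> R) : Prop :=
  distribution V /\
  (forall f, test_fun f -> (forall x, 0 <= f x) ->
     V f <= intRd (fun x => newton_pot sigma x * f x)) /\
  (forall f, test_fun_in_ball rad f -> (forall x, 0 <= f x) ->
     0 <= V (Lap f)).

Definition bal_largest (sigma : 'rV[R]_d -> R) (rad : R)
  (V : ('rV[R]_d -> R) -> R) : Prop :=
  bal_candidate sigma rad V /\
  forall W, bal_candidate sigma rad W ->
    forall f, test_fun f -> (forall x, 0 <= f x) -> W f <= V f.

(** Pairing of Bal_R(sigma,0) = -(1/2d) Delta V with a test function. *)
Definition bal_pair (V : ('rV[R]_d -> R) -> R) (f : 'rV[R]_d -> R) : R :=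
  - (2 * d%:R)^-1 * V (Lap f).

(** Discrete setting: the point xi*k of xi Z^d is encoded by k : 'rV[int]_d. *)
Definition lattice_pt (xi : R) (k : 'rV[int]_d) : 'rV[R]_d :=
  xi *: map_mx (fun z : int => z%:~R) k.
Definition ievec (i : 'I_d) : 'rV[int]_d := delta_mx 0 i.
Definition dLap (xi : R) (f : 'rV[int]_d -> R) (y : 'rV[int]_d) : R :=
  (2 * d%:R * xi ^+ 2)^-1 *
  \sum_(i < d) ((f (y + ievec i) - f y) + (f (y - ievec i) - f y)).
Definition ddelta (x : 'rV[int]_d) : 'rV[int]_d -> R :=
  fun y => if y == x then 1 else 0.
Definition topple (xi : R) (x : 'rV[int]_d) (eta : 'rV[int]_d -> R) :
  'rV[int]_d -> R :=
  fun y => eta y + Num.max (eta x) 0 * xi ^+ 2 * dLap xi (ddelta x) y.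
Fixpoint run (xi : R) (s : nat -> 'rV[int]_d) (eta : 'rV[int]_d -> R)
  (n : nat) : 'rV[int]_d -> R :=
  match n with 0 => eta | n'.+1 => topple xi (s n') (run xi s eta n') end.

Definition admissible (xi rad : R) (s : nat -> 'rV[int]_d) : Prop :=
  (forall m, enorm (lattice_pt xi (s m)) < rad) /\
  forall x, enorm (lattice_pt xi x) < rad ->
    forall N, exists m, (N <= m)%N /\ s m = x.

Definition is_GDS (xi rad : R) (tau eta : 'rV[int]_d -> R) : Prop :=
  forall s, admissible xi rad s ->
    forall y, (fun n => run xi s tau n y) @ \oo --> eta y.

(** Pairing of the measure xi^d sum_x eta(x) delta_{xi x} with f. *)
Definition disc_pair (xi : R) (eta : 'rV[int]_d -> R) (f : 'rV[R]_d -> R) : R :=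
  xi ^+ d * \sum_(k \in [set: 'rV[int]_d]) (eta k * f (lattice_pt xi k)).

Definition cell_avg (xi : R) (sigma : 'rV[R]_d -> R) (k : 'rV[int]_d) : R :=
  xi ^- d * intRd (fun y =>
    if `[< forall i, `|y 0 i - lattice_pt xi k 0 i| <= xi / 2 >]
    then sigma y else 0).

End Defs.

(* Main.v *)
(** The odometer [u_n] of the discrete process (total mass emitted from each
    point) satisfies [eta_n = sigma_n + dLap u_n], with [eta_n <= 0] on the ball
    and [eta_n >= 0] where [u_n > 0]. Put [v = U^sigma - V^{sigma,R}], so that
    [Bal_R(sigma,0) = sigma + (2d)^-1 Lap v]; it suffices to show that the rescaled
    odometers [xi_n^d sum_x u_n(x) delta_x] converge to [v] as distributions.

    Summation by parts against a paraboloid bounds their masses. Any ultrafilter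
    limit [T] is then a nonnegative functional with [T (Lap f) <= - 2d int sigma f]
    for nonnegative [f] supported in the ball, so that [U^sigma - T] is admissible
    in the definition of [V^{sigma,R}] and maximality gives [T >= v].

    Conversely, sampling a mollified and slightly dilated copy of [v] on the
    lattice gives [w >= 0] with [dLap w <= - h + O(xi)] on the ball, where [h] is a
    mollification of [sigma]. The paraboloid argument applied to [(u_n - w)^+]
    bounds its rescaled sum by the L^1 distance between [sigma_n] and [h], which
    is small because [sigma] is bounded and almost everywhere continuous; hence
    [T <= v]. *)

Require Import Defs.
From HB Require Import structures.
From mathcomp Require Import all_boot all_order all_algebra finmap.
From mathcomp Require Import all_classical all_reals all_analysis.
From mathcomp Require Import measurable_realfun borel_hierarchy.
From mathcomp Require Import zify ring lra.
Set Implicit Arguments. Unset Strict Implicit. Unset Printing Implicit Defensive.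
Import Order.TTheory GRing.Theory Num.Theory.
Import numFieldNormedType.Exports.
Local Open Scope classical_set_scope.
Local Open Scope ring_scope.

(** [sigma] need not be Borel, and [intRd] iterates one-dimensional integrals of functions whose
    measurability is unknown. The analysis is therefore done for a Borel version [s] that agrees
    with [sigma] off a Borel null set, and iterated integrals are shown to ignore such sets.
    V^{sigma,R} enters only as a linear functional with a one-sided Laplacian inequality and an
    extremality property. Hence all comparisons are between pairings with test functions, and an
    ultrafilter gives a limit on all test functions at once, so that the limit inherits linearity
    and positivity directly. Contracting by [lam] toward the origin creates the room that
    mollification consumes, since the inequality for v holds only for test functions supported
    inside the ball. For fixed [lam] and mollification radius the constants may be huge, but they
    multiply xi_n; so n tends to infinity before the mollification is removed. Lap is approximated
    by 2d times [dLap], which matches the 2d in the normalisation of U^sigma. *)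

(** * Lebesgue integrals of functions not known to be measurable *)

Section NonMeasurableIntegral.
Local Open Scope ereal_scope.
Context d (T : measurableType d) (R : realType) (mu : {measure set T -> \bar R}).
Import HBNNSimple.

(** For nonnegative integrands the integral is the supremum of the integrals of simple functions
    below, with no measurability asked. A simple function below [f], multiplied by the indicator of
    the complement of [N], keeps its integral and lies below [g]. *)
Lemma ge0_le_integral_off_null (f g : T -> \bar R) (N : set T) :
  measurable N -> mu N = 0 -> (forall x, 0 <= f x) -> (forall x, 0 <= g x) ->
  (forall x, ~ N x -> f x = g x) -> \int[mu]_x f x <= \int[mu]_x g x.
Proof.
move=> mN N0 f0 g0 fg; rewrite !ge0_integralTE//.
apply: ge_ereal_sup => _ [h hf <-].
have mC := measurableC mN.
have -> : sintegral mu h = sintegral mu (proj_nnsfun h mC).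
  rewrite -!integralT_nnsfun.
  apply: ae_eq_integral => //; [exact/measurable_EFinP|exact/measurable_EFinP|].
  exists N; split=> // x /= /not_implyP[_]; apply: contra_notP => Nx.
  by rewrite mindicE mem_set// mulr1.
apply: ereal_sup_ubound; exists (proj_nnsfun h mC) => //= x.
rewrite mindicE; case: (boolP (x \in ~` N)) => [|_].
  by rewrite inE => Nx; rewrite mulr1 -fg.
by rewrite mulr0.
Qed.

Lemma eq_integral_off_null (f g : T -> \bar R) (N : set T) :
  measurable N -> mu N = 0 ->
  (forall x, ~ N x -> f x = g x) -> \int[mu]_x f x = \int[mu]_x g x.
Proof.
move=> mN N0 fg; rewrite integralE [RHS]integralE; congr (_ - _).
- by apply/eqP; rewrite eq_le; apply/andP; split;
    apply: (ge0_le_integral_off_null mN N0) => // x Nx; rewrite !funeposE fg.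
- by apply/eqP; rewrite eq_le; apply/andP; split;
    apply: (ge0_le_integral_off_null mN N0) => // x Nx; rewrite !funenegE fg.
Qed.

End NonMeasurableIntegral.

Lemma sigma_finite_prod d1 d2 (T1 : measurableType d1) (T2 : measurableType d2)
    (R : realType) (m1 : {sigma_finite_measure set T1 -> \bar R})
    (m2 : {sigma_finite_measure set T2 -> \bar R}) :
  sigma_finite setT (m1 \x m2)%E.
Proof.
have /sigma_finiteP[F [TF ndF Foo]] := sigma_finiteT m1.
have /sigma_finiteP[G [TG ndG Goo]] := sigma_finiteT m2.
exists (fun n => F n `*` G n).
  rewrite -setXTT TF TG predeqE => -[x y]; split.
    move=> [/= [n _ Fnx] [k _ Gky]]; exists (maxn n k) => //; split.
    - by move: x Fnx; exact/subsetPset/ndF/leq_maxl.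
    - by move: y Gky; exact/subsetPset/ndG/leq_maxr.
  by move=> [n _ []/= ? ?]; split; exists n.
move=> k; have [? ?] := Foo k; have [? ?] := Goo k.
split; first exact: measurableX.
by rewrite product_measure1E// lte_mul_pinfty// ge0_fin_numE.
Qed.

(** * Product measure on tuples *)

Section TupleMeasure.
Local Open Scope ereal_scope.
Context (R : realType) d (T : measurableType d).
Variable leb : {sigma_finite_measure set T -> \bar R}.
Notation tup n := (n.-tuple T).

Definition tcons n (p : T * tup n) : tup n.+1 :=
  [tuple of p.1 :: p.2].

Lemma measurable_tcons n : measurable_fun setT (@tcons n).
Proof. exact: measurable_cons. Qed.

HB.instance Definition _ n :=
  @isMeasurableFun.Build _ _ _ _ (@tcons n) (@measurable_tcons n).

Definition tuple_measureS n (m : {sigma_finite_measure set (tup n) -> \bar R})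
  : set (tup n.+1) -> \bar R := pushforward (leb \x m) (@tcons n).

Section instance.
Variables (n : nat) (m : {sigma_finite_measure set (tup n) -> \bar R}).

Let tm0 : tuple_measureS m set0 = 0.
Proof. by rewrite /tuple_measureS /pushforward preimage_set0 measure0. Qed.

Let tm_ge0 A : 0 <= tuple_measureS m A.
Proof. exact: measure_ge0. Qed.

Let tm_sigma_additive : semi_sigma_additive (tuple_measureS m).
Proof. exact: (@measure_semi_sigma_additive _ _ _ (pushforward (leb \x m) (@tcons n))). Qed.

HB.instance Definition _ := isMeasure.Build _ _ _ (tuple_measureS m)
  tm0 tm_ge0 tm_sigma_additive.

Let sf : sigma_finite setT (tuple_measureS m).
Proof.
have [F FT mF] := sigma_finite_prod leb m.
pose uncons (t : tup n.+1) : T * tup n := (thead t, [tuple of behead t]).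
have munc : measurable_fun setT uncons.
  apply/measurable_fun_pairP; split.
    by rewrite (_ : _ \o _ = (fun t => tnth t ord0)); [exact: measurable_tnth|].
  exact: measurable_behead.
have unK : cancel (@tcons n) uncons.
  move=> [x t]; rewrite /uncons/=; congr pair.
  by apply: val_inj.
exists (fun k => uncons @^-1` F k).
  by rewrite -preimage_bigcup -FT preimage_setT.
move=> k; have [mFk Fk] := mF k; split.
  by rewrite -[X in measurable X]setTI; exact: munc.
rewrite /tuple_measureS /pushforward -comp_preimage.
by rewrite (_ : uncons \o _ = id)//; apply/funext => p /=; exact: unK.
Qed.

HB.instance Definition _ := @Measure_isSigmaFinite.Build _ _ _ (tuple_measureS m) sf.
End instance.

(** Built by adding one head coordinate at a time, in the order in which [iterint] peels off
    variables, so that Fubini matches that recursion. The 0-tuples carry the Dirac mass: integration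
    in dimension 0 is evaluation. *)
Fixpoint tuple_measure n : {sigma_finite_measure set (tup n) -> \bar R} :=
  match n with
  | 0 => \d_[tuple]
  | n'.+1 => tuple_measureS (tuple_measure n')
  end.

Lemma ge0_integral_tupleS n (F : tup n.+1 -> \bar R) :
  measurable_fun setT F -> (forall t, 0 <= F t) ->
  \int[tuple_measure n.+1]_t F t =
  \int[leb]_x \int[tuple_measure n]_t F (tcons (x, t)).
Proof.
move=> mF F0; transitivity (\int[pushforward (leb \x tuple_measure n) (@tcons n)]_t F t); first by [].
rewrite (ge0_integral_pushforward (@measurable_tcons n))//.
rewrite preimage_setT fubini_tonelli1//.
  by apply: measurableT_comp => //; exact: measurable_tcons.
by move=> x /=.
Qed.

End TupleMeasure.

(** * Iterated integrals as integrals over tuples *)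

Section Iterint.
Local Open Scope ereal_scope.
Context (R : realType).
Notation leb := (@lebesgue_measure R).
Notation tup n := (n.-tuple (measurableTypeR R)).
Definition mu n := tuple_measure leb n.

(** Induction on the dimension. Almost every slice of [N] is null and almost every slice of [G] is
    integrable; for those head coordinates the inner iterated integral is known by induction, and
    the others form a null set on which its value, possibly meaningless, does not count. *)
Lemma iterintE n (g : seq R -> R) (G : tup n -> R) (N : set (tup n)) :
  (mu n).-integrable setT (EFin \o G) -> measurable N -> mu n N = 0 ->
  (forall t : tup n, ~ N t -> g t = G t) ->
  iterint n g = Rintegral (mu n) setT G.
Proof.
elim: n g G N => [|n IHn] g G N iG mN N0 gG /=.
  rewrite /Rintegral /= integral_dirac//=; last exact: measurable_int iG.
  rewrite indicE mem_set// mul1r -gG// => NN.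
  move: N0; rewrite /mu /= diracE mem_set//= => /eqP.
  by rewrite onee_eq0.
have iG' : (leb \x mu n).-integrable setT (EFin \o G \o (@tcons _ _ n)).
  apply/integrableP; split.
    apply: measurableT_comp; first exact: measurable_int iG.
    exact: measurable_tcons.
  move/integrableP : iG => [mG]; rewrite ge0_integral_tupleS//; last first.
    exact: measurableT_comp.
  have mGc : measurable_fun setT (EFin \o G \o @tcons _ _ n).
    by apply: measurableT_comp => //; exact: measurable_tcons.
  by rewrite fubini_tonelli1//=; exact: (measurableT_comp (@abse_measurable _ setT) mGc).
have -> : Rintegral (mu n.+1) setT G =
    fine (\int[leb]_x \int[mu n]_t (EFin \o G \o (@tcons _ _ n)) (x, t)).
  rewrite /Rintegral; congr fine.
  rewrite integral12_prod_meas1//.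
  transitivity (\int[pushforward (leb \x mu n) (@tcons _ _ n)]_t (G t)%:E); first by [].
  rewrite (integral_pushforward (@measurable_tcons _ _ n)) ?preimage_setT//.
  exact: measurable_int iG.
have mN' : measurable ((@tcons _ _ n) @^-1` N : set (measurableTypeR R * tup n)).
  by rewrite -[X in measurable X]setTI; exact: measurable_tcons.
(* The measure of the slices is a nonnegative function whose integral is the measure of [N], hence
   zero, so it vanishes almost everywhere. *)
have aeN : leb.-negligible [set x | mu n (xsection ((@tcons _ _ n) @^-1` N) x) <> 0].
  have /ae_eq_integral_abs : measurable_fun setT (fun x => mu n (xsection ((@tcons _ _ n) @^-1` N) x)).
    exact: measurable_fun_xsection.
  move=> /(_ leb measurableT)[+ _] => /(_ _)[].
    rewrite -[RHS]N0 /mu /= /tuple_measureS /pushforward /product_measure1.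
    by apply: eq_integral => x _ /=; rewrite gee0_abs.
  move=> A [mA A0 sA]; exists A; split => // x /= Hx; apply: sA => /=.
  by apply/not_implyP; split.
have [A [mA A0 sA]] := aeN.
have [B [mB B0 sB]] := ae_integrable1 iG'.
rewrite /Rintegral; congr fine.
apply: (@eq_integral_off_null _ _ _ _ _ _ (A `|` B)).
- exact: measurableU.
- by apply: null_set_setU.
move=> x /not_orP[Ax Bx].
have iGx : (mu n).-integrable setT (fun t => (EFin \o G \o (@tcons _ _ n)) (x, t)).
  by apply: contrapT => H; apply: Bx; exact: sB.
have Nx : mu n (xsection ((@tcons _ _ n) @^-1` N) x) = 0.
  by apply: contrapT => H; apply: Ax; exact: sA.
rewrite (IHn _ (fun t => G (tcons (x, t))) (xsection ((@tcons _ _ n) @^-1` N) x))//.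
- by rewrite /Rintegral fineK//; exact: integrable_fin_num.
- exact: measurable_xsection.
- move=> t Nt; rewrite -gG//= => Nxt; apply: Nt.
  by rewrite /xsection /= inE.
Qed.

End Iterint.

(** * Lebesgue measure on row vectors *)

Section AffineChange.
Local Open Scope ereal_scope.
Context (R : realType).
Notation leb := (@lebesgue_measure R).
Notation tup n := (n.-tuple (measurableTypeR R)).

Definition affine (a c : R) (x : measurableTypeR R) : measurableTypeR R := (a * x + c)%R.

Lemma measurable_affine (a c : R) : measurable_fun setT (affine a c).
Proof. by apply: measurable_funD => //; exact: measurable_funM. Qed.

Definition affine_pushforward (a c : R) : set (measurableTypeR R) -> \bar R :=
  pushforward leb (affine a c).

Section affine_pushforward_instance.
Variables a c : R.

Let ap0 : affine_pushforward a c set0 = 0.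
Proof. by rewrite /affine_pushforward /pushforward preimage_set0 measure0. Qed.

Let ap_ge0 A : 0 <= affine_pushforward a c A.
Proof. exact: (measure_ge0 leb). Qed.

Let ap_sigma_additive : semi_sigma_additive (affine_pushforward a c).
Proof.
apply: (@measure_semi_sigma_additive _ _ _ (pushforward leb (affine a c))).
exact: measurable_affine.
Qed.

HB.instance Definition _ := isMeasure.Build _ _ _ (affine_pushforward a c)
  ap0 ap_ge0 ap_sigma_additive.

End affine_pushforward_instance.

(** Uniqueness of Lebesgue measure: the scaled image measure gives each half-open interval its
    length. *)
Lemma lebesgue_measure_affine (a c : R) (A : set (measurableTypeR R)) :
  (0 < a)%R -> measurable A ->
  leb A = a%:E * leb (affine a c @^-1` A).
Proof.
move=> a0 mA; pose k : {nonneg R} := NngNum (ltW a0).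
transitivity (mscale k (affine_pushforward a c) A); last by [].
apply: lebesgue_measure_unique => // _ [[x y] _ <-].
rewrite /= /mscale /affine_pushforward /pushforward.
have E : affine a c @^-1` `]x, y]%classic = `]((x - c) / a)%R, ((y - c) / a)%R]%classic.
  by apply/seteqP; split=> z /=; rewrite !in_itv/= /affine ltr_pdivrMr//
    ler_pdivlMr// ltrBlDr lerBrDr mulrC.
transitivity (a%:E * leb `]((x - c) / a)%R, ((y - c) / a)%R]%classic); last first.
  by rewrite -E.
rewrite !lebesgue_measure_itv /= !lte_fin ltr_pM2r ?invr_gt0// ltrD2r.
case: ifPn => _; last by rewrite mule0.
by rewrite -!EFinD -EFinM; congr EFin; field; rewrite gt_eqF.
Qed.

Lemma ge0_integral_affine (a c : R) (F : R -> \bar R) : (0 < a)%R ->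
  measurable_fun setT F -> (forall x, 0 <= F x) ->
  \int[leb]_x F x = a%:E * \int[leb]_x F (a * x + c)%R.
Proof.
move=> a0 mF F0; pose k : {nonneg R} := NngNum (ltW a0).
transitivity (\int[mscale k (affine_pushforward a c)]_x F x).
  by apply: eq_measure_integral => A mA _ /=; exact: lebesgue_measure_affine.
rewrite ge0_integral_mscale//; congr (_ * _).
exact: (ge0_integral_pushforward (measurable_affine a c)).
Qed.

(** The scale [a] is common to all coordinates, while the translation is indexed by [nat], so that
    removing the head amounts to shifting the index. *)
Definition taffine n (a : R) (c : nat -> R) (t : tup n) : tup n :=
  [tuple (a * tnth t i + c i)%R | i < n].

Lemma taffine_tcons n a c (x : R) (t : tup n) :
  taffine a c (tcons (x, t)) = tcons ((a * x + c 0%N)%R, taffine a (c \o succn) t).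
Proof.
apply: eq_from_tnth => i; rewrite tnth_mktuple.
case: (unliftP ord0 i) => [j ->|->]; last by [].
by rewrite !tnthS tnth_mktuple.
Qed.

Lemma measurable_taffine n a c : measurable_fun setT (@taffine n a c).
Proof.
apply/measurable_fun_tnthP => i.
rewrite (_ : _ \o _ = fun t => (a * tnth t i + c i)%R); last first.
  by apply/funext => t /=; rewrite tnth_mktuple.
apply: measurable_funD => //; apply: measurable_funM => //.
exact: measurable_tnth.
Qed.

Lemma ge0_integral_taffine n (a : R) c (F : tup n -> \bar R) : (0 < a)%R ->
  measurable_fun setT F -> (forall x, 0 <= F x) ->
  \int[mu R n]_t F t = (a ^+ n)%:E * \int[mu R n]_t F (taffine a c t).
Proof.
move=> a0; elim: n c F => [|n IHn] c F mF F0.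
  rewrite expr0 mul1e; apply: eq_integral => t _; congr F.
  by apply: eq_from_tnth => -[].
have mFc : measurable_fun setT (F \o (@tcons _ _ n)).
  by apply: measurableT_comp => //; exact: measurable_tcons.
rewrite ge0_integral_tupleS// [in RHS]ge0_integral_tupleS//; last first.
  by apply: measurableT_comp => //; exact: measurable_taffine.
rewrite (ge0_integral_affine (c 0%N) a0); last 2 first.
  - by apply: (measurable_fun_fubini_tonelli_F (F \o (@tcons _ _ n))) => // x /=.
  - by move=> x; apply: integral_ge0.
rewrite exprS EFinM -muleA; congr (_ * _).
rewrite -ge0_integralZl//; last 3 first.
- apply: (measurable_fun_fubini_tonelli_F (F \o @taffine _ a c \o (@tcons _ _ n))) => [|x]; last exact: F0.
  apply: measurableT_comp; last exact: measurable_tcons.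
  by apply: measurableT_comp => //; exact: measurable_taffine.
- by move=> x _; apply: integral_ge0.
- by rewrite lee_fin exprn_ge0// ltW.
apply: eq_integral => x _.
rewrite (IHn (c \o succn))//; last first.
  exact: (measurableT_comp mFc (measurable_pair1 _)).
by congr (_ * _); apply: eq_integral => t _; rewrite taffine_tcons.
Qed.

End AffineChange.

Arguments taffine {R n} a c t.

(** * Row vectors, seen as tuples *)

Section RowVector.
Context (R : realType) (d : nat).
Notation tup n := (n.-tuple (measurableTypeR R)).
Notation V := 'rV[R]_d.

Definition rv (t : tup d) : V := \row_i tnth t i.

Definition tv (x : V) : tup d := [tuple x 0 i | i < d].

Lemma tvK : cancel tv rv.
Proof. by move=> x; apply/rowP => i; rewrite mxE tnth_mktuple. Qed.

Lemma rvK : cancel rv tv.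
Proof. by move=> t; apply: eq_from_tnth => i; rewrite tnth_mktuple mxE. Qed.

(** Measurability into row vectors is coordinatewise: the sigma-algebra in use lives on tuples,
    while row vectors carry the topology. *)
Definition meas_vec d1 (X : measurableType d1) (q : X -> V) :=
  forall i, measurable_fun setT (fun x => q x 0 i : measurableTypeR R).

Lemma meas_vec_rv : meas_vec rv.
Proof.
move=> i; rewrite (_ : (fun _ => _) = fun t => tnth t i); first exact: measurable_tnth.
by apply/funext => t; rewrite mxE.
Qed.

Section MeasVec.
Context d1 (X : measurableType d1).
Implicit Types q : X -> V.

Lemma meas_vec_cst (v : V) : meas_vec (fun _ : X => v).
Proof. by move=> i; exact: measurable_cst. Qed.

Lemma meas_vecD q1 q2 : meas_vec q1 -> meas_vec q2 -> meas_vec (fun x => q1 x + q2 x).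
Proof.
move=> m1 m2 i; under eq_fun do rewrite mxE.
by apply: measurable_funD; [exact: m1|exact: m2].
Qed.

Lemma meas_vecN q : meas_vec q -> meas_vec (fun x => - q x).
Proof.
move=> m i; under eq_fun do rewrite mxE.
by apply: measurableT_comp => //; exact: m.
Qed.

Lemma meas_vecB q1 q2 : meas_vec q1 -> meas_vec q2 -> meas_vec (fun x => q1 x - q2 x).
Proof. by move=> m1 m2; apply: meas_vecD => //; exact: meas_vecN. Qed.

Lemma measurable_coord q i : meas_vec q -> measurable_fun setT (fun x => q x 0 i).
Proof. exact. Qed.

Lemma meas_vec_comp d2 (Y : measurableType d2) (q : X -> V) (h : Y -> X) :
  measurable_fun setT h -> meas_vec q -> meas_vec (q \o h).
Proof. by move=> mh mq i; exact: (measurableT_comp (mq i) mh). Qed.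

Definition rat_box (p : 'rV[rat]_d * rat) : set V :=
  [set x | forall i, `|x 0 i - ratr (p.1 0 i)| < ratr p.2].

(** Boxes with rational centre and half-side are countably many; those not contained in [O] are
    replaced by the empty set, which keeps the union indexed by all of them. *)
Lemma open_rat_boxes (O : set V) : open O ->
  O = \bigcup_p (if `[< rat_box p `<=` O >] then rat_box p else set0).
Proof.
move=> oO; apply/seteqP; split=> x; last first.
  by move=> [p _]; case: ifPn => // /asboolP; apply.
move=> Ox; have /nbhs_ballP[e /= e0 xeO] : nbhs x O by exact: open_nbhs_nbhs.
have [r /andP[r0 re]] : exists r : rat, 0 < (ratr r : R) < e / 2.
  have /rat_in_itvoo[r] : 0 < e / 2 by rewrite divr_gt0.
  by rewrite in_itv/=; exists r.
have /choice[c Hc] : forall i, exists c : rat, `|x 0 i - ratr c| < ratr r.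
  move=> i; have /rat_in_itvoo[c] : x 0 i - ratr r < x 0 i + ratr r by lra.
  by rewrite in_itv/= => /andP[? ?]; exists c; rewrite ltr_norml; lra.
exists (\row_i c i, r) => //; rewrite ifT; last first.
  apply/asboolP => y /= Hy; apply: xeO; split=> // i j; rewrite !ord1 {i}.
  have := Hy j; have := Hc j; rewrite mxE /ball /= => H1 H2.
  have -> : x 0 j - y 0 j = (x 0 j - ratr (c j)) - (y 0 j - ratr (c j)) by ring.
  apply: (le_lt_trans (ler_normB _ _)); lra.
by move=> i; rewrite mxE; exact: Hc.
Qed.

Lemma measurable_preimage_open q (O : set V) : meas_vec q -> open O ->
  measurable (q @^-1` O).
Proof.
move=> mq /open_rat_boxes ->; rewrite preimage_bigcup.
apply: countable_bigcupT_measurable => [|p].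
  exact: (@countableP ('rV[rat]_d * rat)%type).
case: ifPn => _; last by rewrite preimage_set0.
have -> : q @^-1` rat_box p =
    \bigcap_(i in [set: 'I_d]) ((fun x => q x 0 i) @^-1` [set y | `|y - ratr (p.1 0 i)| < ratr p.2]).
  by apply/seteqP; split=> x /= H i => [_|]; exact: H.
apply: fin_bigcap_measurable; first exact: finite_finset.
move=> i _; rewrite -[X in measurable X]setTI; apply: mq => //.
rewrite (_ : mkset _ = `](ratr (p.1 0 i) - ratr p.2), (ratr (p.1 0 i) + ratr p.2)[%classic)//.
by apply/seteqP; split=> y /=; rewrite in_itv/= ltr_norml; lra.
Qed.

Lemma measurable_continuous_comp q (f : V -> R) : meas_vec q -> continuous f ->
  measurable_fun setT (f \o q).
Proof.
move=> mq /continuousP cf; apply: (measurability _ (RGenOpens.measurableE R)).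
move=> _ [_ [a [b ->] <-]]; rewrite setTI comp_preimage.
by apply: measurable_preimage_open => //; exact/cf/interval_open.
Qed.

End MeasVec.
End RowVector.
Arguments rv {R d} t.
Arguments tv {R d} x.

(** * Volumes of boxes *)

Section Boxes.
Context (R : realType).
Notation leb := (@lebesgue_measure R).
Notation tup n := (n.-tuple (measurableTypeR R)).

Definition tbox n (a b : nat -> R) : set (tup n) :=
  [set t | forall i : 'I_n, a i <= tnth t i <= b i].

Lemma measurable_tbox n a b : measurable (@tbox n a b).
Proof.
have -> : @tbox n a b = \bigcap_(i in [set: 'I_n]) ((fun t => tnth t i) @^-1` `[a i, b i]%classic).
  by apply/seteqP; split=> t /= H i => [_|]; have := H i; rewrite /= in_itv/=; last exact.
apply: fin_bigcap_measurable; first exact: finite_finset.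
by move=> i _; rewrite -[X in measurable X]setTI; apply: measurable_tnth.
Qed.

Lemma measure_tbox n (a b : nat -> R) : (forall i, (i < n)%N -> a i <= b i) ->
  mu R n (@tbox n a b) = (\prod_(i < n) (b i - a i))%:E.
Proof.
elim: n a b => [|n IHn] a b ab.
  rewrite big_ord0 /mu /= diracE mem_set//.
  by move=> [].
transitivity ((leb \x mu R n)%E (@tcons _ _ n @^-1` (@tbox n.+1 a b))); first by [].
have -> : @tcons _ _ n @^-1` (@tbox n.+1 a b) =
    `[a 0%N, b 0%N]%classic `*` @tbox n (a \o succn) (b \o succn).
  apply/seteqP; split=> -[x t] /=.
    move=> H; split; first by have := H ord0; rewrite in_itv.
    by move=> i; have := H (lift ord0 i); rewrite tnthS.
  rewrite in_itv /= => -[H1 H2] i; case: (unliftP ord0 i) => [j ->|->//].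
  by rewrite tnthS; exact: H2.
rewrite product_measure1E//; last exact: measurable_tbox.
rewrite IHn; last by move=> i ni; apply: ab.
rewrite [X in (X * _)%E]lebesgue_measure_itv /= lte_fin big_ord_recl /= EFinM; congr (_ * _)%E.
case: ltP => ba; first by rewrite EFinB.
by congr EFin; apply/eqP; rewrite eq_sym subr_eq0 eq_le ab// ba.
Qed.

End Boxes.

(** * The integral over R^d and the Euclidean norm *)

Section Integral.
Context (R : realType) (d : nat).
Notation tup n := (n.-tuple (measurableTypeR R)).
Notation V := 'rV[R]_d.
Implicit Types f g : V -> R.

Definition nat_coord (x : V) (i : nat) : R := nth 0 (tv x) i.

Lemma nat_coordE x (i : 'I_d) : nat_coord x i = x 0 i.
Proof. by rewrite /nat_coord -tnth_nth tnth_mktuple. Qed.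

Definition Meas f := measurable_fun setT (f \o rv : tup d -> R).
Definition Intg f := (mu R d).-integrable setT (EFin \o (f \o rv : tup d -> R)).
Definition Int f : R := Rintegral (mu R d) setT (f \o rv).

Lemma IntE f : Intg f -> (Int f)%:E = (\int[mu R d]_t (f (rv t))%:E)%E.
Proof. by move=> H; rewrite /Int /Rintegral fineK//; exact: integrable_fin_num. Qed.

Lemma Intg_Meas f : Intg f -> Meas f.
Proof. by move=> H; have /measurable_EFinP := measurable_int (mu R d) H. Qed.

(** The bridge to the iterated integrals of the theorem: [f] is arbitrary, and only the function [g]
    that it equals off a null set has to be integrable. *)
Lemma intRdE f g (N : set (tup d)) : Intg g -> measurable N -> mu R d N = 0%E ->
  (forall t, ~ N t -> f (rv t) = g (rv t)) -> intRd f = Int g.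
Proof.
move=> ig mN N0 fg; apply: (iterintE ig mN N0) => t Nt /=.
rewrite -fg//; congr f; apply/rowP => i; rewrite !mxE.
by rewrite -tnth_nth.
Qed.

Lemma intRd_Int f : Intg f -> intRd f = Int f.
Proof. by move=> fi; apply: (intRdE fi measurable0) => //; exact: measure0. Qed.

Lemma IntD f g : Intg f -> Intg g -> Int (fun x => f x + g x) = Int f + Int g.
Proof. by move=> mf mg; rewrite /Int -RintegralD. Qed.

Lemma IntB f g : Intg f -> Intg g -> Int (fun x => f x - g x) = Int f - Int g.
Proof. by move=> mf mg; rewrite /Int -RintegralB. Qed.

Lemma IntZ a f : Intg f -> Int (fun x => a * f x) = a * Int f.
Proof. by move=> mf; rewrite /Int -RintegralZl. Qed.

Lemma IntgD f g : Intg f -> Intg g -> Intg (fun x => f x + g x).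
Proof.
move=> mf mg; rewrite /Intg.
rewrite (_ : _ \o _ = (EFin \o (f \o rv)) \+ (EFin \o (g \o rv)))%E//.
exact: integrableD.
Qed.

Lemma IntgZ a f : Intg f -> Intg (fun x => a * f x).
Proof.
move=> mf; rewrite /Intg.
rewrite (_ : _ \o _ = (fun t => a%:E * (EFin \o (f \o rv)) t))%E//.
exact: integrableZl.
Qed.

Lemma IntgB f g : Intg f -> Intg g -> Intg (fun x => f x - g x).
Proof.
move=> mf mg; rewrite /Intg.
rewrite (_ : _ \o _ = (EFin \o (f \o rv)) \- (EFin \o (g \o rv)))%E//.
exact: integrableB.
Qed.

Lemma IntN f : Intg f -> Int (fun x => - f x) = - Int f.
Proof. by move=> /(IntZ (-1)); under eq_fun do rewrite mulN1r; rewrite mulN1r. Qed.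

Lemma Int0 : Int (fun=> 0) = 0.
Proof. by rewrite /Int /Rintegral integral0. Qed.

Lemma Intg0 : Intg (fun=> 0).
Proof. exact: integrable0. Qed.

Lemma Intg_sum (I : Type) (s : seq I) (F : I -> V -> R) :
  (forall i, Intg (F i)) -> Intg (fun x => \sum_(i <- s) F i x).
Proof.
move=> iF; elim: s => [|i s IHs].
  by under eq_fun do rewrite big_nil; exact: Intg0.
by under eq_fun do rewrite big_cons; exact: IntgD.
Qed.

Lemma Int_sum (I : Type) (s : seq I) (F : I -> V -> R) :
  (forall i, Intg (F i)) ->
  Int (fun x => \sum_(i <- s) F i x) = \sum_(i <- s) Int (F i).
Proof.
move=> iF; elim: s => [|i s IHs].
  by under eq_fun do rewrite big_nil; rewrite big_nil Int0.
under eq_fun do rewrite big_cons; rewrite big_cons IntD// ?IHs//.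
exact: Intg_sum.
Qed.

Lemma le_Int f g : Intg f -> Intg g -> (forall x, f x <= g x) -> Int f <= Int g.
Proof. by move=> mf mg fg; apply: le_Rintegral => // t _ /=. Qed.

Lemma Int_ge0 f : (forall x, 0 <= f x) -> 0 <= Int f.
Proof. by move=> f0; apply: Rintegral_ge0 => t _ /=. Qed.

Lemma Intg_norm f : Intg f -> Intg (fun x => `|f x|).
Proof. by move=> mf; have := integrable_norm mf. Qed.

Lemma le_norm_Int f : Intg f -> `|Int f| <= Int (fun x => `|f x|).
Proof. by move=> mf; apply: le_normr_Rintegral. Qed.

Lemma le_Intg f g : Meas f -> Intg g -> (forall x, `|f x| <= g x) -> Intg f.
Proof.
move=> mf ig fg; apply: (le_integrable measurableT _ _ ig).
  exact/measurable_EFinP.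
by move=> t _ /=; rewrite lee_fin (le_trans (fg _))// ler_norm.
Qed.

Lemma MeasB f g : Meas f -> Meas g -> Meas (fun x => f x - g x).
Proof. by move=> mf mg; exact: measurable_funB. Qed.

Lemma MeasM f g : Meas f -> Meas g -> Meas (fun x => f x * g x).
Proof. by move=> mf mg; exact: measurable_funM. Qed.

Lemma Meas_cst a : Meas (fun=> a).
Proof. exact: measurable_cst. Qed.

Lemma Meas_norm f : Meas f -> Meas (fun x => `|f x|).
Proof. by move=> mf; exact: measurableT_comp. Qed.

Lemma Meas_continuous f : continuous f -> Meas f.
Proof. by move=> cf; exact: measurable_continuous_comp (@meas_vec_rv _ _) cf. Qed.

Definition nsq (x : V) : R := \sum_(i < d) x 0 i ^+ 2.

Lemma nsq_ge0 x : 0 <= nsq x.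
Proof. by apply: sumr_ge0 => i _; rewrite sqr_ge0. Qed.

Lemma enorm_ge0 (x : V) : 0 <= enorm x.
Proof. exact: sqrtr_ge0. Qed.

Lemma sqr_enorm (x : V) : enorm x ^+ 2 = nsq x.
Proof. by rewrite sqr_sqrtr// nsq_ge0. Qed.

Lemma nsqZ a x : nsq (a *: x) = a ^+ 2 * nsq x.
Proof. by rewrite /nsq mulr_sumr; apply: eq_bigr => i _; rewrite mxE exprMn. Qed.

Lemma enormZ a (x : V) : 0 <= a -> enorm (a *: x) = a * enorm x.
Proof.
move=> a0; rewrite /enorm -/(nsq _) nsqZ sqrtrM ?sqr_ge0// sqrtr_sqr ger0_norm//.
Qed.

Lemma enormN (x : V) : enorm (- x) = enorm x.
Proof. by rewrite /enorm; congr Num.sqrt; apply: eq_bigr => i _; rewrite mxE sqrrN. Qed.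

Lemma coord_le_enorm (x : V) i : `|x 0 i| <= enorm x.
Proof.
rewrite -sqrtr_sqr ler_sqrt ?nsq_ge0// (bigD1 i)//= lerDl.
by apply: sumr_ge0 => j _; rewrite sqr_ge0.
Qed.

Lemma enorm_le_coord (x : V) r : 0 <= r -> (forall i, `|x 0 i| <= r) ->
  enorm x <= d%:R * r.
Proof.
move=> r0 H; have s0 : 0 <= d%:R * r by rewrite mulr_ge0// ler0n.
rewrite -(ger0_norm s0) -sqrtr_sqr ler_sqrt ?sqr_ge0//.
apply: (@le_trans _ _ (\sum_(i < d) r ^+ 2)).
  by apply: ler_sum => i _; rewrite -[x 0 i ^+ 2]real_normK ?num_real// ler_sqr ?nnegrE.
rewrite sumr_const card_ord -[leLHS]mulr_natl exprMn; apply: ler_wpM2r; first exact: sqr_ge0.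
by rewrite -natrX ler_nat; case: (d) => // n; rewrite leq_pmulr.
Qed.

Lemma enorm_triangle (x y : V) : enorm (x + y) <= enorm x + enorm y.
Proof.
have s0 : 0 <= enorm x + enorm y by rewrite addr_ge0// enorm_ge0.
rewrite -(ger0_norm s0) -sqrtr_sqr ler_sqrt ?sqr_ge0// sqrrD !sqr_enorm.
have -> : \sum_(i < d) (x + y) 0 i ^+ 2 =
    nsq x + (\sum_(i < d) x 0 i * y 0 i) *+ 2 + nsq y.
  rewrite /nsq -sumrMnl -!big_split/=; apply: eq_bigr => i _.
  by rewrite mxE sqrrD.
rewrite lerD2r lerD2l lerMn2r/=.
have CS : (\sum_(i < d) x 0 i * y 0 i) ^+ 2 <= nsq x * nsq y.
  have [y0|y0] := eqVneq (nsq y) 0.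
    rewrite y0 mulr0 big1 ?expr0n// => i _.
    move/eqP : y0; rewrite psumr_eq0; last by move=> j _; rewrite sqr_ge0.
    by move/allP => /(_ i (mem_index_enum i)); rewrite /= sqrf_eq0 => /eqP ->; rewrite mulr0.
  have yp : 0 < nsq y by rewrite lt0r y0 nsq_ge0.
  set p := \sum_(i < d) _.
  (* Cauchy-Schwarz from the squared norm of |y|^2 x - <x, y> y, which equals |y|^2 (|x|^2 |y|^2 -
     <x, y>^2). *)
  have : 0 <= nsq (nsq y *: x - p *: y) by exact: nsq_ge0.
  have -> : nsq (nsq y *: x - p *: y) = nsq y * (nsq x * nsq y - p ^+ 2).
    have -> (u v : R) : nsq (u *: x - v *: y) = u ^+ 2 * nsq x - (u * v * p) *+ 2 + v ^+ 2 * nsq y.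
      rewrite /nsq /p !mulr_sumr -sumrMnl -sumrB -big_split/=.
      by apply: eq_bigr => i _; rewrite !mxE; ring.
    ring.
  by rewrite pmulr_rge0// subr_ge0.
apply: le_trans (ler_norm _) _.
by rewrite -sqrtr_sqr -sqrtrM ?nsq_ge0// ler_sqrt// mulr_ge0// nsq_ge0.
Qed.

Lemma enorm0 : enorm (0 : V) = 0.
Proof. by rewrite /enorm big1 ?sqrtr0// => i _; rewrite mxE expr0n. Qed.

Lemma measurable_nsq d1 (X : measurableType d1) (q : X -> V) : meas_vec q ->
  measurable_fun setT (fun x => nsq (q x)).
Proof.
move=> mq; apply: measurable_sum => i; apply: measurable_funX.
exact: measurable_coord.
Qed.

Lemma measurable_enorm d1 (X : measurableType d1) (q : X -> V) : meas_vec q ->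
  measurable_fun setT (fun x => enorm (q x)).
Proof.
move=> mq; apply: (measurableT_comp (f := @Num.sqrt R)); last exact: measurable_nsq.
by apply: continuous_measurable_fun; exact: sqrt_continuous.
Qed.

Lemma Meas_ball (r : R) : Meas (fun x => if enorm x < r then 1 else 0).
Proof.
apply: measurable_fun_ifT => //.
by apply: measurable_fun_ltr => //; exact: measurable_enorm (@meas_vec_rv _ _).
Qed.

Lemma Intg_cube (r : R) :
  Intg (fun x => \1_[set t | forall i, - r <= t 0 i <= r] x).
Proof.
apply: (@eq_integrable _ _ _ _ _ _ (EFin \o \1_(@tbox R d (fun=> -r) (fun=> r)))) => //.
  move=> t _ /=; congr EFin; rewrite !indicE.
  congr ((nat_of_bool _)%:R).
  by apply/idP/idP; rewrite !inE => H i; have := H i; rewrite mxE.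
have mT := @measurable_tbox R d (fun=> - r) (fun=> r).
apply/integrableP; split; first exact/measurable_EFinP/measurable_indic.
rewrite (eq_integral (fun x => (\1_(@tbox R d (fun=> - r) (fun=> r)) x)%:E)); last first.
  by move=> t _; rewrite gee0_abs// lee_fin.
rewrite integral_indic// setIT.
have [r0|r0] := leP 0 r.
  have E := @measure_tbox R d (fun=> - r) (fun=> r).
  by rewrite [X in (X < _)%E]E ?ltry// => i _; rewrite ge0_cp.
(* For negative [r] the sides are not ordered, as the volume formula requires; the set is compared
   with the one-point box at 0 that contains it. *)
apply: (@le_lt_trans _ _ (mu R d (@tbox R d (fun=> 0) (fun=> 0)))).
  apply: le_measure; rewrite ?inE; [exact: measurable_tbox|exact: measurable_tbox|].
  by move=> t H i; have := H i; lra.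
by rewrite measure_tbox ?ltry.
Qed.

Lemma Intg_bounded f (M r : R) : Meas f -> (forall x, `|f x| <= M) ->
  (forall x, r <= enorm x -> f x = 0) -> Intg f.
Proof.
move=> mf fM fr; apply: (le_Intg mf (IntgZ M (Intg_cube r))) => x.
rewrite indicE; case: (boolP (_ \in _)) => [_|].
  by rewrite mulr1.
rewrite notin_setE /= => H; rewrite fr ?normr0 ?mulr0//.
rewrite leNgt; apply/negP => xr; apply: H => i.
by rewrite -ler_norml (le_trans (coord_le_enorm _ _))// ltW.
Qed.

Lemma rv_taffine (a : R) (c : V) (t : tup d) :
  rv (taffine a (nat_coord c) t) = a *: rv t + c.
Proof. by apply/rowP => i; rewrite !mxE tnth_mktuple nat_coordE. Qed.

Lemma Meas_affine (a : R) (c : V) f : Meas f -> Meas (fun x => f (a *: x + c)).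
Proof.
move=> mf; rewrite /Meas.
rewrite (_ : _ \o rv = (f \o rv) \o taffine a (nat_coord c)); last first.
  by apply/funext => t; rewrite /= rv_taffine.
apply: measurableT_comp; [exact: mf|exact: measurable_taffine].
Qed.

Lemma ge0_Int_affine (a : R) (c : V) f : 0 < a -> Meas f -> (forall x, 0 <= f x) ->
  (\int[mu R d]_t (f (rv t))%:E = (a ^+ d)%:E * \int[mu R d]_t (f (a *: rv t + c))%:E)%E.
Proof.
move=> a0 mf f0.
rewrite (ge0_integral_taffine (nat_coord c) a0)//.
- by congr (_ * _)%E; apply: eq_integral => t _; rewrite rv_taffine.
- exact/measurable_EFinP.
- by move=> t; rewrite lee_fin.
Qed.

Lemma Intg_affine (a : R) (c : V) f : 0 < a -> Intg f -> Intg (fun x => f (a *: x + c)).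
Proof.
move=> a0 fi; apply/integrableP; split.
  by apply/measurable_EFinP; apply: Meas_affine; exact: Intg_Meas.
have /integrableP[_] := fi.
under eq_integral do rewrite /=.
rewrite (ge0_Int_affine c a0 (Meas_norm (Intg_Meas fi))) => [H|//].
have an : 0 < a ^+ d by rewrite exprn_gt0.
move: H; rewrite -[X in (_ < X)%E -> _](@gt0_muley _ (a ^+ d)%:E) ?lte_fin//.
by rewrite lte_pmul2l//= ?lte_fin.
Qed.

Lemma Int_affine (a : R) (c : V) f : 0 < a -> Intg f ->
  Int f = a ^+ d * Int (fun x => f (a *: x + c)).
Proof.
move=> a0 fi.
pose fp x := Num.max (f x) 0; pose fn x := Num.max (- f x) 0.
have mp : Meas fp by apply: measurable_maxr => //; exact: Intg_Meas.
have mn : Meas fn.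
  by apply: measurable_maxr => //; apply: measurableT_comp => //; exact: Intg_Meas.
have ip : Intg fp.
  apply: (le_Intg mp (Intg_norm fi)) => x; rewrite /fp.
  by case: (leP (f x) 0) => ?; rewrite ?normr0.
have in' : Intg fn.
  apply: (le_Intg mn (Intg_norm fi)) => x; rewrite /fn.
  by case: (leP (- f x) 0) => ?; rewrite ?normr0// normrN.
have fE x : f x = fp x - fn x.
  rewrite /fp /fn; case: (leP (f x) 0); case: (leP (- f x) 0); lra.
have key g : Intg g -> (forall x, 0 <= g x) -> Int g = a ^+ d * Int (fun x => g (a *: x + c)).
  move=> ig g0; apply: EFin_inj; rewrite EFinM !IntE//; last exact: Intg_affine.
  by apply: ge0_Int_affine => //; exact: Intg_Meas.
have -> : Int f = Int fp - Int fn by rewrite -IntB//; congr Int; apply/funext.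
have -> : Int (fun x => f (a *: x + c)) = Int (fun x => fp (a *: x + c)) - Int (fun x => fn (a *: x + c)).
  rewrite -IntB//; [|exact: Intg_affine|exact: Intg_affine].
  by congr Int; apply/funext => x.
rewrite mulrBr -!key// => x; rewrite /fp /fn le_max lexx orbT//.
Qed.

Lemma Int_shift (c : V) f : Intg f -> Int (fun x => f (x + c)) = Int f.
Proof.
move=> fi; rewrite (Int_affine c ltr01 fi) expr1n mul1r.
by under [in RHS]eq_fun do rewrite scale1r.
Qed.

Lemma Intg_shift (c : V) f : Intg f -> Intg (fun x => f (x + c)).
Proof. by move=> /(Intg_affine c ltr01); under eq_fun do rewrite scale1r. Qed.

End Integral.

(** * Null sets and Borel versions *)

Section NullSets.
Context (R : realType) (d : nat).
Notation tup n := (n.-tuple (measurableTypeR R)).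
Notation V := 'rV[R]_d.

(** Covers by boxes of total volume at most 1/(k+1) are intersected over all k, which gives a Borel
    set of measure zero. *)
Lemma lebesgue_null_measurable_cover (N : set V) : lebesgue_null N ->
  exists A : set (tup d), [/\ measurable A, mu R d A = 0%E &
    forall t, N (rv t) -> A t].
Proof.
move=> nullN.
have e0 k : (0 : R) < k.+1%:R^-1 by rewrite invr_gt0.
have /choice[ab Hab] : forall k : nat, exists ab : (nat -> V) * (nat -> V),
    (forall n i, ab.1 n 0 i <= ab.2 n 0 i) /\
    N `<=` \bigcup_n [set x | forall i, ab.1 n 0 i <= x 0 i <= ab.2 n 0 i] /\
    forall m, \sum_(n < m) \prod_(i < d) (ab.2 n 0 i - ab.1 n 0 i) <= k.+1%:R^-1.
  by move=> k; have [a [b H]] := nullN _ (e0 k); exists (a, b).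
pose B k n := @tbox R d (nat_coord ((ab k).1 n)) (nat_coord ((ab k).2 n)).
have mB k n : measurable (B k n) by exact: measurable_tbox.
have muB k n : mu R d (B k n) = (\prod_(i < d) ((ab k).2 n 0 i - (ab k).1 n 0 i))%:E.
  rewrite measure_tbox; last first.
    by move=> i id; have := (Hab k).1 n (Ordinal id); rewrite -!nat_coordE.
  by congr EFin; apply: eq_bigr => i _; rewrite !nat_coordE.
exists (\bigcap_k \bigcup_n B k n).
have mU k : measurable (\bigcup_n B k n) by exact: bigcupT_measurable.
have mA : measurable (\bigcap_k \bigcup_n B k n) by exact: bigcapT_measurable.
split => //.
- apply/eqP; rewrite eq_le measure_ge0 andbT.
  apply/lee_addgt0Pr => e ep; rewrite add0e.
  have [k ke] : exists k, k.+1%:R^-1 < e.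
    have [k _ Hk] := near_infty_natSinv_lt (PosNum ep).
    by exists k; apply: Hk => /=.
  apply: (@le_trans _ _ (k.+1%:R^-1%:E)); last by rewrite lee_fin ltW.
  have sub : \bigcap_k \bigcup_n B k n `<=` \bigcup_n B k n by move=> t /(_ k I).
  apply: (@le_trans _ _ (\sum_(n <oo) mu R d (B k n))%E).
    exact: (@measure_sigma_subadditive _ _ _ (mu R d) _ _ (mB k) mA sub).
  apply: lime_le; first by apply: is_cvg_nneseries => n _ _.
  near=> m; rewrite big_mkord; under eq_bigr do rewrite muB.
  by rewrite sumEFin lee_fin; exact: (Hab k).2.2.
- move=> t Nt k _; have [n _ Hn] := (Hab k).2.1 _ Nt.
  by exists n => // i; have := Hn i; rewrite !nat_coordE mxE.
Unshelve. all: by end_near. Qed.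

(** Off [A] the function is continuous, so there the preimage of an open set coincides with its
    interior; on [A] the value is reset to 0, which makes the remaining part either [A] or empty. *)
Lemma ae_continuous_borel_version (f : V -> R) :
  lebesgue_null [set x | ~ {for x, continuous f}] ->
  exists A : set (tup d), [/\ measurable A, mu R d A = 0%E,
    Meas (fun x => if tv x \in A then 0 else f x) &
    forall t, ~ A t -> {for rv t, continuous f}].
Proof.
move=> /lebesgue_null_measurable_cover[A [mA A0 HA]]; exists A; split => //; last first.
  by move=> t At; apply: contrapT => H; apply: At; exact: HA.
apply: (measurability _ (RGenOpens.measurableE R)).
move=> _ [_ [a [b ->] <-]]; rewrite setTI.
set O := [set` _]; have oO : open O by exact: interval_open.
have -> : ((fun x => if tv x \in A then 0 else f x) \o rv) @^-1` O =
    (~` A `&` rv @^-1` (interior (f @^-1` O))) `|`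
    (A `&` (if `[< O 0 >] then setT else set0)).
  apply/seteqP; split=> t /=; rewrite rvK.
    case: (boolP (t \in A)) => [tA Ot|].
      by right; split; [exact: set_mem|rewrite ifT//; exact/asboolP].
    rewrite notin_setE => tA Ot; left; split => //.
    have ct : {for rv t, continuous f} by apply: contrapT => H; apply: tA; exact: HA.
    by apply: ct; exact: open_nbhs_nbhs.
  move=> [[tA /interior_subset Ot]|[tA]].
    by rewrite memNset.
  by case: ifPn => // /asboolP O0 _; rewrite mem_set.
apply: measurableU; apply: measurableI => //.
- exact: measurableC.
- by apply: measurable_preimage_open; [exact: meas_vec_rv|exact: open_interior].
- by case: ifPn.
Qed.

End NullSets.

(** * Test functions *)

Section Lines.
Context (R : realType) (d : nat).
Notation V := 'rV[R]_d.

(** Directional derivatives become ordinary derivatives along a line, so that the mean value theorem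
    and the chain rule in one variable apply. *)
Lemma is_derive_line (f : V -> R) (x v : V) (t D : R) :
  is_derive (x + t *: v) v f D <-> is_derive t 1 (fun h : R => f (x + h *: v)) D.
Proof.
have E : (fun h : R => h^-1 *: ((f \o shift (x + t *: v)) (h *: v) - f (x + t *: v))) =
    (fun h : R => h^-1 *: (((fun h : R => f (x + h *: v)) \o shift t) (h *: (1 : R^o)) - f (x + t *: v))).
  apply/funext => h /=; congr (_ *: (f _ - _)).
  have -> : h *: (1 : R^o) = h by exact: mulr1.
  by rewrite scalerDl addrCA.
by split=> -[H1 H2]; split; move: H1 H2; rewrite /derivable /derive E.
Qed.

Lemma is_derive_line0 (f : V -> R) (x v : V) (D : R) :
  is_derive x v f D <-> is_derive (0 : R) 1 (fun h : R => f (x + h *: v)) D.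
Proof. by rewrite -is_derive_line scale0r addr0. Qed.

End Lines.

Section Smooth.
Context (R : realType) (d : nat).
Notation V := 'rV[R]_d.
Implicit Types (f g : V -> R) (C : (V -> R) -> Prop).

(** A coinduction principle: iterated partial derivatives never leave [C], so first-order
    information on the class suffices. *)
Lemma smooth_class C :
  (forall f, C f -> continuous f /\
     forall i, (forall x, derivable f x (evec R i)) /\ C (partial i f)) ->
  forall f, C f -> smooth f.
Proof.
move=> HC f Cf; have Cs s : C (iterpartial s f).
  by elim: s => [//|i s IHs]; exact: ((HC _ IHs).2 i).2.
by move=> s; split; [exact: (HC _ (Cs s)).1|move=> i; exact: ((HC _ (Cs s)).2 i).1].
Qed.

Lemma smooth_continuous f : smooth f -> continuous f.
Proof. by move=> /(_ [::])[]. Qed.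

Lemma smooth_derivable f i x : smooth f -> derivable f x (evec R i).
Proof. by move=> /(_ [::])[_]; exact. Qed.

Lemma smooth_partial f i : smooth f -> smooth (partial i f).
Proof.
move=> sf s; have -> : iterpartial s (partial i f) = iterpartial (rcons s i) f.
  by rewrite /iterpartial foldr_rcons.
exact: sf.
Qed.

Lemma smooth_iterpartial f s : smooth f -> smooth (iterpartial s f).
Proof. by elim: s => [//|i s IHs] sf; apply: smooth_partial; exact: IHs. Qed.

Lemma is_derive_partial f i x : smooth f -> is_derive x (evec R i) f (partial i f x).
Proof. by move=> sf; apply: derivableP; exact: smooth_derivable. Qed.

(** Smooth functions closed up under sums and products. The Leibniz rule stays inside this class,
    whereas a derivative of a product is no longer a product. *)
Inductive smooth_alg : (V -> R) -> Prop :=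
| SA_base f of smooth f : smooth_alg f
| SA_cst a : smooth_alg (fun=> a)
| SA_add f g of smooth_alg f & smooth_alg g : smooth_alg (fun x => f x + g x)
| SA_mul f g of smooth_alg f & smooth_alg g : smooth_alg (fun x => f x * g x).

Lemma smooth_algP f : smooth_alg f -> smooth f.
Proof.
apply: smooth_class => {}f; elim => {f}.
- move=> f sf; split; first exact: smooth_continuous.
  move=> i; split; first by move=> x; exact: smooth_derivable.
  by apply: SA_base; exact: smooth_partial.
- move=> a; split; first exact: cst_continuous.
  move=> i; split; first by move=> x; exact: derivable_cst.
  rewrite (_ : partial i _ = fun=> 0); first exact: SA_cst.
  by apply/funext => x; exact: derive_cst.
- move=> f g Af [cf Df] Ag [cg Dg]; split; first by move=> x; exact: (cvgD (cf x) (cg x)).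
  move=> i; split; first by move=> x; apply: derivableD; [exact: (Df i).1|exact: (Dg i).1].
  rewrite (_ : partial i _ = fun x => partial i f x + partial i g x).
    by apply: SA_add; [exact: (Df i).2|exact: (Dg i).2].
  by apply/funext => x; apply: deriveD; [exact: (Df i).1|exact: (Dg i).1].
- move=> f g Af [cf Df] Ag [cg Dg]; split; first by move=> x; exact: (cvgM (cf x) (cg x)).
  move=> i; split; first by move=> x; apply: derivableM; [exact: (Df i).1|exact: (Dg i).1].
  rewrite (_ : partial i _ = fun x => f x * partial i g x + g x * partial i f x).
    by apply: SA_add; apply: SA_mul => //; [exact: (Dg i).2|exact: (Df i).2].
  by apply/funext => x; apply: deriveM; [exact: (Df i).1|exact: (Dg i).1].
Qed.

Lemma smooth_cst a : smooth (fun _ : V => a).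
Proof. exact/smooth_algP/SA_cst. Qed.

Lemma smoothD f g : smooth f -> smooth g -> smooth (fun x => f x + g x).
Proof. by move=> sf sg; apply: smooth_algP; apply: SA_add; exact: SA_base. Qed.

Lemma smoothM f g : smooth f -> smooth g -> smooth (fun x => f x * g x).
Proof. by move=> sf sg; apply: smooth_algP; apply: SA_mul; exact: SA_base. Qed.

Lemma smoothZ a f : smooth f -> smooth (fun x => a * f x).
Proof. by move=> sf; apply: smoothM => //; exact: smooth_cst. Qed.

Lemma smooth_sum (I : Type) (s : seq I) (F : I -> V -> R) :
  (forall i, smooth (F i)) -> smooth (fun x => \sum_(i <- s) F i x).
Proof.
move=> sF; elim: s => [|i s IHs].
  by under eq_fun do rewrite big_nil; exact: smooth_cst.
by under eq_fun do rewrite big_cons; exact: smoothD.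
Qed.

Lemma smooth_prod (I : Type) (s : seq I) (F : I -> V -> R) :
  (forall i, smooth (F i)) -> smooth (fun x => \prod_(i <- s) F i x).
Proof.
move=> sF; elim: s => [|i s IHs].
  by under eq_fun do rewrite big_nil; exact: smooth_cst.
by under eq_fun do rewrite big_cons; exact: smoothM.
Qed.

Lemma is_derive_affine g (a D : R) (c x v : V) :
  is_derive (a *: x + c) v g D -> is_derive x v (fun y => g (a *: y + c)) (a * D).
Proof.
rewrite is_derive_line0 => H; apply/is_derive_line0.
rewrite (_ : (fun _ => _) = (fun h => g (a *: x + c + h *: v)) \o (fun h : R => a * h)); last first.
  by apply/funext => h /=; rewrite scalerDr scalerA addrAC.
have H0 : is_derive (0 : R) 1 (fun h : R => a * h) a.
  apply: is_derive_eq; by rewrite [_ *: _]mulr1.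
rewrite mulrC; apply: is_derive1_comp; by rewrite mulr0.
Qed.

Lemma continuous_affine (a : R) (c : V) : continuous (fun y : V => a *: y + c).
Proof.
have H : continuous (fun y : V => a *: y) by exact: scaler_continuous.
by move=> x; apply: (cvgD (H x)); exact: cst_continuous.
Qed.

Lemma partial_affine g (a : R) (c : V) i : smooth g ->
  partial i (fun y => g (a *: y + c)) = fun x => a * partial i g (a *: x + c).
Proof.
move=> sg; apply/funext => x; have [_] := is_derive_affine (is_derive_partial i (a *: x + c) sg).
by [].
Qed.

Lemma smooth_affine g (a : R) (c : V) : smooth g -> smooth (fun y => g (a *: y + c)).
Proof.
move=> sg.
apply: (@smooth_class (fun f => exists b h, smooth h /\ f = fun y => b * h (a *: y + c))); last first.
  by exists 1, g; split => //; apply/funext => y; rewrite mul1r.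
move=> _ [b [h [sh ->]]]; split.
  have cb : continuous (fun _ : V => b) by exact: cst_continuous.
  have ch : continuous (fun y : V => h (a *: y + c)).
    move=> x; apply: (@continuous_comp _ _ _ (fun y : V => a *: y + c) h x).
      exact: continuous_affine.
    exact: smooth_continuous.
  by move=> x; exact: (cvgM (cb x) (ch x)).
move=> i; have D x : is_derive x (evec R i) (fun y => b * h (a *: y + c)) (b * (a * partial i h (a *: x + c))).
  have H := is_derive_affine (is_derive_partial i (a *: x + c) sh).
  by have := is_deriveZ b H.
split; first by move=> x; have [] := D x.
exists (b * a), (partial i h); split; first exact: smooth_partial.
by apply/funext => x; have [_] := D x; rewrite mulrA.
Qed.

Lemma partialD f g i : smooth f -> smooth g ->
  partial i (fun x => f x + g x) = fun x => partial i f x + partial i g x.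
Proof. by move=> sf sg; apply/funext => x; apply: deriveD; exact: smooth_derivable. Qed.

Lemma partialZ a f i : smooth f -> partial i (fun x => a * f x) = fun x => a * partial i f x.
Proof. by move=> sf; apply/funext => x; apply: deriveZ; exact: smooth_derivable. Qed.

Lemma LapE f x : Lap f x = \sum_(i < d) partial i (partial i f) x.
Proof. by []. Qed.

Lemma smooth_Lap f : smooth f -> smooth (Lap f).
Proof. by move=> sf; apply: (@smooth_sum _ _ (fun i => iterpartial [:: i; i] f)) => i; exact: smooth_iterpartial. Qed.

Lemma Lap_affine g (a : R) (c : V) x : smooth g ->
  Lap (fun y => g (a *: y + c)) x = a ^+ 2 * Lap g (a *: x + c).
Proof.
move=> sg; rewrite !LapE mulr_sumr; apply: eq_bigr => i _.
rewrite partial_affine// partialZ; last by apply: smooth_affine; exact: smooth_partial.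
by rewrite partial_affine; [rewrite mulrA expr2|exact: smooth_partial].
Qed.

Lemma enorm_evec (i : 'I_d) : enorm (evec R i) = 1.
Proof.
rewrite /enorm (bigD1 i)//= /evec mxE !eqxx/= expr1n big1 ?addr0 ?sqrtr1// => j ji.
by rewrite mxE (negbTE ji) andbF expr0n.
Qed.

(** The strict inequality makes [f] vanish on a whole neighbourhood of [x], where the derivative can
    be read off. *)
Lemma partial_vanish f i r : (forall x, r <= enorm x -> f x = 0) ->
  forall x, r < enorm x -> partial i f x = 0.
Proof.
move=> fr x rx; have : is_derive (0 : R) 1 (fun h : R => f (x + h *: evec R i)) 0.
  have H0 : is_derive (0 : R) 1 (cst (0 : R)) 0 by exact: is_derive_cst.
  apply: (near_eq_is_derive _ H0).
  near=> h; rewrite fr//.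
  have : `|h| < enorm x - r.
    near: h; apply/nbhs_ballP; exists (enorm x - r); first by rewrite /= subr_gt0.
    by move=> h; rewrite /ball /= sub0r normrN.
  have := enorm_triangle (x + h *: evec R i) (- (h *: evec R i)).
  rewrite addrK enormN.
  have -> : enorm (h *: evec R i) = `|h|.
    have [h0|h0] := leP 0 h; first by rewrite enormZ// enorm_evec mulr1 ger0_norm.
    by rewrite -enormN -scaleNr enormZ ?enorm_evec ?mulr1 ?ltr0_norm//; lra.
  by lra.
by move=> /is_derive_line0[].
Unshelve. all: by end_near. Qed.

Lemma iterpartial_vanish f s r : (forall x, r <= enorm x -> f x = 0) ->
  forall x, r < enorm x -> iterpartial s f x = 0.
Proof.
move=> fr; have [->|s0] := eqVneq s [::]; first by move=> x rx; apply: fr; exact: ltW.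
elim: s s0 => [//|i s IHs] _ x rx /=.
have Hs y : r < enorm y -> iterpartial s f y = 0.
  case: (s) IHs => [|j s'] IHs; first by move=> /ltW; exact: fr.
  exact: IHs.
apply: (@partial_vanish _ i ((r + enorm x) / 2)); last lra.
by move=> y ry; apply: Hs; lra.
Qed.

Lemma test_fun_iterpartial f s : test_fun f -> test_fun (iterpartial s f).
Proof.
move=> [sf [r fr]]; split; first exact: smooth_iterpartial.
exists (r + 1) => x rx; apply: (iterpartial_vanish s fr); lra.
Qed.

Lemma test_fun_partial f i : test_fun f -> test_fun (partial i f).
Proof. exact: (@test_fun_iterpartial _ [:: i]). Qed.

Lemma test_funD f g : test_fun f -> test_fun g -> test_fun (fun x => f x + g x).
Proof.
move=> [sf [r fr]] [sg [r' gr]]; split; first exact: smoothD.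
exists (Num.max r r') => x; rewrite ge_max => /andP[rx r'x].
by rewrite fr// gr// addr0.
Qed.

Lemma test_funZ a f : test_fun f -> test_fun (fun x => a * f x).
Proof.
move=> [sf [r fr]]; split; first exact: smoothZ.
by exists r => x rx; rewrite fr// mulr0.
Qed.

Lemma test_fun0 : test_fun (fun _ : V => 0).
Proof. by split; [exact: smooth_cst|exists 0]. Qed.

Lemma test_fun_sum (I : Type) (s : seq I) (F : I -> V -> R) :
  (forall i, test_fun (F i)) -> test_fun (fun x => \sum_(i <- s) F i x).
Proof.
move=> sF; elim: s => [|i s IHs].
  by under eq_fun do rewrite big_nil; exact: test_fun0.
by under eq_fun do rewrite big_cons; exact: test_funD.
Qed.

Lemma test_fun_Lap f : test_fun f -> test_fun (Lap f).
Proof. by move=> tf; apply: (@test_fun_sum _ _ (fun i => iterpartial [:: i; i] f)) => i; exact: test_fun_iterpartial. Qed.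

Lemma test_fun_in_ballW r f : test_fun_in_ball r f -> test_fun f.
Proof. by move=> [sf [r' [_ fr]]]; split => //; exists r'. Qed.

Lemma test_fun_affine g (a : R) (c : V) : 0 < a -> test_fun g ->
  test_fun (fun y => g (a *: y + c)).
Proof.
move=> a0 [sg [r gr]]; split; first exact: smooth_affine.
exists ((r + enorm c) / a) => x; rewrite ler_pdivrMr// => rx; apply: gr.
have := enorm_triangle (a *: x + c) (- c); rewrite addrK enormN (enormZ _ (ltW a0)).
lra.
Qed.

Lemma test_fun_bounded f : test_fun f -> exists M : R, 0 <= M /\ forall x, `|f x| <= M.
Proof.
move=> [sf [r fr]].
pose A := [set x : V | forall i, `[- `|r|, `|r|]%classic (x ord0 i)].
have cA : compact A by apply: (@rV_compact _ _ (fun=> `[- `|r|, `|r|]%classic)) => i; exact: segment_compact.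
have A0 : A !=set0.
  by exists 0 => i /=; rewrite in_itv/= mxE oppr_le0 normr_ge0.
have cf : {within A, continuous (fun x => `|f x|)}.
  apply: continuous_subspaceT => x.
  exact: (cvg_norm (@smooth_continuous f sf x)).
have [c _ Hc] := EVT_max_rV A0 cA cf.
exists `|f c|; split=> // x; have [xr|xr] := leP r (enorm x).
  by rewrite fr// normr0.
apply: Hc; rewrite inE => i /=; rewrite in_itv/= -ler_norml.
by rewrite (le_trans (coord_le_enorm _ _))// (le_trans (ltW xr))// ler_norm.
Qed.

Lemma test_fun_Intg f : test_fun f -> Intg f.
Proof.
move=> tf; have [M [M0 fM]] := test_fun_bounded tf.
have [sf [r fr]] := tf.
by apply: (Intg_bounded _ fM fr); apply: Meas_continuous; exact: smooth_continuous.
Qed.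

End Smooth.

(** * Taylor and Lipschitz estimates *)

Section SecondDifference.
Context (R : realType).

Lemma MVT_everywhere (f df : R -> R) (a b : R) : a <= b ->
  (forall t : R, is_derive t 1 f (df t)) ->
  exists2 c, a <= c <= b & f b - f a = df c * (b - a).
Proof.
move=> ab H; have cf : {within `[a, b], continuous f}.
  apply: continuous_subspaceT => x.
  by apply: differentiable_continuous; apply/derivable1_diffP; have [] := H x.
have [c] := @MVT_segment R f df a b ab (fun x _ => H x) cf.
by rewrite in_itv/= => ? ?; exists c.
Qed.

(** Two mean value arguments: one for the symmetric remainder [g] on [0, h], whose derivative at [c]
    is f1(c) - f1(-c) - 2 c f2(0), and one for [f1] on [-c, c]. *)
Lemma second_difference_bound (f f1 f2 : R -> R) (h L : R) : 0 <= h ->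
  (forall t : R, is_derive t 1 f (f1 t)) -> (forall t : R, is_derive t 1 f1 (f2 t)) ->
  (forall t, `|t| <= h -> `|f2 t - f2 0| <= L * `|t|) ->
  `|f h + f (- h) - 2 * f 0 - h ^+ 2 * f2 0| <= 2 * L * h ^+ 3.
Proof.
move=> h0 D1 D2 HL.
pose g (t : R) := f t + f (- t) - 2 * f 0 - t ^+ 2 * f2 0.
pose g1 (t : R) := f1 t - f1 (- t) - 2 * t * f2 0.
have Dg (t : R) : is_derive t 1 g (g1 t).
  have H1 : is_derive t 1 (fun t => f (- t)) (- f1 (- t)).
    have H : is_derive t 1 (f \o -%R) (f1 (- t) * -1) by apply: is_derive1_comp.
    by move: H; rewrite mulrN1.
  by apply: is_derive_eq; rewrite /g1 /GRing.scale /=; ring.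
have [c /andP[c0 ch]] := MVT_everywhere h0 Dg.
have -> : g 0 = 0 by rewrite /g oppr0; ring.
rewrite -/(g h) !subr0 => ->.
have cc : - c <= c by lra.
have [e /andP[e1 e2] E] := MVT_everywhere cc D2.
have -> : g1 c = 2 * c * (f2 e - f2 0) by rewrite /g1 E; ring.
have ce : `|e| <= c by rewrite ler_norml e1.
have ec : `|f2 e - f2 0| <= L * `|e| by apply: HL; rewrite (le_trans ce).
rewrite !normrM (ger0_norm h0) (ger0_norm c0) ger0_norm//.
have L0 : 0 <= L * `|e| by apply: le_trans ec.
have [L1|L1] := leP 0 L.
  rewrite (_ : 2 * L * h ^+ 3 = 2 * h * (L * h) * h); last by ring.
  apply: ler_wpM2r => //; apply: ler_pM => //.
  - by rewrite mulr_ge0.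
  - by lra.
  - by apply: (le_trans ec); apply: ler_wpM2l => //; lra.
(* A negative [L] forces [e = 0], and then the hypothesis at [h] forces [h = 0]. *)
have e0 : e = 0.
  apply/eqP; rewrite -normr_le0; by move: L0; rewrite -{1}(mulr0 L) ler_nM2l.
rewrite e0 subrr normr0 mulr0 mul0r.
have [hz|hz] := eqVneq h 0; first by rewrite hz expr0n mulr0.
have hp : 0 < h by rewrite lt0r hz.
have := HL h; rewrite ger0_norm// lexx => /(_ isT) H; exfalso.
by have := le_trans (normr_ge0 _) H; rewrite pmulr_lge0// leNgt L1.
Qed.

Context (d : nat).
Notation V := 'rV[R]_d.
Implicit Types f : V -> R.

Lemma is_derive_partial_line f i (x : V) (t : R) : smooth f ->
  is_derive t 1 (fun h : R => f (x + h *: evec R i)) (partial i f (x + t *: evec R i)).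
Proof. by move=> sf; apply/is_derive_line; exact: is_derive_partial. Qed.

Lemma partial_lipschitz_line f i (x : V) (C t : R) : smooth f ->
  (forall y, `|partial i f y| <= C) ->
  `|f (x + t *: evec R i) - f x| <= C * `|t|.
Proof.
move=> sf fC.
have [t0|t0] := leP 0 t.
  have [c _] := MVT_everywhere t0 (fun s => is_derive_partial_line i x s sf).
  rewrite scale0r addr0 subr0 => ->; rewrite normrM; apply: ler_wpM2r => //.
have [c _] := MVT_everywhere (ltW t0) (fun s => is_derive_partial_line i x s sf).
rewrite scale0r addr0 sub0r distrC => ->; rewrite normrM normrN; apply: ler_wpM2r => //.
Qed.

Lemma test_fun_second_difference f : test_fun f ->
  exists C : R, 0 <= C /\ forall x i h, 0 <= h ->
    `|f (x + h *: evec R i) + f (x - h *: evec R i) - 2 * f x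
      - h ^+ 2 * partial i (partial i f) x| <= C * h ^+ 3.
Proof.
move=> tf; have sf := tf.1.
have /choice[C HC] : forall i, exists C : R, 0 <= C /\ forall x, `|partial i (partial i (partial i f)) x| <= C.
  by move=> i; apply: test_fun_bounded; exact: (test_fun_iterpartial [:: i; i; i]).
exists (2 * \sum_i C i); split.
  by rewrite mulr_ge0// sumr_ge0// => i _; exact: (HC i).1.
move=> x i h h0.
have si := smooth_partial i sf.
have sii := smooth_partial i si.
have := @second_difference_bound (fun t => f (x + t *: evec R i))
  (fun t => partial i f (x + t *: evec R i)) (fun t => partial i (partial i f) (x + t *: evec R i))
  h (C i) h0 (fun t => is_derive_partial_line i x t sf) (fun t => is_derive_partial_line i x t si).
rewrite scale0r addr0 scaleNr => H; apply: (le_trans (H _)).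
  move=> t _; apply: partial_lipschitz_line => // y; exact: (HC i).2.
apply: ler_wpM2r; first exact: exprn_ge0.
apply: ler_wpM2l => //; rewrite (bigD1 i)//= lerDl.
by apply: sumr_ge0 => j _; exact: (HC j).1.
Qed.

(** Interpolates from [x] to [y]: consecutive values of [k] differ in a single coordinate, so a
    telescoping sum reduces the Lipschitz bound to one partial derivative at a time. *)
Definition splice (k : nat) (x y : V) : V :=
  \row_i (if (i < k)%N then y 0 i else x 0 i).

Lemma test_fun_lipschitz f : test_fun f ->
  exists C : R, 0 <= C /\ forall x y, `|f x - f y| <= C * \sum_i `|x 0 i - y 0 i|.
Proof.
move=> tf; have sf := tf.1.
have /choice[C HC] : forall i, exists C : R, 0 <= C /\ forall x, `|partial i f x| <= C.
  by move=> i; apply: test_fun_bounded; exact: test_fun_partial.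
exists (\sum_i C i); split; first by apply: sumr_ge0 => i _; exact: (HC i).1.
move=> x y.
have step (i : 'I_d) : `|f (splice i.+1 x y) - f (splice i x y)| <= (\sum_i C i) * `|x 0 i - y 0 i|.
  have -> : splice i.+1 x y = splice i x y + (y 0 i - x 0 i) *: evec R i.
    apply/rowP => j; rewrite !mxE eqxx /= ltnS eq_sym.
    have [->|ji] := eqVneq j i; first by rewrite leqnn ltnn /= mulr1 addrC subrK.
    rewrite mulr0 addr0 leq_eqVlt; case: eqVneq => [E|//].
    by rewrite (val_inj E) eqxx in ji.
  apply: le_trans (partial_lipschitz_line _ _ sf (HC i).2) _.
  rewrite distrC; apply: ler_wpM2r => //; rewrite (bigD1 i)//= lerDl.
  by apply: sumr_ge0 => j _; exact: (HC j).1.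
have -> : f x - f y = - \sum_(i < d) (f (splice i.+1 x y) - f (splice i x y)).
  rewrite -(big_mkord xpredT (fun i => f (splice i.+1 x y) - f (splice i x y))).
  rewrite telescope_sumr// opprB; congr (f _ - f _); apply/rowP => i; rewrite mxE//.
  by rewrite ltn_ord.
rewrite normrN mulr_sumr; apply: le_trans (ler_norm_sum _ _ _) _.
by apply: ler_sum => i _; exact: step.
Qed.

End SecondDifference.

Lemma near_norm_le (R : realType) (e : R) : 0 < e -> \forall h \near nbhs (0 : R), `|h| <= e.
Proof.
move=> e0; apply/nbhs_ballP; exists e => //= h.
by rewrite /ball /= sub0r normrN => /ltW.
Qed.

(** * A smooth bump function *)

Section Bump.
Context (R : realType).

(** [expinv p] is smooth on the whole line; the polynomial factor is what
    differentiating [exp (- 1 / t)] repeatedly produces. *)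
Definition expinv (p : {poly R}) (t : R) : R :=
  if 0 < t then p.[t^-1] * expR (- t^-1) else 0.

Lemma horner_le_monomial (p : {poly R}) : exists K : R, 0 <= K /\
  forall s, 1 <= s -> `|p.[s]| <= K * s ^+ size p.
Proof.
exists (\sum_(i < size p) `|p`_i|); split; first exact: sumr_ge0.
move=> s s1; rewrite horner_coef mulr_suml; apply: le_trans (ler_norm_sum _ _ _) _.
apply: ler_sum => i _; rewrite normrM; apply: ler_wpM2l => //.
rewrite ger0_norm ?exprn_ge0//; last by lra.
by apply: ler_weXn2l => //; exact: ltnW.
Qed.

Lemma expinv_flat (p : {poly R}) : exists K : R, 0 <= K /\
  forall t, `|t| <= 1 -> `|expinv p t| <= K * t ^+ 2.
Proof.
have [K [K0 HK]] := horner_le_monomial p.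
(* The exponential series then supplies the power [size p + 2] of 1/t: [size p] factors absorb the
   polynomial, the other two leave t^2. *)
pose n := (size p).+1.
exists (K * n.+1`!%:R); split; first by rewrite mulr_ge0// ler0n.
move=> t t1; rewrite /expinv; case: ifPn => [t0|_]; last first.
  by rewrite normr0 mulr_ge0 ?sqr_ge0// mulr_ge0// ler0n.
have tV1 : 1 <= t^-1 by rewrite invf_ge1//; move: t1; rewrite gtr0_norm.
have tV0 : 0 < t^-1 by rewrite invr_gt0.
rewrite normrM [X in _ * X]gtr0_norm ?expR_gt0// expRN ler_pdivrMr ?expR_gt0//.
apply: (le_trans (HK _ tV1)).
have := expR_ge1Dxn n (ltW tV0).
have f0 : (0 : R) < n.+1`!%:R by rewrite ltr0n fact_gt0.
move=> E; have {E} E : t^-1 ^+ n.+1 <= n.+1`!%:R * expR t^-1.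
  by rewrite -ler_pdivrMl// mulrC; lra.
rewrite -!mulrA; apply: ler_wpM2l => //.
have -> : t^-1 ^+ size p = t ^+ 2 * t^-1 ^+ n.+1.
  have -> : t^-1 ^+ n.+1 = t^-1 ^+ 2 * t^-1 ^+ size p by rewrite -exprD add2n.
  by rewrite mulrA -exprMn divff ?gt_eqF// expr1n mul1r.
rewrite [leRHS](_ : _ = t ^+ 2 * (n.+1`!%:R * expR t^-1)); last by ring.
  by apply: ler_wpM2l => //; rewrite sqr_ge0.
Qed.

(** For t > 0 the derivative of p(1/t) exp(-1/t) is t^-2 (p - p')(1/t) exp(-1/t). At 0 the quadratic
    bound makes the difference quotient tend to 0. *)
Lemma is_derive_expinv (p : {poly R}) (t : R) :
  is_derive t 1 (expinv p) (expinv ('X^2 * (p - p^`())) t).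
Proof.
have [t0|t0|t0] := ltgtP t 0.
- apply: (@near_eq_is_derive _ _ _ (cst (0 : R))).
    by near=> s; rewrite /expinv ltNge ltW//; near: s; exact: lt_nbhsl.
  by rewrite /expinv ltNge ltW//; exact: is_derive_cst.
- have tn : t != 0 by rewrite gt_eqF.
  apply: (@near_eq_is_derive _ _ _ (fun s : R => p.[s^-1] * expR (- s^-1))).
    near=> s; rewrite /expinv ifT//; near: s; exact: lt_nbhsr.
  have HV : is_derive t 1 (fun s : R => s^-1) (- t ^- 2).
    apply: DeriveDef; first by apply: derivableV.
    by rewrite deriveV// derive_id; exact: mulr1.
  have Hp : is_derive t 1 (fun s : R => p.[s^-1]) (p^`().[t^-1] * (- t ^- 2)).
    exact: (@is_derive1_comp _ (horner p) (fun s : R => s^-1)).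
  have He : is_derive t 1 (fun s : R => expR (- s^-1)) (expR (- t^-1) * (- (- t ^- 2))).
    apply: (@is_derive1_comp _ expR (fun s : R => - s^-1)).
  rewrite /expinv t0; apply: is_derive_eq.
  rewrite /GRing.scale /=  hornerM hornerXn hornerD hornerN; field.
  by [].
- rewrite t0 /expinv ltxx.
  have [K [K0 HK]] := expinv_flat p.
  have lim0 : (fun h : R => h^-1 *: ((expinv p \o shift 0) (h *: (1 : R)) - expinv p 0)) @ 0^' --> (0 : R).
    apply/cvgrPdist_le => e e0; near=> h.
    have hn : h != 0 by near: h; exact: nbhs_dnbhs_neq.
    rewrite sub0r normrN /= addr0 [h *: _]mulr1 {2}/expinv ltxx subr0 normrZ normfV.
    have h1 : `|h| <= 1.
      near: h; apply: nbhs_dnbhs; exact: near_norm_le.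
    have he : `|h| <= e / (K + 1).
      by near: h; apply: nbhs_dnbhs; apply: near_norm_le; rewrite divr_gt0// ltr_wpDl.
    rewrite ler_pdivrMl ?normr_gt0//; apply: le_trans (HK _ h1) _.
    rewrite -[h ^+ 2]real_normK ?num_real// expr2 mulrCA; apply: ler_wpM2l => //.
    move: he; rewrite ler_pdivlMr ?ltr_wpDl// => he; apply: le_trans he.
    by rewrite mulrC; apply: ler_wpM2l => //; lra.
  split; first by apply/cvg_ex; exists 0.
  exact: cvg_lim lim0.
Unshelve. all: by end_near. Qed.

Context (d : nat).
Notation V := 'rV[R]_d.

Lemma is_derive_coord (f : R -> R) (D : R) (x : V) (i j : 'I_d) :
  is_derive (x 0 i) 1 f D ->
  is_derive x (evec R j) (fun y : V => f (y 0 i)) (if i == j then D else 0).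
Proof.
move=> H; apply/is_derive_line0.
have [E|ij] := eqVneq i j; last first.
  rewrite (_ : (fun _ => _) = cst (f (x 0 i))); first exact: is_derive_cst.
  by apply/funext => h; rewrite !mxE (negbTE ij) andbF mulr0 addr0.
rewrite (_ : (fun _ => _) = f \o (fun h : R => h + x 0 i)); last first.
  by apply/funext => h /=; rewrite !mxE E !eqxx mulr1 addrC.
have H1 : is_derive (0 : R) 1 (fun h : R => h + x 0 i) 1 by exact: is_derive_shift.
by rewrite -[D]mulr1; apply: is_derive1_comp; rewrite add0r.
Qed.

Lemma smooth_expinv_coord p (i : 'I_d) : smooth (fun x : V => expinv p (x 0 i)).
Proof.
apply: (@smooth_class _ _ (fun f => exists q, f = fun x : V => expinv q (x 0 i))); last by exists p.
move=> _ [q ->]; split.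
  move=> x; apply: (@continuous_comp _ _ _ (fun y : V => y 0 i) (expinv q) x).
    exact: coord_continuous.
  by apply: differentiable_continuous; apply/derivable1_diffP; have [] := is_derive_expinv q (x 0 i).
move=> j; have H (x : V) := is_derive_coord j (is_derive_expinv q (x 0 i)).
split; first by move=> x; have [] := H x.
exists (if i == j then 'X^2 * (q - q^`()) else 0).
apply/funext => x; have [_] := H x; rewrite /partial => ->.
by case: ifP => // _; rewrite /expinv horner0 mul0r if_same.
Qed.

(** A product of one-variable bumps, vanishing outside the cube [-1, 1]^d. The two factors are
    exchanged by a change of sign of x_i, which makes the product even. *)
Definition cutoff (x : V) : R :=
  \prod_(i < d) (expinv 1 (x 0 i + 1) * expinv 1 (1 - x 0 i)).

Lemma expinv1_ge0 t : 0 <= expinv 1 t.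
Proof. by rewrite /expinv; case: ifP => // _; rewrite hornerE mul1r expR_ge0. Qed.

Lemma expinv1_gt0 t : 0 < t -> 0 < expinv 1 t.
Proof. by move=> t0; rewrite /expinv t0 hornerE mul1r expR_gt0. Qed.

Lemma expinv1_incr s t : s <= t -> expinv 1 s <= expinv 1 t.
Proof.
rewrite /expinv => st; case: ifPn => s0; last by case: ifP => // _; rewrite hornerE mul1r expR_ge0.
by rewrite (lt_le_trans s0 st) !hornerE ?mul1r ler_expR lerN2 lef_pV2// posrE// (lt_le_trans s0).
Qed.

Lemma cutoff_ge0 x : 0 <= cutoff x.
Proof. by apply: prodr_ge0 => i _; rewrite mulr_ge0// expinv1_ge0. Qed.

Lemma cutoffN x : cutoff (- x) = cutoff x.
Proof.
by apply: eq_bigr => i _; rewrite mxE opprK mulrC; congr (expinv 1 _ * expinv 1 _); ring.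
Qed.

Lemma cutoff_vanish x : d.+1%:R <= enorm x -> cutoff x = 0.
Proof.
move=> dx; have [H|H] := pselect (exists i : 'I_d, 1 <= `|x 0 i|).
  have [i xi] := H; rewrite /cutoff (bigD1 i)//=.
  suff -> : expinv 1 (x 0 i + 1) * expinv 1 (1 - x 0 i) = 0 by rewrite mul0r.
  move: xi; rewrite ler_normr => /orP[xi|xi].
    by rewrite [X in _ * X]/expinv ltNge subr_le0 xi mulr0.
  by rewrite [X in X * _]/expinv ltNge -lerBrDr sub0r lerNr xi mul0r.
have : enorm x <= d%:R * 1.
  apply: enorm_le_coord => // i; rewrite leNgt; apply/negP => xi.
  by apply: H; exists i; exact: ltW.
by rewrite mulr1 => /(le_trans dx); rewrite ler_nat ltnn.
Qed.

Lemma cutoff_test_fun : test_fun cutoff.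
Proof.
split; last by exists d.+1%:R; exact: cutoff_vanish.
apply: smooth_prod => i; apply: smoothM.
  have -> : (fun x : V => expinv 1 (x 0 i + 1)) =
      (fun y => expinv 1 ((1 *: y + const_mx 1 : V) 0 i)).
    by apply/funext => x; rewrite !mxE mul1r.
  exact: (@smooth_affine _ _ (fun x : V => expinv 1 (x 0 i)) 1 (const_mx 1) (smooth_expinv_coord 1 i)).
have -> : (fun x : V => expinv 1 (1 - x 0 i)) =
    (fun y => expinv 1 (((-1) *: y + const_mx 1 : V) 0 i)).
  by apply/funext => x; rewrite !mxE mulN1r addrC.
exact: (@smooth_affine _ _ (fun x : V => expinv 1 (x 0 i)) (-1) (const_mx 1) (smooth_expinv_coord 1 i)).
Qed.

Lemma cutoff_lower_bound : exists m : R, 0 < m /\ forall x, enorm x <= 2^-1 -> m <= cutoff x.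
Proof.
exists ((expinv 1 2^-1 * expinv 1 2^-1) ^+ d); split.
  by rewrite exprn_gt0// mulr_gt0// expinv1_gt0.
move=> x xr; rewrite -[X in _ ^+ X]card_ord -prodr_const.
apply: ler_prod => i _; rewrite mulr_ge0 ?expinv1_ge0//=.
have := le_trans (coord_le_enorm x i) xr; rewrite ler_norml => /andP[? ?].
by apply: ler_pM; rewrite ?expinv1_ge0//; apply: expinv1_incr; lra.
Qed.

End Bump.

(** * The Newtonian kernel *)

Section LayerCake.
Context (R : realType) (d : nat).
Notation leb := (@lebesgue_measure R).
Notation tup n := (n.-tuple (measurableTypeR R)).
Notation V := 'rV[R]_d.

Definition ball1 (x : V) : R := if enorm x < 1 then 1 else 0.
Definition vol1 : R := Int ball1.

Lemma Intg_ball (r : R) : Intg (fun x : V => if enorm x < r then 1 else 0).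
Proof.
apply: (@Intg_bounded _ _ _ 1 r); first exact: Meas_ball.
  by move=> x; case: ifP; rewrite ?normr1 ?normr0.
by move=> x rx; rewrite ltNge rx.
Qed.

Lemma omega_dE : omega_d R d = d%:R * vol1.
Proof. by rewrite /omega_d intRd_Int//; exact: Intg_ball. Qed.

(** The cube of half-side 1/(d+1) lies in the unit ball since d/(d+1) < 1. *)
Lemma vol1_gt0 : 0 < vol1.
Proof.
pose r : R := d.+1%:R^-1.
have r0 : 0 < r by rewrite invr_gt0 ltr0n.
apply: (@lt_le_trans _ _ (Int (fun x : V => \1_[set t : V | forall i, - r <= t 0 i <= r] x))).
  apply: (@lt_le_trans _ _ ((r - (- r)) ^+ d)); first by rewrite exprn_gt0//; lra.
  rewrite -lee_fin IntE; last exact: Intg_cube.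
  have mT := @measurable_tbox R d (fun=> - r) (fun=> r).
  have := integral_indic (mu R d) measurableT mT.
  have E := @measure_tbox R d (fun=> - r) (fun=> r).
  rewrite setIT [X in _ = X -> _]E; last by move=> i _; lra.
  rewrite prodr_const card_ord => <-.
  rewrite le_eqVlt; apply/orP; left; apply/eqP; apply: eq_integral => t _; congr EFin.
  rewrite !indicE; congr ((nat_of_bool _)%:R).
  by apply/idP/idP; rewrite !inE => H i; have := H i; rewrite mxE.
apply: le_Int; [exact: Intg_cube|exact: Intg_ball|move=> x].
rewrite indicE /ball1; case: (boolP (_ \in _)) => [|_]; last by case: ifP.
rewrite inE /= => H; rewrite ifT//.
apply: (@le_lt_trans _ _ (d%:R * r)).
  by apply: enorm_le_coord; [exact: ltW|move=> i; rewrite ler_norml].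
by rewrite /r ltr_pdivrMr ?ltr0n// mul1r ltr_nat.
Qed.

Lemma nsq_lt (x : V) t : 0 < t -> (nsq x < t) = (enorm ((Num.sqrt t)^-1 *: x) < 1).
Proof.
move=> t0; have s0 : 0 < Num.sqrt t by rewrite sqrtr_gt0.
rewrite enormZ ?invr_ge0 ?sqrtr_ge0// ltr_pdivrMl// mulr1 /enorm -/(nsq x).
by rewrite ltr_sqrt.
Qed.

Lemma integral_ball_sqrt (t : R) :
  (\int[mu R d]_x (if nsq (rv x) < t then 1 else 0)%:E =
   (if 0 < t then Num.sqrt t ^+ d * vol1 else 0)%:E)%E.
Proof.
case: ifPn => t0; last first.
  apply: integral0_eq => x _; rewrite ltNge.
  by rewrite (le_trans _ (nsq_ge0 _))// leNgt.
have s0 : 0 < Num.sqrt t by rewrite sqrtr_gt0.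
have si0 : 0 < (Num.sqrt t)^-1 by rewrite invr_gt0.
pose f (x : V) : R := if nsq x < t then 1 else 0.
have fE : f = fun x => ball1 ((Num.sqrt t)^-1 *: x + 0).
  by apply/funext => x; rewrite /f /ball1 addr0 nsq_lt.
have fi : Intg f by rewrite fE; apply: Intg_affine => //; exact: Intg_ball.
rewrite -(IntE fi) fE; congr EFin.
rewrite /vol1 (Int_affine 0 si0 (Intg_ball 1)) mulrA exprVn divff ?mul1r//.
by rewrite expf_neq0// gt_eqF.
Qed.

(** Tonelli on the region |x|^2 < t, whose slice at [t] is a ball of volume vol1 t^(d/2). A radial
    function written as the integral of [p] over t > |x|^2 is thereby integrated in one variable, in
    place of polar coordinates. *)
Lemma layer_cake (p : R -> R) : measurable_fun setT p -> (forall t, 0 <= p t) ->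
  (\int[mu R d]_x \int[leb]_t (if (nsq (rv x) < t)%R then p t else 0)%:E =
   vol1%:E * \int[leb]_t (if (0 < t)%R then p t * Num.sqrt t ^+ d else 0)%:E)%E.
Proof.
move=> mp p0.
have mh : measurable_fun setT (fun z : tup d * measurableTypeR R =>
    (if nsq (rv z.1) < z.2 then p z.2 else 0)%:E : \bar R).
  apply/measurable_EFinP; apply: measurable_fun_ifT.
  - apply: measurable_fun_ltr => //.
    exact: (@measurable_nsq R d _ _ (fun z : tup d * measurableTypeR R => rv z.1)
              (meas_vec_comp measurable_fst (@meas_vec_rv R d))).
  - by apply: measurableT_comp.
  - exact: measurable_cst.
have mr : measurable_fun setT (fun t : R => if 0 < t then p t * Num.sqrt t ^+ d else 0).
  apply: measurable_fun_ifT => //; first exact: measurable_fun_ltr.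
  apply: measurable_funM => //; apply: measurable_funX.
  by apply: continuous_measurable_fun; exact: sqrt_continuous.
rewrite (fubini_tonelli (m1 := mu R d) (m2 := leb)
  (fun z : tup d * measurableTypeR R => (if nsq (rv z.1) < z.2 then p z.2 else 0)%:E))//; last first.
  by move=> z; rewrite lee_fin; case: ifP.
rewrite -ge0_integralZl//; last 3 first.
- exact/measurable_EFinP.
- by move=> t _; rewrite lee_fin; case: ifP => // _; rewrite mulr_ge0// exprn_ge0// sqrtr_ge0.
- by rewrite lee_fin ltW// vol1_gt0.
apply: eq_integral => t _ /=.
under eq_integral.
  move=> x _; rewrite (_ : (if _ then _ else _)%:E = ((p t)%:E * (if nsq (rv x) < t then 1 else 0)%:E)%E); last first.
    by case: ifP; rewrite ?mule1 ?mule0.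
  over.
rewrite ge0_integralZl//; last 3 first.
- apply/measurable_EFinP; apply: measurable_fun_ifT => //.
  by apply: measurable_fun_ltr => //; exact: measurable_nsq (@meas_vec_rv _ _).
- by move=> x _; rewrite lee_fin; case: ifP.
- by rewrite lee_fin.
rewrite integral_ball_sqrt -!EFinM; congr EFin.
by case: ifP => _; ring.
Qed.

End LayerCake.

Section OneDim.
Context (R : realType).
Notation leb := (@lebesgue_measure R).

Lemma integral_if_gt (a : R) (f : R -> R) :
  (\int[leb]_t (if (a < t)%R then f t else 0)%:E = \int[leb]_(t in `]a, +oo[) (f t)%:E)%E.
Proof.
rewrite [RHS]integral_mkcond; apply: eq_integral => t _.
rewrite patchE; case: ifPn => [at_|at_].
  by rewrite ifT// inE /= in_itv/= at_.
by rewrite ifF//; apply/negbTE; rewrite notin_setE /= in_itv/= andbT; exact/negP.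
Qed.

Lemma ge0_integral_FTC_y (f F : R -> R) (a l : R) : (forall x, a <= x -> 0 <= f x) ->
  (forall x, a <= x -> {for x, continuous f}) ->
  (forall x : R, a < x -> is_derive x 1 F (f x)) -> {for a, continuous F} ->
  F x @[x --> +oo%R] --> l ->
  (\int[leb]_t (if (a < t)%R then f t else 0)%:E = (l - F a)%:E)%E.
Proof.
move=> f0 cf dF cF Fl.
rewrite integral_if_gt integral_itv_obnd_cbnd//; last first.
  apply/measurable_EFinP; apply: open_continuous_measurable_fun => //.
  by move=> x; rewrite inE /= in_itv/= andbT => /ltW; exact: cf.
rewrite EFinB (@ge0_continuous_FTC2y _ f F a l)//.
- apply/continuous_within_itvcyP; split.
    by move=> x; rewrite in_itv/= andbT => /ltW; exact: cf.
  exact: cvg_at_right_filter (cf _ (lexx a)).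
- by move=> x ax; have [] := dF x ax.
- exact: cvg_at_right_filter cF.
- by move=> x; rewrite in_itv/= andbT => ax; rewrite derive1E; have [_] := dF x ax.
Qed.

End OneDim.

(** * Mass of the kernel (1 + |x|^2)^(-d/2-1) *)

Section PowerIntegrals.
Context (R : realType).
Notation leb := (@lebesgue_measure R).

Lemma sqrtX_powR (t : R) n : 0 <= t -> Num.sqrt t ^+ n = t `^ (n%:R / 2).
Proof.
by move=> t0; rewrite -powR12_sqrt// -powR_mulrn ?powR_ge0// -powRrM mulrC.
Qed.

Lemma is_derive_powR_shift (b t : R) : -1 < t ->
  is_derive t 1 (fun t : R => (1 + t) `^ b) (b * (1 + t) `^ (b - 1)).
Proof.
move=> t1; have t0 : 0 < 1 + t by lra.
have H0 : is_derive t 1 (fun t : R => 1 + t) 1.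
  by rewrite (_ : (fun t : R => 1 + t) = (fun t => t + 1)); [exact: is_derive_shift|apply/funext => z; rewrite addrC].
have H1 := is_derive1_powR b t0.
have := @is_derive1_comp _ (fun x => x `^ b) (fun t : R => 1 + t) t _ _ H1 H0.
by rewrite mulr1.
Qed.

Lemma continuous_powR_shift (b t : R) : -1 < t ->
  {for t, continuous (fun t : R => (1 + t) `^ b)}.
Proof.
move=> t1; apply: differentiable_continuous; apply/derivable1_diffP.
by have [] := is_derive_powR_shift b t1.
Qed.

Lemma cvg_inv_shift_y : (1 + t : R)^-1 @[t --> +oo] --> (0 : R).
Proof.
apply/cvgrPdist_le => e e0; near=> t.
have t1 : e^-1 < t by near: t; apply: nbhs_pinfty_gt; exact: num_real.
have t0 : 0 < t by apply: lt_trans t1; rewrite invr_gt0.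
rewrite sub0r normrN gtr0_norm ?invr_gt0; last by lra.
rewrite -[leRHS]invrK lef_pV2 ?posrE ?invr_gt0//; lra.
Unshelve. all: by end_near. Qed.

Lemma cvg_powR_shift_y (b : R) : 1 <= b -> (1 + t) `^ (- b) @[t --> +oo] --> (0 : R).
Proof.
move=> b1; apply: (@squeeze_cvgr _ _ _ _ (fun=> 0) (fun t : R => (1 + t)^-1)).
- near=> t; rewrite powR_ge0/=.
  have t0 : 0 < t by near: t; apply: nbhs_pinfty_gt; exact: num_real.
  rewrite powRN lef_pV2 ?posrE ?powR_gt0//; [|lra|lra].
  by apply: le1r_powR => //; lra.
- exact: cvg_cst.
- exact: cvg_inv_shift_y.
Unshelve. all: by end_near. Qed.

Lemma cvg_ratio_powR_y (b : R) : (t / (1 + t)) `^ b @[t --> +oo] --> (1 : R).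
Proof.
have H : (1 - (1 + t)^-1) @[t --> +oo] --> (1 : R).
  rewrite -[X in _ --> X](subr0 (1 : R)); apply: cvgB; first exact: cvg_cst.
  exact: cvg_inv_shift_y.
have c1 : {for 1, continuous (fun x : R => x `^ b)}.
  apply: differentiable_continuous; apply/derivable1_diffP.
  by have [] := is_derive1_powR b (@ltr01 R).
have E1 : (1 : R) `^ b = 1 by rewrite powR1.
rewrite -[X in _ --> X]E1.
apply: cvg_trans (cvg_comp _ _ H c1); apply: near_eq_cvg; near=> t.
have t0 : 0 < t by near: t; apply: nbhs_pinfty_gt; exact: num_real.
by rewrite /=; congr (_ `^ _); field; lra.
Unshelve. all: by end_near. Qed.

Context (d : nat).
Notation V := 'rV[R]_d.
Let e : R := d%:R / 2.
Let e0 : 0 <= e. Proof. by rewrite divr_ge0// ler0n. Qed.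

Lemma inner_poisson (s : R) : 0 <= s ->
  (\int[leb]_t (if (s < t)%R then ((e + 1) * (1 + t) `^ (- (e + 2)))%R else 0)%:E =
   ((1 + s) `^ (- (e + 1)))%:E)%E.
Proof.
move=> s0.
apply: etrans; first apply: (@ge0_integral_FTC_y _ _ (fun t => - (1 + t) `^ (- (e + 1))) s 0).
- by move=> x _; rewrite mulr_ge0 ?powR_ge0//; have := e0; lra.
- move=> x sx; have x1 : -1 < x by lra.
  have C0 : {for x, continuous (fun _ : R => e + 1)} by exact: cst_continuous.
  exact: (cvgM C0 (@continuous_powR_shift (- (e + 2)) x x1)).
- move=> x sx; have x1 : -1 < x by lra.
  have H := is_derive_powR_shift (- (e + 1)) x1.
  apply: is_derive_eq; rewrite mulNr opprK; congr (_ * _ `^ _); ring.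
- have s1 : -1 < s by lra.
  exact: (cvgN (@continuous_powR_shift (- (e + 1)) s s1)).
- rewrite -[X in _ --> X](oppr0); apply: cvgN; apply: cvg_powR_shift_y.
  by have := e0; lra.
- by rewrite sub0r opprK.
Qed.

(** The antiderivative t^(d/2+1) (1+t)^(-d/2-1) is the power d/2+1 of t/(1+t), which runs from 0 to
    1. *)
Lemma outer_poisson :
  (\int[leb]_t (if (0 < t)%R then ((e + 1) * (1 + t) `^ (- (e + 2)) * Num.sqrt t ^+ d)%R else 0)%:E = 1)%E.
Proof.
apply: etrans; first apply: (@ge0_integral_FTC_y _ _ (fun t => Num.sqrt t ^+ d.+2 * (1 + t) `^ (- (e + 1))) 0 1).
- move=> x _; rewrite !mulr_ge0 ?powR_ge0 ?exprn_ge0 ?sqrtr_ge0//; have := e0; lra.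
- move=> x sx; have x1 : -1 < x by lra.
  have C0 : {for x, continuous (fun _ : R => e + 1)} by exact: cst_continuous.
  have H1 : {for x, continuous (fun t : R => (e + 1) * (1 + t) `^ (- (e + 2)))}.
    exact: (cvgM C0 (@continuous_powR_shift (- (e + 2)) x x1)).
  have H2 : {for x, continuous (fun t : R => Num.sqrt t ^+ d)}.
    apply: (@continuous_comp _ _ _ (@Num.sqrt R) (fun y => y ^+ d)).
      exact: sqrt_continuous.
    exact: exprn_continuous.
  exact: (cvgM H1 H2).
- move=> x x0; have x1 : -1 < x by lra.
  have H := is_derive_powR_shift (- (e + 1)) x1.
  have Hs := is_derive1_sqrt x0.
  have sx : 0 < Num.sqrt x by rewrite sqrtr_gt0.
  have HX : is_derive (Num.sqrt x) 1 (fun y : R => y ^+ d.+2) (d.+2%:R * Num.sqrt x ^+ d.+1).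
    apply: DeriveDef; first exact: exprn_derivable.
    by rewrite exp_derive [_ *: _]mulr1.
  have HC : is_derive x 1 (fun t : R => Num.sqrt t ^+ d.+2) (d.+2%:R * Num.sqrt x ^+ d.+1 * (2 * Num.sqrt x)^-1).
    exact: (@is_derive1_comp _ (fun y : R => y ^+ d.+2) Num.sqrt).
  apply: (is_derive_eq (is_deriveM HC H)); rewrite /GRing.scale /=.
  have -> : (1 + x) `^ (- (e + 1)) = (1 + x) * (1 + x) `^ (- (e + 2)).
    rewrite -[X in X * _]powRr1; last by lra.
    by rewrite -powRD; [congr (_ `^ _); ring|apply/implyP => _; lra].
  have -> : (1 + x) `^ (- (e + 1) - 1) = (1 + x) `^ (- (e + 2)) by congr (_ `^ _); ring.
  have E : Num.sqrt x ^+ 2 = x by rewrite sqr_sqrtr// ltW.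
  rewrite !exprS; move: E; rewrite expr2; set q := Num.sqrt x in sx *; move=> E.
  set w := _ `^ _; rewrite /e -E -!natr1; field; lra.
- have x1 : -1 < (0 : R) by lra.
  have H2 : {for 0, continuous (fun t : R => Num.sqrt t ^+ d.+2)}.
    apply: (@continuous_comp _ _ _ (@Num.sqrt R) (fun y => y ^+ d.+2)).
      exact: sqrt_continuous.
    exact: exprn_continuous.
  exact: (cvgM H2 (@continuous_powR_shift (- (e + 1)) 0 x1)).
- apply: cvg_trans (cvg_ratio_powR_y (e + 1)); apply: near_eq_cvg; near=> t.
  have t0 : 0 < t by near: t; apply: nbhs_pinfty_gt; exact: num_real.
  rewrite sqrtX_powR ?ltW// powRM ?invr_ge0; [|lra|lra].
  congr (_ * _); last first.
    have t1 : 0 <= 1 + t by lra.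
    by rewrite -(powR_inv1 t1) -powRrM mulN1r.
  by congr (_ `^ _); rewrite /e -!natr1; field.
- by rewrite /= sqrtr0 expr0n mul0r subr0.
Unshelve. all: by end_near. Qed.

(** Up to the factor -d, the Laplacian of the regularised Newtonian kernel at scale 1; rescaled, it
    becomes an approximate identity. The exponent is -(d/2+1). *)
Definition poisson (x : V) : R := (1 + nsq x) `^ (- (e + 1)).

Lemma Meas_poisson : Meas poisson.
Proof.
apply: (measurableT_comp (f := fun y : R => y `^ (- (e + 1)))); first exact: measurable_powR.
apply: measurable_funD => //; exact: measurable_nsq (@meas_vec_rv _ _).
Qed.

Lemma integral_poisson : (\int[mu R d]_x (poisson (rv x))%:E = (vol1 R d)%:E)%E.
Proof.
have mp : measurable_fun setT (fun t : R => (e + 1) * (1 + t) `^ (- (e + 2))).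
  apply: measurable_funM => //; apply: (measurableT_comp (f := fun y : R => y `^ _)).
    exact: measurable_powR.
  exact: measurable_funD.
have p0 t : 0 <= (e + 1) * (1 + t) `^ (- (e + 2)).
  by rewrite mulr_ge0 ?powR_ge0//; have := e0; lra.
have := layer_cake d mp p0.
rewrite outer_poisson mule1 => <-; apply: eq_integral => x _.
by rewrite inner_poisson// nsq_ge0.
Qed.

Lemma Intg_poisson : Intg poisson.
Proof.
apply/integrableP; split; first by apply/measurable_EFinP; exact: Meas_poisson.
under eq_integral do rewrite /= ger0_norm ?powR_ge0//.
by rewrite integral_poisson ltry.
Qed.

Lemma Int_poisson : Int poisson = vol1 R d.
Proof. by apply: EFin_inj; rewrite IntE ?integral_poisson//; exact: Intg_poisson. Qed.

End PowerIntegrals.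

(** * Area of the unit disc *)

Section PlanarVolume.
Context (R : realType).
Notation leb := (@lebesgue_measure R).

Lemma cvg_linear_expR_y : (1 + t) * expR (- t) @[t --> +oo] --> (0 : R).
Proof.
apply: (@squeeze_cvgr _ _ _ _ (fun=> 0) (fun t : R => 4 * (1 + t)^-1)).
- near=> t; have t0 : 0 < t by near: t; apply: nbhs_pinfty_gt; exact: num_real.
  rewrite mulr_ge0 ?expR_ge0//=; last by lra.
  rewrite expRN ler_pdivrMr ?expR_gt0// mulrAC ler_pdivlMr; last by lra.
  (* Squaring 1 + t/2 <= exp(t/2) bounds exp t from below by a quadratic. *)
  have -> : t = 2%:R * (t / 2) by field.
  rewrite expRM_natl; have := expR_ge1Dx (t / 2) => H.
  apply: (@le_trans _ _ (4 * (1 + t / 2) ^+ 2)); first by rewrite !expr2; nra.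
  by apply: ler_wpM2l => //; rewrite ler_sqr ?nnegrE ?expR_ge0//; lra.
- exact: cvg_cst.
- by rewrite -[X in _ --> X](mulr0 4); apply: cvgM; [exact: cvg_cst|exact: cvg_inv_shift_y].
Unshelve. all: by end_near. Qed.

Lemma inner_gauss (s : R) : (\int[leb]_t (if (s < t)%R then expR (- t) else 0)%:E = (expR (- s))%:E)%E.
Proof.
have D (x : R) : is_derive x 1 (fun t : R => expR (- t)) (- expR (- x)).
  have := @is_derive1_comp _ expR (fun t : R => - t) x _ _ (is_derive_expR _) (is_deriveNid x 1).
  by rewrite mulrN1.
have cD (x : R) : {for x, continuous (fun t : R => expR (- t))}.
  by apply: differentiable_continuous; apply/derivable1_diffP; have [] := D x.
apply: etrans; first apply: (@ge0_integral_FTC_y _ _ (fun t => - expR (- t)) s 0).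
- by move=> x _; exact: expR_ge0.
- by move=> x _; exact: cD.
- by move=> x _; have H := D x; apply: is_derive_eq; rewrite opprK.
- exact: (cvgN (cD s)).
- by rewrite -[X in _ --> X]oppr0; apply: cvgN; exact: cvgr_expR.
- by rewrite sub0r opprK.
Qed.

Lemma outer_gauss : (\int[leb]_t (if (0 < t)%R then expR (- t) * Num.sqrt t ^+ 2 else 0)%:E = 1)%E.
Proof.
have D (x : R) : is_derive x 1 (fun t : R => expR (- t)) (- expR (- x)).
  have := @is_derive1_comp _ expR (fun t : R => - t) x _ _ (is_derive_expR _) (is_deriveNid x 1).
  by rewrite mulrN1.
have cD (x : R) : {for x, continuous (fun t : R => expR (- t))}.
  by apply: differentiable_continuous; apply/derivable1_diffP; have [] := D x.
transitivity (\int[leb]_t (if (0 < t)%R then t * expR (- t) else 0)%:E)%E.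
  apply: eq_integral => t _; congr EFin; case: ifP => // t0.
  by rewrite sqr_sqrtr 1?mulrC// ltW.
apply: etrans; first apply: (@ge0_integral_FTC_y _ _ (fun t => - ((1 + t) * expR (- t))) 0 0).
- by move=> x x0; rewrite mulr_ge0 ?expR_ge0.
- by move=> x _; exact: (cvgM cvg_id (cD x)).
- move=> x _; have H := D x; apply: is_derive_eq; rewrite /GRing.scale /=; ring.
- by apply: cvgN; apply: cvgM (cD 0); apply: cvgD; [exact: cvg_cst|exact: cvg_id].
- by rewrite -[X in _ --> X]oppr0; apply: cvgN; exact: cvg_linear_expR_y.
- by rewrite /= oppr0 expR0 !(mulr1, addr0, sub0r, opprK).
Qed.

(** [fundsol] is normalised by 2 pi in the plane and by [omega_d] elsewhere; this reconciles the
    two. The integral of exp(-|x|^2) is [vol1] by the layer cake formula, and pi as the square of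
    the Gaussian integral. *)
Lemma vol1_2 : vol1 R 2 = pi.
Proof.
have mp : measurable_fun setT (fun t : R => expR (- t)).
  by apply: measurableT_comp => //; exact: measurable_expR.
have := layer_cake 2 mp (fun t => expR_ge0 (- t)).
rewrite outer_gauss mule1 => H; apply: EFin_inj; rewrite -H.
under eq_integral do rewrite inner_gauss.
have mg : measurable_fun setT (fun t : 2.-tuple (measurableTypeR R) => (expR (- nsq (rv t)))%:E).
  apply/measurable_EFinP; apply: measurableT_comp mp _.
  exact: measurable_nsq (@meas_vec_rv _ _).
rewrite ge0_integral_tupleS//.
have g1 (x : R) : (\int[mu R 1]_t (expR (- nsq (rv (tcons (x, t)))))%:E =
    (gauss_fun x)%:E * (Num.sqrt pi)%:E)%E.
  rewrite ge0_integral_tupleS//; last first.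
    exact: (measurableT_comp mg (measurableT_comp (@measurable_tcons _ _ 1) (measurable_pair1 _))).
  transitivity (\int[leb]_y ((gauss_fun x)%:E * (gauss_fun y)%:E))%E.
    apply: eq_integral => y _ /=; rewrite integral_dirac//=; last first.
      have m1 := measurable_pair1 (T1 := measurableTypeR R) (T2 := 0.-tuple (measurableTypeR R)) y.
      have m2 := measurable_pair1 (T1 := measurableTypeR R) (T2 := 1.-tuple (measurableTypeR R)) x.
      have mt1 := measurableT_comp (@measurable_tcons _ (measurableTypeR R) 0) m1.
      have mt2 := measurableT_comp (@measurable_tcons _ (measurableTypeR R) 1) (measurableT_comp m2 mt1).
      exact: (measurableT_comp mg mt2).
    rewrite diracT mul1e.
    rewrite /nsq !big_ord_recl big_ord0 !mxE /= addr0 opprD expRD.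
    by rewrite /gauss_fun.
  rewrite ge0_integralZl//; last 3 first.
  - by apply/measurable_EFinP; exact: measurable_gauss_fun.
  - by move=> y _; rewrite lee_fin gauss_fun_ge0.
  - by rewrite lee_fin gauss_fun_ge0.
  by rewrite integralT_gauss.
under eq_integral do rewrite g1.
rewrite ge0_integralZr//; last 2 first.
- by apply/measurable_EFinP; exact: measurable_gauss_fun.
- by move=> y _; rewrite lee_fin gauss_fun_ge0.
by rewrite integralT_gauss -EFinM -expr2 sqr_sqrtr// pi_ge0.
Qed.

End PlanarVolume.

Section DominatedConvergence.
Context (R : realType) (d : nat).
Notation tup n := (n.-tuple (measurableTypeR R)).
Notation V := 'rV[R]_d.

Lemma Int_dominated_cvg (f_ : nat -> V -> R) (f g : V -> R) (N : set (tup d)) :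
  (forall n, Meas (f_ n)) -> Meas f -> Intg g -> measurable N -> mu R d N = 0%E ->
  (forall t, ~ N t -> f_ ^~ (rv t) @ \oo --> f (rv t)) ->
  (forall t n, ~ N t -> `|f_ n (rv t)| <= g (rv t)) ->
  Intg f /\ (Int (f_ n) @[n --> \oo] --> Int f).
Proof.
move=> mf_ mf ig mN N0 cf bf.
have ae (P : tup d -> Prop) : (forall t, ~ N t -> P t) -> {ae mu R d, forall t, P t}.
  by move=> H; exists N; split => // t /= Pt; apply: contrapT => Nt; apply: Pt; exact: H.
have [] := @dominated_convergence _ _ _ (mu R d) setT measurableT
  (fun n => EFin \o (f_ n \o rv)) (EFin \o (f \o rv)) (EFin \o (g \o rv)).
- by move=> n; apply/measurable_EFinP; exact: mf_.
- by apply/measurable_EFinP.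
- by apply: ae => t Nt _; apply: cvg_EFin; [exact: nearW|exact: cf].
- exact: ig.
- by apply: ae => t Nt n _; rewrite /= lee_fin; exact: bf.
move=> fi _ H; split => //; move: H; rewrite -(IntE fi) => /fine_cvg; exact.
Qed.

End DominatedConvergence.

(** * Local integrability of the Newtonian kernel *)

Section Profile.
Context (R : realType) (d : nat).
Hypothesis d2 : (2 <= d)%N.
Notation leb := (@lebesgue_measure R).
Notation V := 'rV[R]_d.
Let e : R := d%:R / 2.
Let dR2 : 2 <= d%:R :> R. Proof. by rewrite (ler_nat _ 2). Qed.

(** The radial profile of the Newtonian kernel as a function of the squared
    norm, normalised so that its derivative is [- s ^ (- d / 2) / 2] in every
    dimension. *)
Definition profile (s : R) : R :=
  if d == 2%N then - ln s / 2 else s `^ (1 - e) / (d%:R - 2).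

Lemma fundsol_profile (x : V) : fundsol x = (omega_d R d)^-1 * profile (nsq x).
Proof.
rewrite /fundsol /profile omega_dE /enorm -/(nsq x) -powR12_sqrt ?nsq_ge0//.
have [E|dn2] := eqVneq d 2%N.
  have -> : vol1 R d = pi by rewrite E vol1_2.
  have E' : (d%:R : R) = 2 by rewrite E.
  have : (pi : R) != 0 by rewrite gt_eqF// pi_gt0.
  by rewrite ln_powR E'; move: pi => q q0; field.
rewrite -powRrM (_ : 2^-1 * (2 - d%:R) = 1 - e); last by rewrite /e; field.
have dn : (d%:R : R) - 2 != 0.
  by rewrite subr_eq0 (eqr_nat R d 2).
have d0 : (d%:R : R) != 0 by rewrite pnatr_eq0; move: d2; case: d.
by field; rewrite dn d0 gt_eqF// vol1_gt0.
Qed.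

Lemma is_derive_profile (s : R) : 0 < s -> is_derive s 1 profile (- (s `^ (- e)) / 2).
Proof.
move=> s0; rewrite /profile; have [E|dn2] := eqVneq d 2%N.
  have H := is_derive1_ln s0.
  have H2 : is_derive s 1 (fun t : R => - 2^-1 * ln t) (- 2^-1 * s^-1) by exact: is_deriveZ.
  have -> : (fun t : R => - ln t / 2) = (fun t : R => - 2^-1 * ln t).
    by apply/funext => t; ring.
  rewrite (_ : - s `^ (- e) / 2 = - 2^-1 * s^-1)//.
  by rewrite /e E divff// powR_inv1 ?ltW//; ring.
have H := is_derive1_powR (1 - e) s0.
have dn : (d%:R : R) - 2 != 0 by rewrite subr_eq0 (eqr_nat R d 2).
have H2 : is_derive s 1 (fun t : R => (d%:R - 2)^-1 * t `^ (1 - e)) ((d%:R - 2)^-1 * ((1 - e) * s `^ (1 - e - 1))).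
  exact: is_deriveZ.
have -> : (fun t : R => t `^ (1 - e) / (d%:R - 2)) = (fun t : R => (d%:R - 2)^-1 * t `^ (1 - e)).
  by apply/funext => t; rewrite mulrC.
rewrite (_ : - s `^ (- e) / 2 = (d%:R - 2)^-1 * ((1 - e) * s `^ (1 - e - 1)))//.
rewrite (_ : 1 - e - 1 = - e); last by ring.
by set w := _ `^ _; rewrite /e; field.
Qed.

Lemma continuous_profile (s : R) : 0 < s -> {for s, continuous profile}.
Proof.
move=> s0; apply: differentiable_continuous; apply/derivable1_diffP.
by have [] := is_derive_profile s0.
Qed.

Lemma profile_nincr (s t : R) : 0 < s -> s <= t -> profile t <= profile s.
Proof.
move=> s0 st.
have [||c _] := @MVT_segment R profile (fun s => - (s `^ (- e)) / 2) s t st.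
- by move=> x; rewrite in_itv/= => /andP[sx _]; apply: is_derive_profile; lra.
- apply: derivable_within_continuous => x; rewrite in_itv/= => /andP[sx _].
  have x0 : 0 < x by lra.
  by have [] := is_derive_profile x0.
move=> E; rewrite -subr_le0 E mulr_le0_ge0 ?subr_ge0//.
by rewrite mulNr oppr_le0 divr_ge0// powR_ge0.
Qed.

Lemma measurable_profile : measurable_fun setT profile.
Proof.
rewrite /profile; have [_|_] := eqVneq d 2%N.
  by apply: measurable_funM => //; apply: measurableT_comp => //; exact: measurable_ln.
by apply: measurable_funM => //; exact: measurable_powR.
Qed.

(** Minus the derivative of [profile] on (0, 1), so that its integral over t > |x|^2 returns
    profile(|x|^2) - profile(1) in the unit ball. Against the weight t^(d/2) of the layer cake
    formula it is the constant 1/2, which is why the singularity is integrable. *)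
Let p (t : R) : R := if 0 < t < 1 then t `^ (- e) / 2 else 0.

Lemma inner_profile (s : R) : 0 < s < 1 ->
  (\int[leb]_t (if (s < t)%R then p t else 0)%:E = (profile s - profile 1)%:E)%E.
Proof.
move=> /andP[s0 s1].
transitivity (\int[leb]_(t in `[s, 1%R]) (t `^ (- e) / 2)%:E)%E; last first.
  have H := @continuous_FTC2 R (fun t => t `^ (- e) / 2) (fun t => - profile t) s 1 s1.
  rewrite H; first by rewrite -EFinB; congr EFin; ring.
  - apply: derivable_within_continuous => x; rewrite in_itv/= => /andP[sx _].
    have x0 : 0 < x by lra.
    have [D _] := is_derive1_powR (- e) x0.
    by apply: derivableM => //; exact: derivable_cst.
  - split.
    + move=> x; rewrite in_itv/= => /andP[sx _]; apply: derivableN.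
      have x0 : 0 < x by lra.
      by have [] := is_derive_profile x0.
    + by apply: cvg_at_right_filter; exact: (cvgN (continuous_profile s0)).
    + by apply: cvg_at_left_filter; exact: (cvgN (continuous_profile ltr01)).
  - move=> x; rewrite in_itv/= => /andP[sx _]; rewrite derive1E.
    have x0 : 0 < x by lra.
    have [D E] := is_derive_profile x0.
    by rewrite deriveN// E; ring.
rewrite (@integral_itv_bndoo _ s 1 _ true false); last first.
  have m1 : measurable_fun setT (fun t : R => t `^ (- e) / 2).
    by apply: measurable_funM => //; exact: measurable_powR.
  by apply: measurable_funTS; apply/measurable_EFinP.
rewrite [RHS]integral_mkcond; apply: eq_integral => t _; rewrite patchE.
case: ifPn => st; last first.
  by rewrite memNset//= in_itv/= (negbTE st).
rewrite /p (lt_trans s0 st) /=; case: ifPn => t1; first by rewrite mem_set//= in_itv/= st.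
by rewrite memNset//= in_itv/= st (negbTE t1).
Qed.

Let p_ge0 t : 0 <= p t.
Proof. by rewrite /p; case: ifP => // _; rewrite divr_ge0// powR_ge0. Qed.

Let measurable_p : measurable_fun setT p.
Proof.
apply: measurable_fun_ifT => //.
  by apply: measurable_and => //; exact: measurable_fun_ltr.
by apply: measurable_funM => //; exact: measurable_powR.
Qed.

Lemma outer_profile :
  (\int[leb]_t (if (0 < t)%R then (p t * Num.sqrt t ^+ d)%R else 0)%:E = (2^-1)%:E)%E.
Proof.
transitivity (\int[leb]_(t in `]0%R, 1%R[) (2^-1)%:E)%E.
  rewrite [RHS]integral_mkcond; apply: eq_integral => t _; rewrite patchE.
  case: ifPn => t0; last by rewrite memNset//= in_itv/= (negbTE t0).
  rewrite /p t0 /=; case: ifPn => t1; last first.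
    by rewrite memNset//= ?mul0r// in_itv/= t0 (negbTE t1).
  rewrite mem_set; last by rewrite /= in_itv/= t0.
  congr EFin; rewrite sqrtX_powR ?ltW// powRN -/e; field.
  by rewrite gt_eqF// powR_gt0.
by rewrite integral_cst//= lebesgue_measure_itv/= lte_fin ltr01 sube0 mule1.
Qed.

Definition near_profile (x : V) : R :=
  if 0 < nsq x < 1 then profile (nsq x) - profile 1 else 0.

Let mnsq : measurable_fun setT (fun t : d.-tuple (measurableTypeR R) => nsq (rv t)).
Proof. exact: measurable_nsq (@meas_vec_rv _ _). Qed.

Lemma Meas_profile : Meas (fun x : V => profile (nsq x)).
Proof. exact: (measurableT_comp measurable_profile mnsq). Qed.

Lemma near_profile_ge0 x : 0 <= near_profile x.
Proof.
by rewrite /near_profile; case: ifP => // /andP[x0 x1]; rewrite subr_ge0 profile_nincr// ltW.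
Qed.

Lemma Intg_near_profile : Intg near_profile.
Proof.
have mW : Meas near_profile.
  apply: measurable_fun_ifT => //.
    by apply: measurable_and; exact: measurable_fun_ltr.
  by apply: measurable_funB => //; exact: Meas_profile.
apply/integrableP; split; first by apply/measurable_EFinP.
under eq_integral do rewrite /= ger0_norm ?near_profile_ge0//.
have := layer_cake d measurable_p p_ge0; rewrite outer_profile => H.
apply: (@le_lt_trans _ _ ((vol1 R d)%:E * (2^-1)%:E)%E); last by rewrite -EFinM ltry.
rewrite -H; apply: ge0_le_integral => //.
- by move=> t _; rewrite lee_fin near_profile_ge0.
- by apply/measurable_EFinP.
- apply: (measurable_fun_fubini_tonelli_F (m2 := leb)
    (fun z : d.-tuple (measurableTypeR R) * measurableTypeR R =>
      (if nsq (rv z.1) < z.2 then p z.2 else 0)%:E)) => //.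
    apply/measurable_EFinP; apply: measurable_fun_ifT.
    + apply: measurable_fun_ltr => //; exact: (measurableT_comp mnsq measurable_fst).
    + exact: (measurableT_comp measurable_p measurable_snd).
    + exact: measurable_cst.
  by move=> z; rewrite lee_fin; case: ifP.
- move=> t _; rewrite /near_profile; case: ifPn => [x01|_].
    by rewrite inner_profile.
  by apply: integral_ge0 => s _; rewrite lee_fin; case: ifP.
Qed.

Definition loc_profile (r : R) (x : V) : R :=
  if enorm x < r then profile (nsq x) else 0.

(** [profile 0] is the default value at the origin. [profile 1] is subtracted inside the unit ball
    and is an upper bound outside it. [profile (r ^+ 2)] bounds from below, since the planar profile
    is negative beyond the unit circle. *)
Lemma loc_profile_bound r (x : V) : `|loc_profile r x| <=
  near_profile x + (`|profile 0| + `|profile 1| + `|profile (r ^+ 2)|) *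
    (if enorm x < r then 1 else 0).
Proof.
rewrite /loc_profile; case: ifPn => xr; last by rewrite normr0 mulr0 addr0 near_profile_ge0.
rewrite mulr1 /near_profile.
have := normr_ge0 (profile 0); have := normr_ge0 (profile 1); have := normr_ge0 (profile (r ^+ 2)).
have [x0|x0] := eqVneq (nsq x) 0; first by rewrite x0 ltxx /=; lra.
have x0' : 0 < nsq x by rewrite lt0r x0 nsq_ge0.
rewrite x0' /=; case: ltP => x1.
  have := profile_nincr x0' (ltW x1) => H1 H2 H3 H4.
  have -> : profile (nsq x) = (profile (nsq x) - profile 1) + profile 1 by ring.
  by apply: le_trans (ler_normD _ _) _; rewrite (ger0_norm (_ : 0 <= profile (nsq x) - profile 1)) ?subr_ge0//; lra.
have H1 := profile_nincr ltr01 x1.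
have H2 : profile (r ^+ 2) <= profile (nsq x).
  apply: profile_nincr => //; rewrite -sqr_enorm ler_sqr ?nnegrE ?enorm_ge0 ?ltW//.
  exact: le_lt_trans (enorm_ge0 _) xr.
have := ler_norm (profile 1); have := ler_norm (- profile (r ^+ 2)); rewrite normrN.
by move=> *; rewrite ler_norml; apply/andP; split; lra.
Qed.

Lemma Intg_loc_profile r : Intg (loc_profile r).
Proof.
apply: (@le_Intg _ _ _ (fun x => near_profile x + (`|profile 0| + `|profile 1| + `|profile (r ^+ 2)|) *
    (if enorm x < r then 1 else 0))); last exact: loc_profile_bound.
  apply: measurable_fun_ifT => //; last exact: Meas_profile.
  by apply: measurable_fun_ltr => //; exact: measurable_enorm (@meas_vec_rv _ _).
by apply: IntgD; [exact: Intg_near_profile|apply: IntgZ; exact: Intg_ball].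
Qed.

End Profile.

(** * Real powers of smooth functions and integration by parts *)

Section SmoothPowers.
Context (R : realType) (d : nat).
Notation V := 'rV[R]_d.
Implicit Types (f g q G : V -> R).

Lemma smooth_of_partial f : continuous f ->
  (forall i x, derivable f x (evec R i)) -> (forall i, smooth (partial i f)) -> smooth f.
Proof.
move=> cf df sf s; case/lastP: s => [|s i]; first by split.
have -> : iterpartial (rcons s i) f = iterpartial s (partial i f).
  by rewrite /iterpartial foldr_rcons.
exact: sf.
Qed.

Lemma smooth_coord i : smooth (fun x : V => x 0 i).
Proof.
have H (x : V) j : is_derive x (evec R j) (fun y : V => y 0 i) (if i == j then 1 else 0).
  exact: (@is_derive_coord R d id 1 x i j (is_derive_id _ _)).
apply: smooth_of_partial.
- by move=> x; exact: coord_continuous.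
- by move=> j x; have [] := H x j.
- move=> j; rewrite (_ : partial j _ = fun=> (if i == j then 1 else 0)); first exact: smooth_cst.
  by apply/funext => x; have [] := H x j.
Qed.

Lemma is_derive_comp_smooth (F F' : R -> R) q i x : smooth q ->
  is_derive (q x) 1 F (F' (q x)) ->
  is_derive x (evec R i) (fun y => F (q y)) (F' (q x) * partial i q x).
Proof.
move=> sq HF; apply/is_derive_line0.
have H := proj1 (is_derive_line0 _ _ _ _) (is_derive_partial i x sq).
by apply: (@is_derive1_comp _ F (fun h : R => q (x + h *: evec R i))); rewrite scale0r addr0.
Qed.

Section Powers.
Variable q : V -> R.
Hypotheses (sq : smooth q) (q0 : forall x, 0 < q x).

Lemma is_derive_powR_comp a i x :
  is_derive x (evec R i) (fun y => q y `^ a) (a * q x `^ (a - 1) * partial i q x).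
Proof. by apply: (@is_derive_comp_smooth (fun t => t `^ a) (fun t => a * t `^ (a - 1))) => //; exact: is_derive1_powR. Qed.

Lemma continuous_powR_comp a : continuous (fun y => q y `^ a).
Proof.
move=> x; apply: (@continuous_comp _ _ _ q (fun t => t `^ a)); first exact: smooth_continuous.
apply: differentiable_continuous; apply/derivable1_diffP.
by have [] := is_derive1_powR a (q0 x).
Qed.

(** The derivative of q^a is a q^(a-1) times a partial derivative of q, a product of members: the
    class is stable under differentiation because it contains all real exponents at once. *)
Inductive pow_alg : (V -> R) -> Prop :=
| PA_smooth f of smooth f : pow_alg f
| PA_pow a : pow_alg (fun y => q y `^ a)
| PA_mul f g of pow_alg f & pow_alg g : pow_alg (fun x => f x * g x)
| PA_add f g of pow_alg f & pow_alg g : pow_alg (fun x => f x + g x).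

Lemma smooth_pow_alg f : pow_alg f -> smooth f.
Proof.
apply: smooth_class => {}f; elim => {f}.
- move=> f sf; split; first exact: smooth_continuous.
  move=> i; split; first by move=> x; exact: smooth_derivable.
  by apply: PA_smooth; exact: smooth_partial.
- move=> a; split; first exact: continuous_powR_comp.
  move=> i; split; first by move=> x; have [] := is_derive_powR_comp a i x.
  rewrite (_ : partial i _ = fun x => a * q x `^ (a - 1) * partial i q x).
    apply: PA_mul; last by apply: PA_smooth; exact: smooth_partial.
    by apply: PA_mul; [apply: PA_smooth; exact: smooth_cst|exact: PA_pow].
  by apply/funext => x; have [] := is_derive_powR_comp a i x.
- move=> f g Af [cf Df] Ag [cg Dg]; split; first by move=> x; exact: (cvgM (cf x) (cg x)).
  move=> i; split; first by move=> x; apply: derivableM; [exact: (Df i).1|exact: (Dg i).1].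
  rewrite (_ : partial i _ = fun x => f x * partial i g x + g x * partial i f x).
    by apply: PA_add; apply: PA_mul => //; [exact: (Dg i).2|exact: (Df i).2].
  by apply/funext => x; apply: deriveM; [exact: (Df i).1|exact: (Dg i).1].
- move=> f g Af [cf Df] Ag [cg Dg]; split; first by move=> x; exact: (cvgD (cf x) (cg x)).
  move=> i; split; first by move=> x; apply: derivableD; [exact: (Df i).1|exact: (Dg i).1].
  rewrite (_ : partial i _ = fun x => partial i f x + partial i g x).
    by apply: PA_add; [exact: (Df i).2|exact: (Dg i).2].
  by apply/funext => x; apply: deriveD; [exact: (Df i).1|exact: (Dg i).1].
Qed.

Lemma smooth_powR a : smooth (fun y => q y `^ a).
Proof. exact/smooth_pow_alg/PA_pow. Qed.

End Powers.

Lemma smooth_nsq : smooth (@nsq R d).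
Proof. by apply: smooth_sum => i; apply: smoothM; exact: smooth_coord. Qed.

Lemma partial_coord i j (x : V) : partial j (fun x : V => x 0 i) x = (i == j)%:R.
Proof.
have [_] := @is_derive_coord R d id 1 x i j (is_derive_id _ _).
by rewrite /partial => ->; case: eqP.
Qed.

Lemma partialM f g i : smooth f -> smooth g ->
  partial i (fun x => f x * g x) = fun x => f x * partial i g x + g x * partial i f x.
Proof. by move=> sf sg; apply/funext => x; apply: deriveM; exact: smooth_derivable. Qed.

Lemma partial_cst a i : partial i (fun _ : V => a) = fun=> 0.
Proof. by apply/funext => x; exact: derive_cst. Qed.

Lemma partial_sum (I : Type) (s : seq I) (F : I -> V -> R) i x :
  (forall j, smooth (F j)) ->
  partial i (fun x => \sum_(j <- s) F j x) x = \sum_(j <- s) partial i (F j) x.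
Proof.
move=> sF; elim: s => [|j s IHs].
  by under eq_fun do rewrite big_nil; rewrite big_nil partial_cst.
under eq_fun do rewrite big_cons; rewrite big_cons -IHs partialD//.
exact: smooth_sum.
Qed.

Lemma partial_nsq i x : partial i (@nsq R d) x = 2 * x 0 i.
Proof.
rewrite (_ : @nsq R d = fun x => \sum_(j < d) (x 0 j * x 0 j)); last first.
  by apply/funext => y; apply: eq_bigr => j _; rewrite expr2.
rewrite partial_sum; last by move=> j; apply: smoothM; exact: smooth_coord.
rewrite (bigD1 i)//= big1 ?addr0; last first.
  move=> j ji; rewrite partialM; [|exact: smooth_coord|exact: smooth_coord].
  by rewrite partial_coord (negbTE ji) !mulr0 addr0.
rewrite partialM; [|exact: smooth_coord|exact: smooth_coord].
by rewrite partial_coord eqxx mulr1; ring.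
Qed.

Lemma test_funM G f : smooth G -> test_fun f -> test_fun (fun x => G x * f x).
Proof.
move=> sG [sf [r fr]]; split; first exact: smoothM.
by exists r => x rx; rewrite fr// mulr0.
Qed.

(** By translation invariance the integral of f(x + h e_i) - f(x) is zero; it differs from h times
    the integral of the partial derivative by O(h^2), and h tends to 0. *)
Lemma Int_partial f i : test_fun f -> Int (partial i f) = 0.
Proof.
move=> tf; have [sf [r fr]] := tf.
have [C [C0 HC]] := test_fun_bounded (test_fun_partial i (test_fun_partial i tf)).
have tp := test_fun_partial i tf.
have fi := test_fun_Intg tf.
have pi' := test_fun_Intg tp.
(* A shift by h <= 1 enlarges the support to radius r + 1; the further unit gives the strict margin
   that the vanishing of derivatives asks for. *)
pose K := C * Int (fun x : V => if enorm x < r + 2 then 1 else 0).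
have key h : 0 < h -> h <= 1 -> `|Int (partial i f)| <= K * h.
  move=> h0 h1.
  have E : Int (fun x => f (x + h *: evec R i) - f x - h * partial i f x) = - h * Int (partial i f).
    have i1 : Intg (fun x => f (x + h *: evec R i)) by exact: Intg_shift.
    rewrite IntB; [|exact: IntgB|exact: IntgZ].
    by rewrite IntB// Int_shift// subrr sub0r IntZ// mulNr.
  have : `|Int (fun x => f (x + h *: evec R i) - f x - h * partial i f x)| <= K * h ^+ 2.
    have i1 : Intg (fun x => f (x + h *: evec R i) - f x - h * partial i f x).
      by apply: IntgB; [apply: IntgB => //; exact: Intg_shift|exact: IntgZ].
    apply: le_trans (le_norm_Int i1) _.
    rewrite (_ : K * h ^+ 2 = Int (fun x : V => C * h ^+ 2 * (if enorm x < r + 2 then 1 else 0))); last first.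
      by rewrite IntZ; [rewrite /K mulrAC|exact: Intg_ball].
    apply: le_Int; [exact: Intg_norm|apply: IntgZ; exact: Intg_ball|move=> x].
    case: ifPn => xr; last first.
      rewrite mulr0; move: xr; rewrite -leNgt => xr.
      have xhr : r <= enorm (x + h *: evec R i).
        have := enorm_triangle (x + h *: evec R i) (- (h *: evec R i)).
        by rewrite addrK enormN (enormZ _ (ltW h0)) enorm_evec; lra.
      rewrite (fr _ xhr) fr; last by lra.
      by rewrite (partial_vanish _ fr) ?subrr ?mulr0 ?subrr ?normr0//; lra.
    have [c /andP[c0 ch] ->] : exists2 c, 0 <= c <= h & f (x + h *: evec R i) - f x = partial i f (x + c *: evec R i) * h.
      have [c ci] := MVT_everywhere (ltW h0) (fun s => is_derive_partial_line i x s sf).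
      by rewrite scale0r addr0 subr0 => E'; exists c.
    rewrite mulr1 (mulrC h) -mulrBl normrM (gtr0_norm h0) expr2 mulrA.
    apply: ler_wpM2r; first exact: ltW.
    apply: le_trans (partial_lipschitz_line x c (smooth_partial i sf) HC) _.
    by apply: ler_wpM2l => //; rewrite ger0_norm.
  rewrite E normrM normrN (gtr0_norm h0) expr2 mulrA mulrC.
  by rewrite ler_pM2r.
have K0 : 0 <= K by rewrite mulr_ge0//; apply: Int_ge0 => x; case: ifP.
apply/eqP; rewrite -normr_le0; apply/ler_addgt0Pl => e e0; rewrite addr0.
pose h := Num.min 1 (e / (K + 1)).
have h0 : 0 < h by rewrite lt_min ltr01 divr_gt0//; lra.
apply: le_trans (key h h0 _) _; first by rewrite ge_min lexx.
apply: (@le_trans _ _ ((K + 1) * (e / (K + 1)))).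
  by apply: ler_pM => //; [exact: ltW|lra|rewrite ge_min lexx orbT].
by rewrite mulrCA divff ?mulr1//; lra.
Qed.

(** Green's identity: G Lap f - f Lap G is the divergence of the compactly supported field G grad f
    - f grad G. *)
Lemma Int_Lap_symmetric G f : smooth G -> test_fun f ->
  Int (fun x => G x * Lap f x) = Int (fun x => f x * Lap G x).
Proof.
move=> sG tf; have sf := tf.1.
have i1 : Intg (fun x => G x * Lap f x) := test_fun_Intg (test_funM sG (test_fun_Lap tf)).
have i2 : Intg (fun x => f x * Lap G x).
  rewrite (_ : (fun _ => _) = (fun x => Lap G x * f x)); last by apply/funext => x; rewrite mulrC.
  exact (test_fun_Intg (test_funM (smooth_Lap sG) tf)).
have sGi i := smooth_partial i sG.
have sfi i := smooth_partial i sf.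
have sNG i := smoothZ (-1) (sGi i).
have tg i : test_fun (fun x => G x * partial i f x + (-1 * partial i G x) * f x) :=
  test_funD (test_funM sG (test_fun_partial i tf)) (test_funM (sNG i) tf).
apply/eqP; rewrite -subr_eq0; apply/eqP; rewrite -(IntB i1 i2).
transitivity (Int (fun x => \sum_(i < d) partial i (fun x => G x * partial i f x + (-1 * partial i G x) * f x) x)).
  congr Int; apply/funext => x; rewrite !LapE !mulr_sumr -sumrB; apply: eq_bigr => i _.
  rewrite (partialD i (smoothM sG (sfi i)) (smoothM (sNG i) sf)).
  rewrite (partialM i sG (sfi i)) (partialM i (sNG i) sf) (partialZ (-1) i (sGi i)).
  move: (partial i (partial i f) x) (partial i (partial i G) x) (partial i f x) (partial i G x) (f x) (G x) => a1 a2 a3 a4 a5 a6.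
  ring.
rewrite (Int_sum _ (fun i => test_fun_Intg (test_fun_partial i (tg i)))).
by rewrite big1 // => i _; exact (Int_partial i (tg i)).
Qed.

End SmoothPowers.

(** * The Newtonian kernel as a fundamental solution *)

Section NewtonIdentity.
Context (R : realType) (d : nat).
Hypothesis d2 : (2 <= d)%N.
Notation V := 'rV[R]_d.
Let e : R := d%:R / 2.

Section Regularised.
Variable k : R.
Hypothesis k0 : 0 < k.

Let q (x : V) : R := nsq x + k.
Let q0 x : 0 < q x. Proof. by rewrite ltr_wpDl// nsq_ge0. Qed.
Let sq : smooth q.
Proof. by apply: smoothD; [exact: smooth_nsq|exact: smooth_cst]. Qed.
Let pq i x : partial i q x = 2 * x 0 i.
Proof.
rewrite /q partialD; [|exact: smooth_nsq|exact: smooth_cst].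
by rewrite partial_nsq partial_cst addr0.
Qed.

(** Adding [k] to |x|^2 removes the singularity and keeps the Laplacian explicit. *)
Definition reg_kernel (x : V) : R := profile d (nsq x + k).

Let D i x : is_derive x (evec R i) reg_kernel (- x 0 i * q x `^ (- e)).
Proof.
have := is_derive_comp_smooth (F := profile d) (F' := fun s => - (s `^ (- e)) / 2) i sq
  (is_derive_profile d (q0 x)).
rewrite pq (_ : - q x `^ (- e) / 2 * (2 * x 0 i) = - x 0 i * q x `^ (- e))//.
by field.
Qed.

Let partial_reg i : partial i reg_kernel = fun x => - 1 * x 0 i * q x `^ (- e).
Proof. by apply/funext => x; have [_] := D i x; rewrite /partial => ->; rewrite mulN1r. Qed.

Lemma smooth_reg_kernel : smooth reg_kernel.
Proof.
apply: smooth_of_partial.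
- move=> x; apply: (@continuous_comp _ _ _ q (profile d)); first exact: smooth_continuous.
  exact: continuous_profile (q0 x).
- by move=> i x; have [] := D i x.
- move=> i; rewrite partial_reg; apply: smoothM; last exact: smooth_powR.
  by apply: smoothZ; exact: smooth_coord.
Qed.

(** With q = |x|^2 + k the gradient is -x q^(-d/2). Its divergence is d |x|^2 q^(-d/2-1) - d
    q^(-d/2), where the terms in |x|^2 cancel and only k is left. *)
Lemma Lap_reg_kernel x : Lap reg_kernel x = - (d%:R * k * (nsq x + k) `^ (- (e + 1))).
Proof.
rewrite LapE.
under eq_bigr => i _.
  rewrite partial_reg partialM; [|by apply: smoothZ; exact: smooth_coord|exact: smooth_powR].
  rewrite partialZ; last exact: smooth_coord.
  rewrite partial_coord eqxx.
  have [_] := is_derive_powR_comp sq q0 (- e) i x; rewrite /partial => ->.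
  rewrite -/(partial i q x) pq.
  over.
rewrite -/(q x) (_ : - e - 1 = - (e + 1)); last by ring.
have -> : q x `^ (- e) = q x * q x `^ (- (e + 1)).
  rewrite -[X in X * _]powRr1; last exact: ltW.
  by rewrite -powRD; [congr (_ `^ _); ring|apply/implyP => _; rewrite gt_eqF].
set w := _ `^ _.
rewrite (_ : \sum_(i < d) _ = \sum_(i < d) (2 * e * w * x 0 i ^+ 2 - q x * w)); last first.
  by apply: eq_bigr => i _; rewrite /=; ring.
rewrite sumrB -mulr_sumr -/(nsq x) sumr_const card_ord -mulr_natl /q /e; field.
by [].
Qed.

Lemma Int_reg_kernel f : test_fun f ->
  Int (fun x => reg_kernel x * Lap f x) =
  Int (fun x => f x * - (d%:R * k * (nsq x + k) `^ (- (e + 1)))).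
Proof.
move=> tf; rewrite Int_Lap_symmetric//; last exact: smooth_reg_kernel.
by congr Int; apply/funext => x; rewrite Lap_reg_kernel.
Qed.

End Regularised.

Lemma Intg_test_poisson (f : V -> R) (a : R) : 0 < a -> test_fun f ->
  Intg (fun z : V => f (a *: z) * poisson z).
Proof.
move=> a0 tf; have [M [M0 fM]] := test_fun_bounded tf.
apply: (@le_Intg _ _ _ (fun z : V => M * poisson z)).
- apply: MeasM; last exact: Meas_poisson.
  have := Meas_affine a 0 (Intg_Meas (test_fun_Intg tf)).
  by under eq_fun do rewrite addr0.
- by apply: IntgZ; exact: Intg_poisson.
- move=> x; rewrite normrM [X in _ * X]ger0_norm ?powR_ge0//.
  by apply: ler_wpM2r => //; exact: powR_ge0.
Qed.

(** The substitution x = a z turns k = a^2 into 1 and all powers of [a] cancel, so the dependence on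
    [a] moves into the argument of [f]. *)
Lemma Int_reg_kernel_scaled (f : V -> R) (a : R) : 0 < a -> test_fun f ->
  Int (fun x => reg_kernel (a ^+ 2) x * Lap f x) =
  - d%:R * Int (fun z : V => f (a *: z) * poisson z).
Proof.
move=> a0 tf; have k0 : 0 < a ^+ 2 by rewrite exprn_gt0.
rewrite Int_reg_kernel//.
have ig : Intg (fun x => f x * - (d%:R * a ^+ 2 * (nsq x + a ^+ 2) `^ (- (e + 1)))).
  rewrite (_ : (fun _ => _) = fun x => Lap (reg_kernel (a ^+ 2)) x * f x); last first.
    by apply/funext => x; rewrite Lap_reg_kernel// mulrC.
  apply: test_fun_Intg; apply: test_funM => //; apply: smooth_Lap.
  exact: smooth_reg_kernel.
rewrite (Int_affine 0 a0 ig) -!IntZ; last 2 first.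
- exact: Intg_test_poisson.
- by have := Intg_affine 0 a0 ig.
congr Int; apply/funext => z; rewrite addr0 nsqZ.
have -> : a ^+ 2 * nsq z + a ^+ 2 = a ^+ 2 * (1 + nsq z) by ring.
rewrite powRM ?sqr_ge0//; last by rewrite addr_ge0// nsq_ge0.
have -> : (a ^+ 2) `^ (- (e + 1)) = (a ^+ d)^-1 * (a ^+ 2)^-1.
  rewrite powRN -powR_mulrn ?ltW// -powRrM -invfM -!powR_mulrn ?ltW//.
  rewrite -powRD; last by apply/implyP => _; rewrite gt_eqF.
  by congr (_ `^ _)^-1; rewrite /e; field.
rewrite /poisson -/e; set w := _ `^ _; field.
by rewrite !gt_eqF// exprn_gt0.
Qed.

Lemma null_origin : mu R d (@tbox R d (fun=> 0) (fun=> 0)) = 0%E.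
Proof.
have E := @measure_tbox R d (fun=> 0) (fun=> 0).
rewrite E//; congr EFin; rewrite prodr_const card_ord subrr expr0n.
by case: (d) d2.
Qed.

Let a_ (n : nat) : R := n.+1%:R^-1.
Let a_gt0 n : 0 < a_ n. Proof. by rewrite invr_gt0 ltr0n. Qed.
Let a_le1 n : a_ n <= 1. Proof. by rewrite invf_le1 ?ltr0n// ler1n. Qed.
Let cvg_a : a_ @ \oo --> (0 : R). Proof. exact: cvg_harmonic. Qed.

Lemma Intg_profile_mul (f : V -> R) : test_fun f -> Intg (fun x => profile d (nsq x) * f x).
Proof.
move=> tf; have [M [M0 fM]] := test_fun_bounded tf; have [sf [r fr]] := tf.
apply: (@le_Intg _ _ _ (fun x => M * `|loc_profile r x|)).
- apply: MeasM; first exact: Meas_profile.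
  by apply: Meas_continuous; exact: smooth_continuous.
- by apply/IntgZ/Intg_norm; exact: Intg_loc_profile.
- move=> x; rewrite /loc_profile; case: ltP => xr; last by rewrite fr// !normr0 !mulr0 normr0.
  by rewrite normrM mulrC; apply: ler_wpM2r.
Qed.

(** Limit a -> 0 in the regularised identity: on the left by domination, on the right because f(a z)
    tends to f(0) under the fixed weight [poisson]. *)
Theorem Int_profile_Lap (f : V -> R) : test_fun f ->
  Int (fun x => profile d (nsq x) * Lap f x) = - (d%:R * vol1 R d) * f 0.
Proof.
move=> tf; have sf := tf.1; have tL := test_fun_Lap tf.
have mN := @measurable_tbox R d (fun=> 0) (fun=> 0).
have N0 := null_origin.
have off0 t : ~ @tbox R d (fun=> 0) (fun=> 0) t -> 0 < nsq (rv t).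
  move=> tn; rewrite lt0r nsq_ge0 andbT; apply/eqP => z; apply: tn => i.
  move/eqP : z; rewrite psumr_eq0; last by move=> j _; rewrite sqr_ge0.
  move/allP => /(_ i (mem_index_enum i)); rewrite /= mxE sqrf_eq0 => /eqP ->.
  by rewrite lexx.
have mL : Meas (Lap f) by apply: Meas_continuous; exact: smooth_continuous tL.1.
have L1 : Int (fun x => reg_kernel (a_ n ^+ 2) x * Lap f x) @[n --> \oo] -->
    Int (fun x => profile d (nsq x) * Lap f x).
  (* The profile is nonincreasing, so for 0 < a <= 1 the regularised kernel lies between its value
     at regularisation 1 and the singular profile; the sum of the two absolute values dominates. *)
  have := @Int_dominated_cvg R d (fun n x => reg_kernel (a_ n ^+ 2) x * Lap f x)
    (fun x => profile d (nsq x) * Lap f x)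
    (fun x => `|profile d (nsq x) * Lap f x| + `|reg_kernel 1 x * Lap f x|) _ _ _ _ mN N0.
  case=> //.
  - move=> n; apply: MeasM => //; apply: Meas_continuous; apply: smooth_continuous.
    by apply: smooth_reg_kernel; rewrite exprn_gt0.
  - by apply: MeasM => //; exact: Meas_profile.
  - apply: IntgD; apply: Intg_norm; first exact: Intg_profile_mul.
    by apply/test_fun_Intg/test_funM => //; exact: smooth_reg_kernel.
  - move=> t /off0 t0; apply: cvgM; last exact: cvg_cst.
    have H2 : (fun n => a_ n ^+ 2) @ \oo --> (0 : R).
      apply: (@squeeze_cvgr _ _ _ _ (fun=> 0) a_) => //; last exact: cvg_cst.
      apply: nearW => n; rewrite sqr_ge0 /= expr2 -[leRHS]mulr1.
      by apply: ler_wpM2l => //; exact: ltW.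
    have H3 : (fun n => nsq (rv t) + a_ n ^+ 2) @ \oo --> nsq (rv t).
      rewrite -[X in _ --> X]addr0; apply: cvgD => //; exact: cvg_cst.
    exact: (cvg_comp _ _ H3 (continuous_profile t0)).
  - move=> t n /off0 t0; rewrite !normrM -mulrDl; apply: ler_wpM2r => //.
    rewrite /reg_kernel.
    have n0 : 0 <= a_ n ^+ 2 by rewrite sqr_ge0.
    have n1 : a_ n ^+ 2 <= 1 by rewrite expr_le1// ltW.
    have H1 : profile d (nsq (rv t) + a_ n ^+ 2) <= profile d (nsq (rv t)).
      by apply: profile_nincr => //; lra.
    have H2 : profile d (nsq (rv t) + 1) <= profile d (nsq (rv t) + a_ n ^+ 2).
      by apply: profile_nincr => //; lra.
    have := ler_norm (profile d (nsq (rv t))).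
    have := ler_norm (- profile d (nsq (rv t) + 1)); rewrite normrN.
    have := normr_ge0 (profile d (nsq (rv t))).
    have := normr_ge0 (profile d (nsq (rv t) + 1)).
    by move=> *; rewrite ler_norml; apply/andP; split; lra.
have L2 : Int (fun z : V => f (a_ n *: z) * poisson z) @[n --> \oo] --> Int (fun z : V => f 0 * poisson z).
  have [M [M0 fM]] := test_fun_bounded tf.
  have := @Int_dominated_cvg R d (fun n (z : V) => f (a_ n *: z) * poisson z)
    (fun z : V => f 0 * poisson z) (fun z : V => M * poisson z) set0 _ _ _ measurable0 (measure0 _).
  case=> //.
  - by move=> n; apply: Intg_Meas; exact: Intg_test_poisson.
  - by apply: Intg_Meas; apply: IntgZ; exact: Intg_poisson.
  - by apply: IntgZ; exact: Intg_poisson.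
  - move=> t _; apply: cvgM; last exact: cvg_cst.
    have H3 : (fun n => a_ n *: rv t) @ \oo --> (0 : V).
      rewrite -(scale0r (rv t)); apply: cvgZ => //; exact: cvg_cst.
    exact: (cvg_comp _ _ H3 (@smooth_continuous _ _ f sf 0)).
  - move=> t n _; rewrite normrM [X in _ * X]ger0_norm ?powR_ge0//.
    by apply: ler_wpM2r => //; exact: powR_ge0.
have L3 : Int (fun x => reg_kernel (a_ n ^+ 2) x * Lap f x) @[n --> \oo] -->
    - d%:R * Int (fun z : V => f 0 * poisson z).
  under eq_fun do rewrite Int_reg_kernel_scaled//.
  by apply: cvgM => //; exact: cvg_cst.
rewrite (cvg_unique _ L1 L3)//.
by rewrite IntZ ?Int_poisson; [ring|exact: Intg_poisson].
Qed.

End NewtonIdentity.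

(** * Lattice sums and the divisible sandpile *)

Section LatticeSums.
Context (R : realType) (d : nat).
Notation Z := 'rV[int]_d.
Implicit Types f g u : Z -> R.

Definition fin_supp f := exists A : {fset Z}, forall k, k \notin A -> f k = 0.
(** By convention this sum is 0 when the support is infinite, hence the [fin_supp] conditions
    wherever two sums are combined or compared. *)
Definition lsum f : R := \sum_(k \in [set: Z]) f k.

Lemma lsumE f (A : {fset Z}) : (forall k, k \notin A -> f k = 0) ->
  lsum f = \sum_(k <- A) f k.
Proof. exact: fsbigTE. Qed.

Lemma fin_supp2 f g : fin_supp f -> fin_supp g ->
  exists A : {fset Z}, (forall k, k \notin A -> f k = 0) /\
    (forall k, k \notin A -> g k = 0).
Proof.
move=> [A HA] [B HB]; exists (A `|` B)%fset.
by split=> k; rewrite in_fsetU negb_or => /andP[kA kB]; [exact: HA|exact: HB].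
Qed.

Lemma fin_suppD f g : fin_supp f -> fin_supp g -> fin_supp (fun k => f k + g k).
Proof.
by move=> /fin_supp2 H /H [A [HA HB]]; exists A => k kA; rewrite HA// HB// addr0.
Qed.

Lemma fin_suppMl f g : fin_supp f -> fin_supp (fun k => f k * g k).
Proof. by move=> [A HA]; exists A => k kA; rewrite HA// mul0r. Qed.

Lemma fin_suppMr f g : fin_supp g -> fin_supp (fun k => f k * g k).
Proof. by move=> [A HA]; exists A => k kA; rewrite HA// mulr0. Qed.

Lemma fin_supp_shift f (e : Z) : fin_supp f -> fin_supp (fun k => f (k + e)).
Proof.
move=> [A HA]; exists [fset (k - e)%R | k in A]%fset => k kA; apply: HA.
by apply: contra kA => kA; apply/imfsetP; exists (k + e); rewrite ?addrK.
Qed.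

Lemma lsumD f g : fin_supp f -> fin_supp g ->
  lsum (fun k => f k + g k) = lsum f + lsum g.
Proof.
move=> /fin_supp2 H /H [A [HA HB]].
rewrite (lsumE HA) (lsumE HB) (@lsumE _ A) ?big_split// => k kA.
by rewrite HA// HB// addr0.
Qed.

Lemma lsumZ a f : lsum (fun k => a * f k) = a * lsum f.
Proof. by rewrite /lsum mulr_fsumr. Qed.

Lemma lsumB f g : fin_supp f -> fin_supp g ->
  lsum (fun k => f k - g k) = lsum f - lsum g.
Proof.
move=> Hf Hg; rewrite lsumD//; last first.
  by have [A HA] := Hg; exists A => k kA; rewrite HA ?oppr0.
congr (_ + _); rewrite -mulN1r -lsumZ; congr lsum.
by apply/funext => k; rewrite mulN1r.
Qed.

Lemma lsum_ge0 f : (forall k, 0 <= f k) -> 0 <= lsum f.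
Proof. by move=> f0; apply: fsumr_ge0. Qed.

Lemma lsum_le f g : fin_supp f -> fin_supp g -> (forall k, f k <= g k) ->
  lsum f <= lsum g.
Proof.
move=> /fin_supp2 H /H [A [HA HB]] fg.
by rewrite (lsumE HA) (lsumE HB); apply: ler_sum.
Qed.

Lemma lsum_norm f : fin_supp f -> `|lsum f| <= lsum (fun k => `|f k|).
Proof.
move=> [A HA]; rewrite (lsumE HA) (@lsumE _ A); first exact: ler_norm_sum.
by move=> k kA; rewrite HA// normr0.
Qed.

Lemma fin_supp_norm f : fin_supp f -> fin_supp (fun k => `|f k|).
Proof. by move=> [A HA]; exists A => k kA; rewrite HA// normr0. Qed.

Lemma lsum_ge_term f k : fin_supp f -> (forall j, 0 <= f j) -> f k <= lsum f.
Proof.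
move=> [A HA] f0; have [kA|/HA ->] := boolP (k \in A); last exact: lsum_ge0.
rewrite (lsumE HA) (big_fsetD1 k)//= lerDl.
by apply: sumr_ge0 => j _.
Qed.

Lemma lsum_shift f (e : Z) : lsum (fun k => f (k + e)) = lsum f.
Proof.
rewrite /lsum [RHS](@reindex_fsbigT _ _ _ _ _ (fun k : Z => k + e))//.
by exists (fun k => k - e) => k; rewrite ?addrK ?subrK.
Qed.

Lemma fin_supp_sum (F : 'I_d -> Z -> R) : (forall i, fin_supp (F i)) ->
  fin_supp (fun k => \sum_i F i k).
Proof.
move=> /choice[A HA]; exists (\big[@fsetU _/fset0]_(i <- index_enum 'I_d) A i)%fset => k kA.
apply: big1 => i _; apply: HA; apply: contra kA => kA.
by apply/bigfcupP; exists i => //; rewrite mem_index_enum.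
Qed.

Lemma lsum_sum (F : 'I_d -> Z -> R) : (forall i, fin_supp (F i)) ->
  lsum (fun k => \sum_i F i k) = \sum_i lsum (F i).
Proof.
move=> /choice[A HA]; pose B := (\big[@fsetU _/fset0]_(i <- index_enum 'I_d) A i)%fset.
have HB i k : k \notin B -> F i k = 0.
  move=> kA; apply: HA; apply: contra kA => kA.
  by apply/bigfcupP; exists i => //; rewrite mem_index_enum.
rewrite (@lsumE _ B); last by move=> k kB; apply: big1 => i _; exact: HB.
by rewrite exchange_big/=; apply: eq_bigr => i _; rewrite (lsumE (HB i)).
Qed.

Variable xi : R.

Lemma fin_supp_dLap u : fin_supp u -> fin_supp (dLap xi u).
Proof.
move=> fu; rewrite /dLap.
have [A HA] : fin_supp (fun y => \sum_(i < d)
    ((u (y + ievec i) - u y) + (u (y - ievec i) - u y))).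
  apply: fin_supp_sum => i.
  have [A HA] := fin_suppD (fin_supp_shift (ievec i) fu) (fin_supp_shift (- ievec i) fu).
  have [B HB] := fu; exists (A `|` B)%fset => k.
  rewrite in_fsetU negb_or => /andP[kA kB]; have := HA _ kA.
  by rewrite (HB _ kB); lra.
by exists A => k kA; rewrite HA ?mulr0.
Qed.

Lemma dLapE u k : dLap xi u k = (2 * d%:R * xi ^+ 2)^-1 *
  (\sum_(i < d) (u (k + ievec i) + u (k - ievec i)) - 2 * d%:R * u k).
Proof.
rewrite /dLap; congr (_ * _).
have -> : 2 * d%:R * u k = \sum_(i < d) (2 * u k).
  by rewrite sumr_const card_ord -[RHS]mulr_natl; ring.
by rewrite -sumrB; apply: eq_bigr => i _; ring.
Qed.

(** Translation invariance of lattice sums makes the discrete Laplacian symmetric. Only [u] has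
    finite support: [g] may be a paraboloid. *)
Lemma lsum_dLap u g : fin_supp u ->
  lsum (fun k => dLap xi u k * g k) = lsum (fun k => u k * dLap xi g k).
Proof.
move=> fu; set c := (2 * d%:R * xi ^+ 2)^-1.
pose P i k := (u (k + ievec i) + u (k - ievec i)) * g k.
pose Q i k := u k * (g (k + ievec i) + g (k - ievec i)).
have fP i : fin_supp (P i).
  by apply: fin_suppMl; apply: fin_suppD; exact: fin_supp_shift.
have fQ i : fin_supp (Q i) by exact: fin_suppMl.
have fug : fin_supp (fun k => 2 * d%:R * (u k * g k)).
  by apply: fin_suppMr; exact: fin_suppMl.
have PQ i : lsum (P i) = lsum (Q i).
  rewrite (_ : P i = fun k => u (k + ievec i) * g k + u (k - ievec i) * g k); last first.
    by apply/funext => k; rewrite /P mulrDl.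
  rewrite (_ : Q i = fun k => u k * g (k - ievec i) + u k * g (k + ievec i)); last first.
    by apply/funext => k; rewrite /Q addrC mulrDr.
  rewrite !lsumD; try (apply: fin_suppMl => //; exact: fin_supp_shift).
  congr (_ + _).
    rewrite -(lsum_shift (fun k => u k * g (k - ievec i)) (ievec i)).
    by congr lsum; apply/funext => k; rewrite addrK.
  rewrite -(lsum_shift (fun k => u k * g (k + ievec i)) (- ievec i)).
  by congr lsum; apply/funext => k; rewrite subrK.
transitivity (c * (lsum (fun k => \sum_i P i k) - lsum (fun k => 2 * d%:R * (u k * g k)))).
  rewrite -lsumB//; last exact: fin_supp_sum.
  rewrite -lsumZ; congr lsum; apply/funext => k; rewrite dLapE -/c -mulr_suml.
  by move: (\sum_(i < d) _) => a; ring.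
rewrite lsum_sum// (eq_bigr (fun i => lsum (Q i))) => [|i _]; last exact: PQ.
rewrite -lsum_sum// -lsumB//; last exact: fin_supp_sum.
rewrite -lsumZ; congr lsum; apply/funext => k; rewrite dLapE -/c -mulr_sumr.
by move: (\sum_(i < d) _) => a; ring.
Qed.

End LatticeSums.

(** * Lattice points and the paraboloid bound *)

Section Lattice.
Context (R : realType) (d : nat).
Notation Z := 'rV[int]_d.
Notation V := 'rV[R]_d.
Variable xi : R.

Lemma lattice_ptD (k l : Z) : lattice_pt xi (k + l) = lattice_pt xi k + lattice_pt xi l.
Proof. by rewrite /lattice_pt -scalerDr; congr (_ *: _); apply/rowP => i; rewrite !mxE intrD. Qed.

Lemma lattice_ptN (k : Z) : lattice_pt xi (- k) = - lattice_pt xi k.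
Proof. by rewrite /lattice_pt -scalerN; congr (_ *: _); apply/rowP => i; rewrite !mxE mulrNz. Qed.

Lemma lattice_pt_ievec (i : 'I_d) : lattice_pt xi (ievec i) = xi *: evec R i.
Proof.
congr (_ *: _); apply/rowP => j; rewrite !mxE.
by case: (_ && _).
Qed.

Hypothesis xi0 : 0 < xi.

Lemma finite_lattice_ball rad : exists B : {fset Z},
  forall k, (k \in B) = (enorm (lattice_pt xi k) < rad).
Proof.
pose N := Num.truncn (rad / xi); pose A : set Z := [set k | enorm (lattice_pt xi k) < rad].
pose h (f : {ffun 'I_d -> 'I_(N + N).+1}) : Z := \row_i ((f i)%:Z - N%:Z).
have fA : finite_set A.
  apply: (@sub_finite_set _ _ (h @` setT)); last exact: finite_image.
  move=> k Ak.
  have kN i : (`|k 0 i| <= N%:Z)%R.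
    have := coord_le_enorm (lattice_pt xi k) i; rewrite !mxE normrM gtr0_norm// => kr.
    have {kr}kr : `|k 0 i|%:~R < rad / xi.
      by rewrite ltr_pdivlMr// mulrC intr_norm; exact: le_lt_trans kr Ak.
    have r0 : 0 <= rad / xi.
      by apply: ltW; apply: le_lt_trans kr; rewrite ler0z.
    have [_ H] := andP (truncn_itv r0); rewrite -/N in H.
    have := lt_trans kr H; rewrite -[N.+1%:R]/(N.+1%:~R) ltr_int; lia.
  have kN2 (i : 'I_d) : (absz (k 0 i + N%:Z)%R < (N + N).+1)%N by have := kN i; lia.
  exists [ffun i => Ordinal (kN2 i)] => //.
  by apply/rowP => i; rewrite mxE ffunE /=; have := kN i; lia.
exists (fset_set A) => k; rewrite in_fset_set//.
by apply/idP/idP => [/set_mem//|kA]; exact: mem_set.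
Qed.

Lemma nsq_lattice_step (k : Z) (i : 'I_d) :
  nsq (lattice_pt xi (k + ievec i)) + nsq (lattice_pt xi (k - ievec i)) =
  2 * nsq (lattice_pt xi k) + 2 * xi ^+ 2.
Proof.
rewrite !lattice_ptD lattice_ptN lattice_pt_ievec; move: (lattice_pt xi k) => x.
rewrite /nsq -big_split mulr_sumr /=.
have -> : 2 * xi ^+ 2 = \sum_(j < d) (if j == i then 2 * xi ^+ 2 else 0).
  by rewrite -big_mkcond big_pred1_eq.
rewrite -big_split; apply: eq_bigr => j _; rewrite !mxE eqxx/=.
by case: eqP => _ /=; ring.
Qed.

Hypothesis d0 : (0 < d)%N.

Lemma dLap_paraboloid (C : R) (k : Z) :
  dLap xi (fun k => C - nsq (lattice_pt xi k)) k = -1.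
Proof.
rewrite dLapE.
rewrite (eq_bigr (fun=> 2 * C - (2 * nsq (lattice_pt xi k) + 2 * xi ^+ 2))); last first.
  by move=> i _; rewrite -(nsq_lattice_step k i); move: (nsq _) (nsq _) => a b; ring.
rewrite sumr_const card_ord -[X in X - _]mulr_natl.
have : d%:R != 0 :> R by rewrite pnatr_eq0 -lt0n.
move: (nsq _) => a dd; field.
by rewrite dd gt_eqF.
Qed.

Variables (rad : R) (B : {fset Z}).
Hypotheses (rad0 : 0 < rad) (HB : forall k, (k \in B) = (enorm (lattice_pt xi k) < rad)).

Lemma enorm_lattice_neighbour (k : Z) (i : 'I_d) (e : bool) :
  (k + (-1) ^+ e *: ievec i) \in B -> enorm (lattice_pt xi k) < rad + xi.
Proof.
rewrite HB => kB.
have E : lattice_pt xi k = lattice_pt xi (k + (-1) ^+ e *: ievec i) - (-1) ^+ e *: (xi *: evec R i).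
  rewrite lattice_ptD -lattice_pt_ievec; case: e {kB}; rewrite ?expr0 ?expr1.
    by rewrite !scaleN1r lattice_ptN opprK subrK.
  by rewrite !scale1r addrK.
rewrite E; apply: le_lt_trans (enorm_triangle _ _) _; rewrite enormN.
have -> : enorm ((-1) ^+ e *: (xi *: evec R i)) = xi.
  case: (e); rewrite ?expr0 ?expr1 ?scaleN1r ?scale1r ?enormN enormZ ?enorm_evec ?mulr1//; exact: ltW.
by rewrite ltrD2r.
Qed.

(** Summation by parts against the paraboloid [(rad + xi)^2 - |x|^2], whose
    discrete Laplacian is [-1]. *)
Lemma lsum_le_superharmonic (z b : Z -> R) :
  (forall k, 0 <= z k) -> (forall k, k \notin B -> z k = 0) ->
  (forall k, 0 <= b k) -> (forall k, k \notin B -> b k = 0) ->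
  (forall k, 0 < z k -> - dLap xi z k <= b k) ->
  lsum z <= (rad + xi) ^+ 2 * lsum b.
Proof.
move=> z0 zB b0 bB zb.
pose p (k : Z) := (rad + xi) ^+ 2 - nsq (lattice_pt xi k).
have fz : fin_supp z by exists B.
have fb : fin_supp b by exists B.
have -> : lsum z = lsum (fun k => - dLap xi z k * p k).
  transitivity (- lsum (fun k => dLap xi z k * p k)).
    rewrite lsum_dLap// -mulN1r -lsumZ; congr lsum; apply/funext => k.
    by rewrite dLap_paraboloid; ring.
  by rewrite -mulN1r -lsumZ; congr lsum; apply/funext => k; ring.
rewrite -lsumZ; apply: lsum_le; first 2 last.
- move=> k.
  have r0 : 0 <= rad + xi by exact: addr_ge0 (ltW rad0) (ltW xi0).
  have pC : p k <= (rad + xi) ^+ 2 by rewrite /p lerBlDr lerDl nsq_ge0.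
  have p0 : enorm (lattice_pt xi k) < rad + xi -> 0 <= p k.
    by move=> kr; rewrite /p subr_ge0 -sqr_enorm ler_sqr ?nnegrE ?enorm_ge0// ltW.
  have [zk|zk] := ltP 0 (z k).
    have kB : k \in B by apply/negPn/negP => /zB zk0; rewrite zk0 ltxx in zk.
    have {}p0 : 0 <= p k by apply: p0; move: kB; rewrite HB => kB; apply: lt_le_trans kB _; rewrite lerDl ltW.
    apply: (@le_trans _ _ (b k * p k)); first by apply: ler_wpM2r => //; exact: zb.
    by rewrite mulrC; apply: ler_wpM2r.
  have {}zk : z k = 0 by apply/eqP; rewrite eq_le zk z0.
  have c0 : 0 <= (2 * d%:R * xi ^+ 2)^-1.
    by rewrite invr_ge0; apply: mulr_ge0; [apply: mulr_ge0; exact: ler0n|exact: sqr_ge0].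
  apply: (@le_trans _ _ 0); last by apply: mulr_ge0 => //; exact: sqr_ge0.
  rewrite mulNr oppr_le0 dLapE zk mulr0 subr0.
  have S0 i : 0 <= z (k + ievec i) + z (k - ievec i) by rewrite addr_ge0.
  (* Where [z] vanishes its Laplacian is nonnegative, but [p] is negative beyond radius rad + xi. A
     point with a neighbour in [B] lies within that radius; at any other point the Laplacian of [z]
     is 0. *)
  have [/existsP[i ki]|/existsPn Hk] := boolP [exists i, (k + ievec i \in B) || (k - ievec i \in B)].
    apply: mulr_ge0; first by apply: mulr_ge0 => //; apply: sumr_ge0.
    apply: p0; case/orP: ki => ki.
      by apply: (@enorm_lattice_neighbour k i false); rewrite expr0 scale1r.
    by apply: (@enorm_lattice_neighbour k i true); rewrite expr1 scaleN1r.
  rewrite big1 ?mulr0 ?mul0r// => i _; have := Hk i.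
  by rewrite negb_or => /andP[k1 k2]; rewrite !zB// addr0.
- have [A HA] := fin_supp_dLap xi fz; exists A => k kA.
  by rewrite HA// oppr0 mul0r.
- by exists B => k kB; rewrite bB// mulr0.
Qed.

End Lattice.

(** * The divisible sandpile and its odometer *)

Section Sandpile.
Context (R : realType) (d : nat).
Notation Z := 'rV[int]_d.
Variables (xi rad : R) (B : {fset Z}).
Hypotheses (d0 : (0 < d)%N) (xi0 : 0 < xi) (rad0 : 0 < rad)
  (HB : forall k, (k \in B) = (enorm (lattice_pt xi k) < rad)).

(** [is_GDS] speaks of every admissible sequence, so one must be exhibited before it yields
    anything; cycling through the finite ball does. *)
Lemma admissible_sequence : exists s : nat -> Z, admissible xi rad s.
Proof.
have B0 : 0 \in B.
  rewrite HB (_ : lattice_pt xi 0 = 0) ?enorm0//.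
  by apply/rowP => i; rewrite !mxE mulr0.
have sB : (0 < size B)%N by case: (enum_fset B) (B0 : 0 \in enum_fset B).
exists (fun m => nth 0 B (m %% size B)%N); split=> [m|x].
  by rewrite -HB; apply: mem_nth; rewrite ltn_mod.
rewrite -HB => xB N.
exists (N * size B + index x B)%N; split.
  by rewrite (leq_trans _ (leq_addr _ _))// leq_pmulr.
by rewrite modnMDl modn_small ?index_mem// nth_index.
Qed.

Lemma dLap_ddelta (x y : Z) : dLap xi (ddelta R x) y =
  (2 * d%:R * xi ^+ 2)^-1 * (\sum_(i < d) (ddelta R x (y + ievec i) + ddelta R x (y - ievec i))
    - 2 * d%:R * ddelta R x y).
Proof. exact: dLapE. Qed.

Let c0 : 0 < 2 * d%:R * xi ^+ 2.
Proof. by rewrite !mulr_gt0 ?ltr0n ?exprn_gt0. Qed.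

Lemma dLap_ddelta_self (x : Z) : xi ^+ 2 * dLap xi (ddelta R x) x = -1.
Proof.
rewrite dLap_ddelta big1 => [|i _].
  rewrite /ddelta eqxx sub0r mulr1.
  have dd : d%:R != 0 :> R by rewrite pnatr_eq0 -lt0n.
  by field; rewrite dd gt_eqF.
have e0 : ievec i != 0 :> Z.
  by apply/eqP => /rowP/(_ i); rewrite !mxE !eqxx.
rewrite /ddelta ifF ?ifF ?addr0//; apply/negbTE; apply: contra e0 => /eqP E.
  by rewrite -[ievec i]opprK -(addrK x (- ievec i)) (addrC _ x) E subrr oppr0.
by rewrite -[ievec i](addrK x) (addrC _ x) E subrr.
Qed.

Lemma dLap_ddelta_ge0 (x y : Z) : y != x -> 0 <= xi ^+ 2 * dLap xi (ddelta R x) y.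
Proof.
move=> yx; apply: mulr_ge0; first exact: sqr_ge0.
rewrite dLap_ddelta; apply: mulr_ge0; first by rewrite invr_ge0 ltW.
rewrite [X in _ - _ * X]/ddelta (negPf yx) mulr0 subr0; apply: sumr_ge0 => i _.
by apply: addr_ge0; rewrite /ddelta; case: eqP.
Qed.

Lemma dLapD (f g : Z -> R) k : dLap xi (fun k => f k + g k) k = dLap xi f k + dLap xi g k.
Proof.
rewrite !dLapE (eq_bigr (fun i => (f (k + ievec i) + f (k - ievec i)) +
  (g (k + ievec i) + g (k - ievec i)))) => [|i _]; last by ring.
by rewrite big_split /=; move: (\sum_(i < d) _) (\sum_(i < d) _) => a b; ring.
Qed.

Lemma dLapZ a (f : Z -> R) k : dLap xi (fun k => a * f k) k = a * dLap xi f k.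
Proof.
rewrite !dLapE (eq_bigr (fun i => a * (f (k + ievec i) + f (k - ievec i)))) => [|i _]; last by ring.
by rewrite -mulr_sumr; move: (\sum_(i < d) _) => b; ring.
Qed.

Lemma dLap_le (f g : Z -> R) k : (forall j, f j <= g j) -> f k = g k ->
  dLap xi f k <= dLap xi g k.
Proof.
move=> fg E; rewrite !dLapE E; apply: ler_wpM2l; first by rewrite invr_ge0 ltW.
by rewrite lerD2r; apply: ler_sum => i _; apply: lerD.
Qed.

Lemma dLap_cvg (u : nat -> Z -> R) (v : Z -> R) k :
  (forall j, (fun n => u n j) @ \oo --> v j) -> (fun n => dLap xi (u n) k) @ \oo --> dLap xi v k.
Proof.
move=> uv; under eq_fun do rewrite dLapE; rewrite dLapE.
apply: cvgM; first exact: cvg_cst.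
apply: cvgB; last by apply: cvgM; [exact: cvg_cst|exact: uv].
by apply: cvg_big => //; [exact: add_continuous|] => i _; apply: cvgD; exact: uv.
Qed.

Variable tau : Z -> R.
Hypothesis tauB : forall k, k \notin B -> tau k = 0.

Section Run.
Variable s : nat -> Z.
Hypothesis sB : admissible xi rad s.

(** Emitted mass multiplied by xi^2, the factor that [topple] puts in front of [dLap]; the
    configuration is then tau + dLap of the odometer. *)
Fixpoint odometer (n : nat) : Z -> R :=
  match n with
  | 0 => fun=> 0
  | n'.+1 => fun k => odometer n' k +
      Num.max (run xi s tau n' (s n')) 0 * xi ^+ 2 * ddelta R (s n') k
  end.

Lemma run_odometer n k : run xi s tau n k = tau k + dLap xi (odometer n) k.
Proof.
elim: n k => [|n IH] k /=.
  rewrite dLapE big1 ?mulr0 ?subr0 ?mulr0 ?addr0// => i _; exact: addr0.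
by rewrite {1}/topple IH dLapD dLapZ addrA.
Qed.

Lemma odometer_step n k : odometer n k <= odometer n.+1 k.
Proof.
rewrite /= lerDl; apply: mulr_ge0; last by rewrite /ddelta; case: eqP.
by apply: mulr_ge0; [rewrite le_max lexx orbT|exact: sqr_ge0].
Qed.

Lemma odometer_ge0 n k : 0 <= odometer n k.
Proof. by elim: n => // n IH; apply: le_trans IH (odometer_step n k). Qed.

Lemma odometer_notin n k : k \notin B -> odometer n k = 0.
Proof.
move=> kB; elim: n => //= n ->; rewrite /ddelta ifF ?mulr0 ?addr0//.
by apply/negbTE; apply: contra kB => /eqP ->; rewrite HB; exact: sB.1.
Qed.

Lemma run_toppled n : run xi s tau n.+1 (s n) <= 0.
Proof.
rewrite /= /topple -mulrA dLap_ddelta_self mulrN1.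
by rewrite subr_le0 le_max lexx.
Qed.

(** A toppling with positive mass leaves exactly 0, and afterwards a point only receives mass until
    it topples again. *)
Lemma run_ge0_odometer n k : 0 < odometer n k -> 0 <= run xi s tau n k.
Proof.
elim: n k => [|n IH] k /=; first by rewrite ltxx.
rewrite /topple -!(mulrA (Num.max _ _) (xi ^+ 2)); have [->|kx] := eqVneq k (s n); last first.
  rewrite [ddelta _ _ k]/ddelta (negPf kx) !mulr0 addr0 => /IH r0.
  apply: addr_ge0 => //; apply: mulr_ge0; first by rewrite le_max lexx orbT.
  exact: dLap_ddelta_ge0.
rewrite dLap_ddelta_self mulrN1 => H; rewrite subr_ge0 ge_max lexx /=.
(* With negative mass nothing is emitted, so the odometer was positive already and the induction
   hypothesis contradicts the sign. *)
have [//|r0] := leP 0 (run xi s tau n (s n)); exfalso.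
move: H; rewrite (max_idPr (ltW r0)) mul0r addr0 => /IH; rewrite leNgt => /negP; exact.
Qed.

(** A point with positive odometer has tau + dLap >= 0, so the paraboloid bound applies with source
    |tau|. The result is uniform in [n], which makes the monotone odometers converge. *)
Lemma odometer_sum n : lsum (odometer n) <= (rad + xi) ^+ 2 * lsum (fun k => `|tau k|).
Proof.
apply: (lsum_le_superharmonic xi0 d0 rad0 HB) => //.
- exact: odometer_ge0.
- exact: odometer_notin.
- by move=> k /tauB ->; rewrite normr0.
- move=> k /run_ge0_odometer; rewrite run_odometer => H.
  by apply: le_trans (ler_norm _); rewrite lerNl -subr_ge0 opprK addrC.
Qed.

End Run.

Lemma GDS_odometer (eta : Z -> R) : is_GDS xi rad tau eta -> exists u : Z -> R,
  [/\ forall k, 0 <= u k, forall k, k \notin B -> u k = 0,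
      forall k, eta k = tau k + dLap xi u k &
      (forall k, k \in B -> eta k <= 0) /\ (forall k, 0 < u k -> 0 <= eta k)].
Proof.
have [s sB] := admissible_sequence; move=> /(_ s sB) run_eta.
pose o := odometer s.
have nd k : nondecreasing_seq (o^~ k).
  by apply/nondecreasing_seqP => n; exact: odometer_step.
have bd k : has_ubound (range (o^~ k)).
  exists ((rad + xi) ^+ 2 * lsum (fun k => `|tau k|)) => _ [n _ <-].
  apply: le_trans (odometer_sum sB n); apply: lsum_ge_term.
    by exists B => j; exact: odometer_notin.
  by move=> j; exact: odometer_ge0.
pose u k := sup (range (o^~ k)).
have ou k : (fun n => o n k) @ \oo --> u k by exact: nondecreasing_cvgn (nd k) (bd k).
have ole n k : o n k <= u k by apply: ub_le_sup; [exact: bd|exists n].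
exists u; split.
- by move=> k; apply: le_trans (ole 0%N k).
- move=> k kB.
  have E : (fun n => o n k) = fun=> 0 by apply/funext => n; exact: odometer_notin.
  by have := ou k; rewrite E => /cvg_unique; apply => //; exact: cvg_cst.
- move=> k; have E : run xi s tau ^~ k = fun n => tau k + dLap xi (o n) k.
    by apply/funext => n; exact: run_odometer.
  have := run_eta k; rewrite E => /cvg_unique; apply => //.
  by apply: cvgD; [exact: cvg_cst|exact: dLap_cvg].
split=> k.
- rewrite HB => kB; rewrite leNgt; apply/negP => e0.
  (* Each point of the ball topples at arbitrarily late times, and right after a toppling its value
     is at most 0. *)
  have /cvgrPdist_lt/(_ _ e0)[N _ HN] := run_eta k.
  have [m [Nm sm]] := sB.2 k kB N.
  have := HN m.+1 (leqW Nm); have := run_toppled s m; rewrite sm.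
  by move: (run _ _ _ _ _) => r r0; rewrite ltNge => /negP; apply; rewrite ger0_norm; lra.
- move=> u0.
  have [n on] : exists n, 0 < o n k.
    apply: contrapT => H; move: u0; rewrite ltNge => /negP; apply.
    apply: ge_sup; first by exists (o 0%N k); exists 0%N.
    by move=> _ [n _ <-]; rewrite leNgt; apply/negP => o0; apply: H; exists n.
  apply: (cvgr_to_ge (run_eta k)); exists n => // m /= nm.
  apply: run_ge0_odometer; apply: lt_le_trans on _; exact: nd.
Qed.

(** A quantitative least action principle. Where u > w, the function (u - w)^+ equals u - w and
    dominates it elsewhere, so its Laplacian is at least dLap u - dLap w >= -tau - (b - tau) =
    -b. *)
Lemma sandpile_comparison (u w b : Z -> R) :
  (forall k, 0 <= u k) -> (forall k, k \notin B -> u k = 0) ->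
  (forall k, 0 < u k -> 0 <= tau k + dLap xi u k) ->
  (forall k, 0 <= w k) -> (forall k, 0 <= b k) -> (forall k, k \notin B -> b k = 0) ->
  (forall k, k \in B -> tau k + dLap xi w k <= b k) ->
  lsum (fun k => Num.max (u k - w k) 0) <= (rad + xi) ^+ 2 * lsum b.
Proof.
move=> u0 uB ue w0 b0 bB wb.
apply: (lsum_le_superharmonic xi0 d0 rad0 HB) => //.
- by move=> k; rewrite le_max lexx orbT.
- by move=> k kB; rewrite uB// sub0r; apply/max_idPr; rewrite oppr_le0.
- move=> k; rewrite lt_max ltxx orbF subr_gt0 => wu.
  have uk : 0 < u k by exact: le_lt_trans (w0 k) wu.
  have kB : k \in B by apply/negPn/negP => /uB uk0; rewrite uk0 ltxx in uk.
  have H : dLap xi (fun k => u k + -1 * w k) k <= dLap xi (fun k => Num.max (u k - w k) 0) k.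
    apply: dLap_le => [j|]; first by rewrite mulN1r le_max lexx.
    by rewrite mulN1r; apply/esym/max_idPl; rewrite subr_ge0 ltW.
  move: H (ue k uk) (wb k kB); rewrite dLapD dLapZ.
  by move: (dLap _ _ _) (dLap _ _ _) (dLap _ _ _) => x y z; lra.
Qed.

End Sandpile.

(** * Lattice cells *)

Section Cells.
Context (R : realType) (d : nat).
Notation Z := 'rV[int]_d.
Notation V := 'rV[R]_d.
Notation tup n := (n.-tuple (measurableTypeR R)).
Variable xi : R.
Hypothesis xi0 : 0 < xi.

(** Rounding to the nearest lattice point; its fibres are half-open cells, which
    partition the space exactly. The closed cells of [cell_avg] differ from them
    by finitely many null faces. *)
Definition near_pt (y : V) : Z := \row_i Num.floor (y 0 i / xi + 2^-1).

Definition cell_ind (k : Z) (y : V) : R := if near_pt y == k then 1 else 0.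

Lemma cell_indE k y : cell_ind k y = if near_pt y == k then 1 else 0.
Proof. by []. Qed.

Lemma near_ptP (k : Z) (y : V) : reflect
  (forall i, lattice_pt xi k 0 i - xi / 2 <= y 0 i < lattice_pt xi k 0 i + xi / 2)
  (near_pt y == k).
Proof.
have E (i : 'I_d) : (lattice_pt xi k 0 i - xi / 2 <= y 0 i < lattice_pt xi k 0 i + xi / 2) =
    (Num.floor (y 0 i / xi + 2^-1) == k 0 i).
  rewrite floor_eq !mxE; move: (y 0 i) => a; rewrite intrD.
  move: ((k 0 i)%:~R : R) => b; rewrite -lerBlDr ler_pdivlMr// -ltrBrDr ltr_pdivrMr//.
  by congr (_ && _); [congr (_ <= _)|congr (_ < _)]; field.
apply: (iffP eqP) => [yk i|H].
  by rewrite E; apply/eqP; move/rowP/(_ i): yk; rewrite mxE.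
by apply/rowP => i; have := H i; rewrite E mxE => /eqP.
Qed.

Lemma near_pt_close (y : V) (i : 'I_d) : `|y 0 i - lattice_pt xi (near_pt y) 0 i| <= xi / 2.
Proof.
have /near_ptP/(_ i)/andP[H1 H2] := eqxx (near_pt y).
by rewrite ler_norml; lra.
Qed.

Lemma near_pt_dist (y : V) : enorm (lattice_pt xi (near_pt y) - y) <= d%:R * xi.
Proof.
apply: enorm_le_coord => [|i]; first exact: ltW.
rewrite mxE [(- y) _ _]mxE distrC; apply: le_trans (near_pt_close _ _) _; move: xi0 => ?; lra.
Qed.

Let lo (k : Z) : V := \row_i (lattice_pt xi k 0 i - xi / 2).
Let hi (k : Z) : V := \row_i (lattice_pt xi k 0 i + xi / 2).
(** A degenerate box: the upper face in direction [i], where the closed cell exceeds the half-open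
    one. *)
Let face (k : Z) (i : 'I_d) : V := \row_j (if j == i then hi k 0 j else lo k 0 j).
Let cbox (k : Z) := @tbox R d (nat_coord (lo k)) (nat_coord (hi k)).
Let faces (k : Z) := \bigcup_(i in [set: 'I_d]) @tbox R d (nat_coord (face k i)) (nat_coord (hi k)).

Let measurable_cbox k : measurable (cbox k). Proof. exact: measurable_tbox. Qed.

Let measurable_faces k : measurable (faces k).
Proof. by apply: fin_bigcup_measurable; [exact: finite_finset|move=> i _; exact: measurable_tbox]. Qed.

Let cboxP k t : cbox k t <-> forall i, `|rv t 0 i - lattice_pt xi k 0 i| <= xi / 2.
Proof.
split=> H i; have := H i.
  by rewrite !nat_coordE ler_norml !mxE; lra.
by rewrite !nat_coordE ler_norml !mxE; lra.
Qed.

Let measure_cbox k : mu R d (cbox k) = (xi ^+ d)%:E.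
Proof.
have E := @measure_tbox R d (nat_coord (lo k)) (nat_coord (hi k)).
rewrite [LHS]E => [|i id].
  congr EFin; rewrite -[X in _ ^+ X]card_ord -prodr_const; apply: eq_bigr => i _.
  by rewrite !nat_coordE !mxE; field.
by rewrite -[i]/(nat_of_ord (Ordinal id)) !nat_coordE !mxE; move: (_ * _) xi0 => a b; lra.
Qed.

Let measure_faces k : mu R d (faces k) = 0%E.
Proof.
have F0 i : mu R d (@tbox R d (nat_coord (face k i)) (nat_coord (hi k))) = 0%E.
  have E := @measure_tbox R d (nat_coord (face k i)) (nat_coord (hi k)).
  rewrite [LHS]E => [|j jd].
    by rewrite (bigD1 i)//= !nat_coordE !mxE eqxx subrr mul0r.
  rewrite -[j]/(nat_of_ord (Ordinal jd)) !nat_coordE !mxE.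
  by case: eqP => _ //; move: (_ * _) xi0 => a b; lra.
apply/eqP; rewrite eq_le measure_ge0 andbT.
apply: (@le_trans _ _ (\sum_(i \in [set: 'I_d])
    mu R d (@tbox R d (nat_coord (face k i)) (nat_coord (hi k))))%E).
  apply: content_sub_fsum => //; first exact: finite_finset.
  by move=> i _; exact: measurable_tbox.
by rewrite fsbig1// => i _; exact: F0.
Qed.

Let cell_notin_faces k t : ~ faces k t ->
  (near_pt (rv t) == k) = `[< forall i, `|rv t 0 i - lattice_pt xi k 0 i| <= xi / 2 >].
Proof.
move=> Ft; apply/near_ptP/asboolP => H i.
  by have := H i; rewrite ler_norml; lra.
have := H i; rewrite ler_norml => Hi; apply/andP; split; first by lra.
rewrite lt_neqAle; apply/andP; split; last by lra.
apply/eqP => E; apply: Ft; exists i => // j; rewrite !nat_coordE !mxE.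
have := H j; rewrite ler_norml !mxE; case: eqP => [->|_]; last by lra.
by move: E; rewrite !mxE => ->; lra.
Qed.

Lemma Meas_cell_ind k : Meas (cell_ind k).
Proof.
have -> : cell_ind k = fun y => \1_[set t : tup d | near_pt (rv t) == k] (tv y).
  apply/funext => y; rewrite indicE /cell_ind; case: ifPn => H.
    by rewrite mem_set//= tvK.
  by rewrite memNset//= tvK; exact/negP.
rewrite /Meas (_ : _ \o _ = \1_[set t : tup d | near_pt (rv t) == k]); last first.
  by apply/funext => t /=; rewrite rvK.
apply: measurable_indic.
have -> : [set t : tup d | near_pt (rv t) == k] = \bigcap_(i in [set: 'I_d])
    ((fun t => tnth t i) @^-1` `[lo k 0 i, hi k 0 i[%classic).
  apply/seteqP; split=> t /=.
    by move=> /near_ptP H i _; have := H i; rewrite /= in_itv/= !mxE.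
  by move=> H; apply/near_ptP => i; have := H i I; rewrite /= in_itv/= !mxE.
apply: fin_bigcap_measurable; first exact: finite_finset.
by move=> i _; rewrite -[X in measurable X]setTI; apply: measurable_tnth.
Qed.

Lemma Intg_mul_cell_ind (G : V -> R) k : Intg G -> Intg (fun y => G y * cell_ind k y).
Proof.
move=> iG; apply: (le_Intg _ (Intg_norm iG)).
  by apply: MeasM; [exact: Intg_Meas|exact: Meas_cell_ind].
by move=> y; rewrite /cell_ind; case: ifP => _; rewrite ?mulr1 ?mulr0 ?normr0.
Qed.

Lemma cell_ind_eq0 k y : enorm (lattice_pt xi k) + d%:R * xi < enorm y -> cell_ind k y = 0.
Proof.
rewrite /cell_ind; case: eqP => // <-; have := near_pt_dist y.
have := enorm_triangle (lattice_pt xi (near_pt y)) (- (lattice_pt xi (near_pt y) - y)).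
rewrite enormN opprB addrC subrK; lra.
Qed.

Lemma Intg_cell_ind k : Intg (cell_ind k).
Proof.
apply: (@Intg_bounded _ _ _ 1 (enorm (lattice_pt xi k) + d%:R * xi + 1)); first exact: Meas_cell_ind.
  by move=> y; rewrite /cell_ind; case: ifP => _; rewrite ?normr1 ?normr0.
move=> y ry; apply: cell_ind_eq0; lra.
Qed.

Lemma Int_cell_ind k : Int (cell_ind k) = xi ^+ d.
Proof.
rewrite -(intRdE (Intg_cell_ind k) (measurable_faces k) (measure_faces k)
  (f := fun y => if `[< forall i, `|y 0 i - lattice_pt xi k 0 i| <= xi / 2 >] then 1 else 0)); last first.
  by move=> t Ft; rewrite /cell_ind (cell_notin_faces Ft).
have E : (fun y : V => if `[< forall i, `|y 0 i - lattice_pt xi k 0 i| <= xi / 2 >] then 1 else 0) \o rv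
    = \1_(cbox k) :> (tup d -> R).
  apply/funext => t /=; rewrite indicE; case: asboolP => H.
    by rewrite mem_set//; apply/cboxP.
  by rewrite memNset// => /cboxP.
have I : Intg (fun y : V => if `[< forall i, `|y 0 i - lattice_pt xi k 0 i| <= xi / 2 >] then 1 else 0).
  rewrite /Intg E; apply/integrableP; split; first exact/measurable_EFinP/measurable_indic.
  rewrite (eq_integral (fun x => (\1_(cbox k) x)%:E)); last first.
    by move=> t _; rewrite gee0_abs// lee_fin.
  by rewrite integral_indic// setIT [X in (X < _)%E]measure_cbox ltry.
rewrite intRd_Int//; apply: EFin_inj; rewrite IntE// -(measure_cbox k).
rewrite -[in RHS](setIT (cbox k)) -integral_indic//; apply: eq_integral => t _.
by congr EFin; have := congr1 (fun f => f t) E.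
Qed.

Lemma near_pt_sum (F : Z -> R) (A : {fset Z}) (y : V) : (forall k, k \notin A -> F k = 0) ->
  F (near_pt y) = \sum_(k <- A) F k * cell_ind k y.
Proof.
move=> FA; have [yA|yA] := boolP (near_pt y \in A).
  rewrite (big_fsetD1 _ yA)/= [cell_ind (near_pt y) y]/cell_ind eqxx mulr1 big_seq big1 ?addr0// => k.
  by rewrite in_fsetD1 /cell_ind eq_sym => /andP[/negPf -> _]; rewrite mulr0.
rewrite FA// big_seq big1// => k kA; rewrite /cell_ind.
by case: eqP => [E|]; rewrite ?mulr0//; move: yA; rewrite E kA.
Qed.

Lemma Int_near_pt (F : Z -> R) (G : V -> R) : fin_supp F -> Intg G ->
  Intg (fun y => G y * F (near_pt y)) /\
  Int (fun y => G y * F (near_pt y)) = lsum (fun k => F k * Int (fun y => G y * cell_ind k y)).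
Proof.
move=> [A FA] iG.
have E : (fun y => G y * F (near_pt y)) =
    fun y => \sum_(k <- A) F k * (G y * cell_ind k y).
  apply/funext => y; rewrite (near_pt_sum y FA) mulr_sumr.
  by apply: eq_bigr => k _; ring.
have I k : Intg (fun y => F k * (G y * cell_ind k y)).
  by apply: IntgZ; exact: Intg_mul_cell_ind.
rewrite E; split; first exact: Intg_sum.
rewrite Int_sum// (@lsumE _ _ _ A) => [|k kA]; last by rewrite FA// mul0r.
by apply: eq_bigr => k _; rewrite IntZ//; exact: Intg_mul_cell_ind.
Qed.

(** Rounding turns a lattice function into a step function, so a scaled lattice sum is exactly an
    integral; errors of Riemann sums become pointwise differences under one integral sign. *)
Lemma Int_lsum (F : Z -> R) : fin_supp F ->
  Intg (fun y => F (near_pt y)) /\ Int (fun y => F (near_pt y)) = xi ^+ d * lsum F.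
Proof.
move=> [A FA].
have E : (fun y => F (near_pt y)) = fun y => \sum_(k <- A) F k * cell_ind k y.
  by apply/funext => y; exact: near_pt_sum.
rewrite E; split; first by apply: Intg_sum => k; apply: IntgZ; exact: Intg_cell_ind.
rewrite Int_sum; last by move=> k; apply: IntgZ; exact: Intg_cell_ind.
rewrite (lsumE FA) mulr_sumr; apply: eq_bigr => k _.
by rewrite (IntZ _ (Intg_cell_ind k)) Int_cell_ind mulrC.
Qed.

Variables (sigma s : V -> R) (N : set (tup d)).
Hypotheses (mN : measurable N) (N0 : mu R d N = 0%E)
  (sN : forall t, ~ N t -> sigma (rv t) = s (rv t)) (is_ : Intg s).

(** Two changes off null sets at once: [sigma] becomes its Borel version, and the closed cell
    becomes the half-open one. *)
Lemma cell_avgE k : cell_avg xi sigma k = xi ^- d * Int (fun y => s y * cell_ind k y).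
Proof.
congr (_ * _).
apply: (@intRdE _ _ _ _ (N `|` faces k)); first exact: Intg_mul_cell_ind.
- exact: measurableU.
- have := measureU0 mN (measurable_faces k) (measure_faces k).
  by rewrite [X in _ = X -> _]N0.
- move=> t /not_orP[Nt Ft]; rewrite sN// -(cell_notin_faces Ft) /cell_ind.
  by case: ifP; rewrite ?mulr1 ?mulr0.
Qed.

End Cells.

(** * Positive functionals on test functions *)

Section TestFunctionals.
Context (R : realType) (d : nat).
Notation V := 'rV[R]_d.
Implicit Types (f g : V -> R) (T : (V -> R) -> R).

Definition linear_on_tests T := forall (a : R) f g, test_fun f -> test_fun g ->
  T (fun x => a * f x + g x) = a * T f + T g.
Definition positive_on_tests T := forall f, test_fun f -> (forall x, 0 <= f x) -> 0 <= T f.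

Lemma ext_test T f g : (forall x, f x = g x) -> T f = T g.
Proof. by move=> fg; congr T; apply/funext. Qed.

Section Linear.
Variable T : (V -> R) -> R.
Hypothesis linT : linear_on_tests T.

Lemma linear_test0 : T (fun=> 0) = 0.
Proof.
have := linT 1 (test_fun0 R d) (test_fun0 R d).
rewrite (@ext_test T (fun x : V => 1 * 0 + 0) (fun=> 0)); first by lra.
by move=> x; rewrite mulr0 addr0.
Qed.

Lemma linear_testZ a f : test_fun f -> T (fun x => a * f x) = a * T f.
Proof.
move=> tf; have := linT a tf (test_fun0 R d); rewrite linear_test0 addr0 => <-.
by apply: ext_test => x; rewrite addr0.
Qed.

Lemma linear_testD f g : test_fun f -> test_fun g -> T (fun x => f x + g x) = T f + T g.
Proof.
move=> tf tg; have := linT 1 tf tg; rewrite mul1r => <-.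
by apply: ext_test => x; rewrite mul1r.
Qed.

Lemma test_funB f g : test_fun f -> test_fun g -> test_fun (fun x => f x - g x).
Proof.
move=> tf tg; rewrite (_ : (fun _ => _) = fun x => f x + -1 * g x).
  by apply: test_funD => //; exact: test_funZ.
by apply/funext => x; rewrite mulN1r.
Qed.

Lemma linear_testB f g : test_fun f -> test_fun g -> T (fun x => f x - g x) = T f - T g.
Proof.
move=> tf tg; have := linT (-1) tg tf; rewrite mulN1r addrC => <-.
by apply: ext_test => x; rewrite mulN1r addrC.
Qed.

Lemma linear_test_sum (I : Type) (s : seq I) (a : I -> R) (F : I -> V -> R) :
  (forall i, test_fun (F i)) ->
  T (fun x => \sum_(i <- s) a i * F i x) = \sum_(i <- s) a i * T (F i).
Proof.
move=> tF; elim: s => [|i s IH].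
  rewrite big_nil; apply: etrans linear_test0.
  by apply: ext_test => x; rewrite big_nil.
rewrite big_cons -IH -linT//; last by apply: test_fun_sum => j; exact: test_funZ.
by apply: ext_test => x; rewrite big_cons.
Qed.

Hypothesis posT : positive_on_tests T.

Lemma positive_test_le f g : test_fun f -> test_fun g -> (forall x, f x <= g x) -> T f <= T g.
Proof.
move=> tf tg fg; rewrite -subr_ge0 -linear_testB//; apply: posT; first exact: test_funB.
by move=> x; rewrite subr_ge0.
Qed.

Lemma plateau (r : R) : exists chi : V -> R, [/\ test_fun chi, forall x, 0 <= chi x &
  forall x, enorm x <= r -> 1 <= chi x].
Proof.
have [m [m0 Hm]] := cutoff_lower_bound R d.
pose q := Num.max r 1; have q0 : 0 < q by rewrite lt_max ltr01 orbT.
have i0 : 0 < (2 * q)^-1 by rewrite invr_gt0 mulr_gt0.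
exists (fun x => m^-1 * cutoff ((2 * q)^-1 *: x + 0)); split.
- by apply: test_funZ; apply: test_fun_affine => //; exact: cutoff_test_fun.
- by move=> x; apply: mulr_ge0; [rewrite invr_ge0 ltW|exact: cutoff_ge0].
- move=> x xr; rewrite addr0 mulrC ler_pdivlMr// mul1r; apply: Hm.
  rewrite enormZ; last exact: ltW.
  rewrite ler_pdivrMl ?mulr_gt0// mulrAC divff// mul1r.
  by apply: le_trans xr _; rewrite le_max lexx.
Qed.

(** Positivity alone gives continuity in the supremum norm: for [f] supported in the ball, -K chi <=
    f <= K chi with a plateau function chi. *)
Lemma positive_test_bound (r : R) : exists C : R, 0 <= C /\ forall f K, test_fun f ->
  (forall x, r <= enorm x -> f x = 0) -> (forall x, `|f x| <= K) -> `|T f| <= C * K.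
Proof.
have [chi [tc c0 c1]] := plateau r; exists (T chi); split; first exact: posT.
move=> f K tf fr fK.
have K0 : 0 <= K by exact: le_trans (normr_ge0 _) (fK 0).
have H x : `|f x| <= K * chi x.
  have [rx|xr] := leP r (enorm x); first by rewrite fr// normr0 mulr_ge0.
  by apply: le_trans (fK x) _; rewrite ler_peMr// c1// ltW.
rewrite ler_norml mulrC -mulNr -!linear_testZ//.
by apply/andP; split; apply: positive_test_le => //; try exact: test_funZ;
  move=> x; have := H x; rewrite ler_norml ?mulNr => /andP[].
Qed.

End Linear.

Lemma test_fun_lipschitz_enorm f : test_fun f ->
  exists C : R, 0 <= C /\ forall x y, `|f x - f y| <= C * enorm (x - y).
Proof.
move=> /test_fun_lipschitz[C [C0 H]]; exists (C * d%:R); split.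
  by apply: mulr_ge0 => //; exact: ler0n.
move=> x y; apply: le_trans (H x y) _; rewrite -mulrA; apply: ler_wpM2l => //.
rewrite mulr_natl -[X in _ *+ X]card_ord -sumr_const; apply: ler_sum => i _.
by have := coord_le_enorm (x - y) i; rewrite !mxE.
Qed.

Lemma lipschitz_enorm_continuous f C : (forall x y, `|f x - f y| <= C * enorm (x - y)) ->
  continuous f.
Proof.
move=> H x; have FF : Filter (nbhs x) := nbhs_filter x.
apply/cvgrPdist_le => e e0.
have c0 : 0 < `|C| * d%:R + 1.
  by apply: ltr_wpDl => //; apply: mulr_ge0 => //; exact: ler0n.
have q0 : 0 < e / (`|C| * d%:R + 1) by exact: divr_gt0.
apply: filterS (nbhsx_ballx x _ q0) => y xy.
apply: le_trans (H x y) _.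
apply: le_trans (ler_wpM2r (enorm_ge0 _) (ler_norm C)) _.
have D : enorm (x - y) <= d%:R * (e / (`|C| * d%:R + 1)).
  apply: enorm_le_coord => [|i]; first exact: ltW.
  by rewrite !mxE; apply: ltW; exact: (xy.2 0 i).
apply: (le_trans (ler_wpM2l (normr_ge0 C) D)).
rewrite [leLHS](_ : _ = e * ((`|C| * d%:R) / (`|C| * d%:R + 1))); last by ring.
rewrite ger_pMr// ler_pdivrMr// mul1r lerDl; exact: ler01.
Qed.

(** The scale (d+1)/e matches the radius d+1 beyond which [cutoff] vanishes with the radius [e]; the
    other two factors normalise the integral to 1. *)
Definition mollifier (e : R) (x : V) : R :=
  (d.+1%:R / e) ^+ d * ((Int (@cutoff R d))^-1 * cutoff ((d.+1%:R / e) *: x + 0)).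

Section Mollifier.
Variable e : R.
Hypothesis e0 : 0 < e.

Let a0 : 0 < d.+1%:R / e. Proof. by rewrite divr_gt0 ?ltr0n. Qed.

Lemma Int_cutoff_gt0 : 0 < Int (@cutoff R d).
Proof.
have [m [m0 Hm]] := cutoff_lower_bound R d.
have t2 : (0 : R) < 2 by [].
have iB : Intg (fun x : V => if enorm (2 *: x + 0) < 1 then 1 else 0).
  exact: (Intg_affine 0 t2 (@Intg_ball R d 1)).
apply: (@lt_le_trans _ _ (Int (fun x : V => m * (if enorm (2 *: x + 0) < 1 then 1 else 0)))).
  rewrite IntZ//; apply: mulr_gt0 => //.
  have := Int_affine 0 t2 (@Intg_ball R d 1); have := vol1_gt0 R d.
  rewrite /vol1 /ball1 => v0 E.
  by rewrite E pmulr_rgt0// exprn_gt0 in v0.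
apply: le_Int; [exact: IntgZ|exact: test_fun_Intg (cutoff_test_fun R d)|].
move=> x; rewrite addr0 enormZ//; case: ltP => H; last by rewrite mulr0; exact: cutoff_ge0.
by rewrite mulr1; apply: Hm; move: H; move: (enorm x) => a; lra.
Qed.

Lemma mollifier_test_fun : test_fun (mollifier e).
Proof. by do 2![apply: test_funZ]; apply: test_fun_affine => //; exact: cutoff_test_fun. Qed.

Lemma mollifier_ge0 x : 0 <= mollifier e x.
Proof.
apply: mulr_ge0; first exact: ltW (exprn_gt0 _ a0).
by apply: mulr_ge0; [rewrite invr_ge0 ltW// Int_cutoff_gt0|exact: cutoff_ge0].
Qed.

Lemma mollifierN x : mollifier e (- x) = mollifier e x.
Proof. by rewrite /mollifier !addr0 scalerN cutoffN. Qed.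

Lemma mollifier_vanish x : e <= enorm x -> mollifier e x = 0.
Proof.
move=> ex; rewrite /mollifier cutoff_vanish ?mulr0// addr0 enormZ; last exact: ltW.
by rewrite mulrAC ler_pdivlMr// ler_pM2l ?ltr0n.
Qed.

Lemma Int_mollifier : Int (mollifier e) = 1.
Proof.
have ic := test_fun_Intg (cutoff_test_fun R d).
have ia := Intg_affine 0 a0 ic.
rewrite /mollifier IntZ; last exact: IntgZ.
rewrite (IntZ _ ia) mulrCA -(Int_affine 0 a0 ic) mulVf//.
by rewrite gt_eqF// Int_cutoff_gt0.
Qed.

End Mollifier.

End TestFunctionals.

(** * Newtonian potentials *)

Section FubiniInt.
Context (R : realType) (d : nat).
Notation tup n := (n.-tuple (measurableTypeR R)).
Notation V := 'rV[R]_d.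

(** The bound [b] on the integral of |F| in its first variable gives joint integrability by Tonelli.
    Slices are assumed integrable everywhere, because their integrals are used as functions defined
    at every point. *)
Lemma Int_Fubini (F : V -> V -> R) (b : V -> R) :
  measurable_fun setT (fun z : tup d * tup d => F (rv z.1) (rv z.2)) ->
  (forall x, Intg (F x)) -> (forall y, Intg (F^~ y)) -> Intg b ->
  (forall y, Int (fun x => `|F x y|) <= b y) ->
  [/\ Intg (fun x => Int (F x)), Intg (fun y => Int (F^~ y)) &
    Int (fun x => Int (F x)) = Int (fun y => Int (F^~ y))].
Proof.
move=> mF Fx Fy ib Fb.
pose f (z : tup d * tup d) : \bar R := (F (rv z.1) (rv z.2))%:E.
have mf : measurable_fun setT f by apply/measurable_EFinP.
have intf : (mu R d \x mu R d)%E.-integrable setT f.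
  apply/integrable21ltyP => //.
  have /integrableP[_] := ib; apply: le_lt_trans.
  apply: ge0_le_integral => //.
  - by move=> y _; apply: integral_ge0.
  - apply: (measurable_fun_fubini_tonelli_G (m1 := mu R d) (abse \o f)) => //=.
    exact: measurableT_comp.
  - by apply: measurableT_comp => //; exact: measurable_int ib.
  - move=> y _ /=; rewrite -(IntE (Intg_norm (Fy (rv y)))) lee_fin.
    by apply: le_trans (Fb _) _; exact: ler_norm.
have E1 t : (\int[mu R d]_y f (t, y) = (Int (F (rv t)))%:E)%E by rewrite IntE.
have E2 t : (\int[mu R d]_x f (x, t) = (Int (F^~ (rv t)))%:E)%E by rewrite IntE.
have iF := integrable_fubini_F intf.
have H1 : Intg (fun x => Int (F x)).
  by apply: (eq_integrable measurableT (fubini_F (mu R d) f)) => // t _; rewrite /fubini_F E1.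
have H2 : Intg (fun y => Int (F^~ y)).
  apply: (le_Intg _ ib) => [|y]; last exact: le_trans (le_norm_Int (Fy y)) (Fb y).
  have mG := measurable_fubini_G intf.
  apply/measurable_EFinP; rewrite (_ : _ \o _ = fubini_G (mu R d) f)//.
  by apply/funext => t; rewrite /fubini_G E2.
split; [exact H1|exact H2|rewrite /Int /Rintegral; congr fine].
transitivity (\int[mu R d]_x \int[mu R d]_y f (x, y))%E.
  by apply: eq_integral => t _; rewrite E1.
by rewrite (Fubini intf); apply: eq_integral => t _; rewrite E2.
Qed.

End FubiniInt.

#[local] Opaque Int Intg.

Section Potential.
Context (R : realType) (d : nat).
Hypothesis d2 : (2 <= d)%N.
Notation tup n := (n.-tuple (measurableTypeR R)).
Notation V := 'rV[R]_d.
Variables (s : V -> R) (M rad : R).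
Hypotheses (ms : Meas s) (sM : forall x, `|s x| <= M)
  (srad : forall x, rad <= enorm x -> s x = 0).

Let w : R := (omega_d R d)^-1.
Let w0 : 0 < w.
Proof. by rewrite invr_gt0 omega_dE mulr_gt0 ?vol1_gt0// ltr0n; case: (d) d2. Qed.
Let M0 : 0 <= M. Proof. exact: le_trans (normr_ge0 _) (sM 0). Qed.

Let Intg_s : Intg s. Proof. exact: Intg_bounded ms sM srad. Qed.

Lemma nsqN (x : V) : nsq (- x) = nsq x.
Proof. by apply: eq_bigr => i _; rewrite mxE sqrrN. Qed.

Lemma fundsolN (x : V) : fundsol (- x) = fundsol x.
Proof. by rewrite !fundsol_profile// nsqN. Qed.

(** The L^1 norm of the fundamental solution on the ball of radius [r]. *)
Definition loc_mass (r : R) : R := w * Int (fun x : V => `|loc_profile r x|).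

Lemma measurable_fundsol d1 (X : measurableType d1) (q : X -> V) : meas_vec q ->
  measurable_fun setT (fun x => fundsol (q x)).
Proof.
move=> mq; under eq_fun do rewrite fundsol_profile//.
apply: measurable_funM => //.
apply: (measurableT_comp (f := profile d)); first exact: measurable_profile.
exact: measurable_nsq.
Qed.

Lemma fundsol_shift_bound (y z : V) (g : V -> R) (C r : R) :
  (forall x, `|g x| <= C) -> (forall x, r <= enorm x -> g x = 0) ->
  forall x, `|fundsol (x - y) * g x| <= C * w * `|loc_profile (r + enorm y) (x - y)|.
Proof.
move=> gC gr x; have C0 : 0 <= C by exact: le_trans (normr_ge0 _) (gC 0).
have [xr|xr] := leP r (enorm x).
  by rewrite gr// mulr0 normr0; apply: mulr_ge0 => //; apply: mulr_ge0 => //; exact: ltW.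
rewrite /loc_profile ifT; last first.
  by have := enorm_triangle x (- y); rewrite enormN; lra.
rewrite fundsol_profile// !normrM -/w (gtr0_norm w0) mulrC.
rewrite -mulrA; apply: ler_wpM2r => //.
by apply: mulr_ge0 => //; exact: ltW.
Qed.

Lemma Intg_fundsol_shift (y : V) (g : V -> R) (C r : R) : Meas g ->
  (forall x, `|g x| <= C) -> (forall x, r <= enorm x -> g x = 0) ->
  Intg (fun x => fundsol (x - y) * g x) /\
  Int (fun x => `|fundsol (x - y) * g x|) <= C * loc_mass (r + enorm y).
Proof.
move=> mg gC gr; have B := fundsol_shift_bound y 0 gC gr.
have il : Intg (fun x => C * w * `|loc_profile (r + enorm y) (x - y)|).
  by apply: IntgZ; apply: (@Intg_shift _ _ (- y) (fun x => `|loc_profile (r + enorm y) x|)); apply: Intg_norm; exact: Intg_loc_profile.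
have ig : Intg (fun x => fundsol (x - y) * g x).
  apply: (le_Intg _ il) => //; apply: MeasM => //.
  by apply: measurable_fundsol; apply: meas_vecB; [exact: meas_vec_rv|exact: meas_vec_cst].
split => //; apply: le_trans (le_Int (Intg_norm ig) il B) _.
rewrite IntZ; last first.
  by apply: (@Intg_shift _ _ (- y) (fun x => `|loc_profile (r + enorm y) x|)); apply: Intg_norm; exact: Intg_loc_profile.
rewrite (@Int_shift _ _ (- y) (fun x => `|loc_profile (r + enorm y) x|)); last by apply: Intg_norm; exact: Intg_loc_profile.
by rewrite /loc_mass mulrA.
Qed.

Definition pot (x : V) : R := 2 * d%:R * Int (fun y => fundsol (x - y) * s y).

Lemma pot_def x : pot x = 2 * d%:R * Int (fun y => fundsol (x - y) * s y).
Proof. by []. Qed.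

Lemma Intg_pot_integrand x : Intg (fun y => fundsol (x - y) * s y).
Proof.
rewrite (_ : (fun _ => _) = fun y => fundsol (y - x) * s y); last first.
  by apply/funext => y; rewrite -fundsolN opprB.
exact: (Intg_fundsol_shift x ms sM srad).1.
Qed.

Section Test.
Variables (f : V -> R) (C r : R).
Hypotheses (mf : Meas f) (fC : forall x, `|f x| <= C)
  (fr : forall x, r <= enorm x -> f x = 0).

Let K := M * C * loc_mass (r + rad).

Let C0 : 0 <= C. Proof. exact: le_trans (normr_ge0 _) (fC 0). Qed.

Let F (x y : V) : R := f x * (fundsol (x - y) * s y).

Let Fy y : Intg (F^~ y).
Proof.
rewrite (_ : F^~ y = fun x => s y * (fundsol (x - y) * f x)); last first.
  by apply/funext => x; rewrite /F; ring.
by apply: IntgZ; exact: (Intg_fundsol_shift y mf fC fr).1.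
Qed.

Lemma loc_mass_le a b : a <= b -> loc_mass a <= loc_mass b.
Proof.
move=> ab; apply: ler_wpM2l; first exact: ltW.
apply: le_Int; try by apply: Intg_norm; exact: Intg_loc_profile.
move=> x; rewrite /loc_profile; case: ltP => xa; last by rewrite normr0.
by rewrite (lt_le_trans xa ab).
Qed.

Let FbK y : Int (fun x => `|F x y|) <= K * (if enorm y < rad then 1 else 0).
Proof.
have [yr|yr] := ltP (enorm y) rad; last first.
  rewrite mulr0 (_ : (fun _ => _) = fun=> 0) ?Int0//.
  by apply/funext => x; rewrite /F srad// !mulr0 normr0.
rewrite mulr1 (_ : (fun _ => _) = fun x => `|s y| * `|fundsol (x - y) * f x|); last first.
  by apply/funext => x; rewrite /F -normrM; congr `|_|; ring.
have [ig ib] := Intg_fundsol_shift y mf fC fr.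
rewrite IntZ; last exact: Intg_norm.
rewrite /K -mulrA; apply: ler_pM => //; first by apply: Int_ge0.
apply: (le_trans ib); apply: ler_wpM2l => //; apply: loc_mass_le; lra.
Qed.

Let mF : measurable_fun setT (fun z : tup d * tup d => F (rv z.1) (rv z.2)).
Proof.
have m1 := meas_vec_comp (@measurable_fst _ _ (tup d) (tup d)) (@meas_vec_rv R d).
have m2 := meas_vec_comp (@measurable_snd _ _ (tup d) (tup d)) (@meas_vec_rv R d).
apply: measurable_funM; first exact: (measurableT_comp mf measurable_fst).
apply: measurable_funM; last exact: (measurableT_comp ms measurable_snd).
by apply: measurable_fundsol; exact: meas_vecB m1 m2.
Qed.

Let Fx x : Intg (F x). Proof. by apply: IntgZ; exact: Intg_pot_integrand. Qed.

Let ib : Intg (fun y : V => K * (if enorm y < rad then 1 else 0)).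
Proof. by apply: IntgZ; exact: Intg_ball. Qed.

Let potE : (fun x => pot x * f x) = fun x => 2 * d%:R * Int (F x).
Proof.
apply/funext => x; rewrite /F IntZ; last exact: Intg_pot_integrand.
by rewrite /pot; ring.
Qed.

Lemma Intg_pot_mul : Intg (fun x => pot x * f x).
Proof. by rewrite potE; apply: IntgZ; have [] := Int_Fubini mF Fx Fy ib FbK. Qed.

Lemma Int_pot_mul : Int (fun x => pot x * f x) =
  2 * d%:R * Int (fun y => s y * Int (fun x => fundsol (x - y) * f x)).
Proof.
have [H1 _ H2] := Int_Fubini mF Fx Fy ib FbK.
rewrite potE (IntZ _ H1) H2; congr (_ * Int _); apply/funext => y.
rewrite /F -IntZ; last exact: (Intg_fundsol_shift y mf fC fr).1.
by congr Int; apply/funext => x; ring.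
Qed.

(** Linear in the supremum bound [C], so the potential acts as a distribution of order 0; the
    competitors built from it inherit the seminorm estimate. *)
Lemma pot_mul_bound : `|Int (fun x => pot x * f x)| <=
  2 * d%:R * (M * loc_mass (r + rad) * Int (fun x : V => if enorm x < rad then 1 else 0)) * C.
Proof.
have [H1 H2 H3] := Int_Fubini mF Fx Fy ib FbK.
rewrite potE (IntZ _ H1) H3 normrM (ger0_norm (_ : 0 <= 2 * d%:R)); last first.
  by rewrite mulr_ge0 ?ler0n.
rewrite -!mulrA; apply: ler_wpM2l; first exact: ler0n.
apply: ler_wpM2l; first exact: ler0n.
apply: le_trans (le_norm_Int H2) _.
rewrite (_ : M * _ = Int (fun y : V => K * (if enorm y < rad then 1 else 0))); last first.
  rewrite IntZ /K /loc_mass; last exact: Intg_ball.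
  by move: (Int _) (Int _) => a b; ring.
apply: (le_Int (Intg_norm H2) ib).
by move=> y; apply: le_trans (FbK y); exact: le_norm_Int.
Qed.

End Test.

Lemma Int_fundsol_Lap (f : V -> R) y : test_fun f ->
  Int (fun x => fundsol (x - y) * Lap f x) = - f y.
Proof.
move=> tf.
have t1 : test_fun (fun z => f (1 *: z + y)) := test_fun_affine y ltr01 tf.
have E z : Lap (fun z => f (1 *: z + y)) z = Lap f (z + y).
  by rewrite Lap_affine ?expr1n ?mul1r ?scale1r//; exact: tf.1.
have H := Int_profile_Lap d2 t1.
rewrite -[LHS](Int_shift y); last first.
  have tL := test_fun_Lap tf; have [C [C0 fC]] := test_fun_bounded tL.
  have [sL [r Lr]] := tL.
  exact: (Intg_fundsol_shift y (Intg_Meas (test_fun_Intg tL)) fC Lr).1.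
rewrite (_ : (fun _ => _) = fun x => w * (profile d (nsq x) * Lap (fun z => f (1 *: z + y)) x)); last first.
  by apply/funext => x; rewrite E addrK fundsol_profile// mulrA.
rewrite IntZ; last exact: (Intg_profile_mul (test_fun_Lap t1)).
rewrite H scaler0 add0r /w omega_dE.
have : d%:R * vol1 R d != 0.
  by rewrite mulf_neq0 ?gt_eqF ?vol1_gt0// ltr0n; case: (d) d2.
by move: (d%:R * vol1 R d) (f y) => a b a0; field.
Qed.

(** After exchanging the integrals, the inner one is the fundamental solution with pole y tested
    against Lap f, that is -f(y). *)
Lemma Int_pot_Lap (f : V -> R) : test_fun f ->
  Int (fun x => pot x * Lap f x) = - (2 * d%:R) * Int (fun y => s y * f y).
Proof.
move=> tf; have tL := test_fun_Lap tf; have [C [C0 fC]] := test_fun_bounded tL.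
have [sL [r Lr]] := tL.
rewrite (Int_pot_mul (Intg_Meas (test_fun_Intg tL)) fC Lr) mulNr -mulrN; congr (_ * _).
have [M1 [_ fM]] := test_fun_bounded tf.
rewrite -IntN; last first.
  apply: (@le_Intg _ _ _ (fun y => M1 * `|s y|)).
  - by apply: MeasM => //; exact: Intg_Meas (test_fun_Intg tf).
  - by apply: IntgZ; exact: Intg_norm.
  - by move=> x; rewrite normrM mulrC; apply: ler_wpM2r.
by congr Int; apply/funext => y; rewrite Int_fundsol_Lap// mulrN.
Qed.

End Potential.

(** * Riemann sums *)

#[local] Opaque Int Intg.

Section RiemannSums.
Context (R : realType) (d : nat).
Notation Z := 'rV[int]_d.
Notation V := 'rV[R]_d.
Notation tup n := (n.-tuple (measurableTypeR R)).
Implicit Types f g : V -> R.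

Lemma Int_eq_ae f g (N : set (tup d)) : Intg f -> Intg g -> measurable N -> mu R d N = 0%E ->
  (forall t, ~ N t -> f (rv t) = g (rv t)) -> Int f = Int g.
Proof. by move=> fi gi mN N0 fg; rewrite -(intRd_Int fi); exact: intRdE gi mN N0 fg. Qed.

Lemma le_Int_ae f g (N : set (tup d)) : Intg f -> Intg g -> measurable N -> mu R d N = 0%E ->
  (forall t, ~ N t -> f (rv t) <= g (rv t)) -> Int f <= Int g.
Proof.
move=> fi gi mN N0 fg; pose m x := Num.min (f x) (g x).
have im : Intg m.
  apply: (@le_Intg _ _ _ (fun x => `|f x| + `|g x|)).
  - by apply: measurable_minr; exact: Intg_Meas.
  - exact: IntgD (Intg_norm fi) (Intg_norm gi).
  - move=> x; rewrite /m minEle; case: ifP => _; rewrite ?lerDl ?lerDr; exact: normr_ge0.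
rewrite (Int_eq_ae fi im mN N0) => [|t Nt]; last by rewrite /m; apply/esym/min_idPl; exact: fg.
by apply: le_Int => // x; rewrite /m ge_min lexx orbT.
Qed.

Definition vol (r : R) : R := Int (fun x : V => if enorm x < r then 1 else 0).

Lemma vol_ge0 r : 0 <= vol r.
Proof. by apply: Int_ge0 => x; case: ifP. Qed.

Lemma vol_le r1 r2 : r1 <= r2 -> vol r1 <= vol r2.
Proof.
move=> r12; apply: le_Int; [exact: Intg_ball|exact: Intg_ball|move=> x].
by case: ltP => [xr|_]; [rewrite (lt_le_trans xr r12)|case: ifP].
Qed.

Variable xi : R.
Hypothesis xi0 : 0 < xi.

Lemma fin_supp_lattice g r : (forall x, r <= enorm x -> g x = 0) ->
  fin_supp (fun k => g (lattice_pt xi k)).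
Proof.
move=> gr; have [B HB] := finite_lattice_ball d xi0 r.
by exists B => k; rewrite HB -leNgt; exact: gr.
Qed.

Lemma lattice_ball_count r :
  xi ^+ d * lsum (fun k : Z => if enorm (lattice_pt xi k) < r then 1 else 0) <= vol (r + d%:R * xi).
Proof.
have fB := @fin_supp_lattice (fun x => if enorm x < r then 1 else 0) r.
have [|I <-] := Int_lsum xi0 (fB _); first by move=> x; rewrite ltNge => ->.
apply: le_Int; [exact: I|exact: Intg_ball|move=> y].
have := near_pt_dist xi0 y; have := enorm_triangle (lattice_pt xi (near_pt xi y)) (y - lattice_pt xi (near_pt xi y)).
rewrite addrC subrK -[enorm (y - _)]enormN opprB => H1 H2.
case: ltP => H; last by case: ifP.
by rewrite ifT//; lra.
Qed.

Lemma riemann_sum_weighted (s g : V -> R) (C : R) : 0 <= C -> Intg s -> test_fun g ->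
  (forall x y, `|g x - g y| <= C * enorm (x - y)) ->
  `|lsum (fun k => g (lattice_pt xi k) * Int (fun y => s y * cell_ind xi k y)) - Int (fun y => s y * g y)|
    <= C * (d%:R * xi) * Int (fun y => `|s y|).
Proof.
move=> C0 is_ tg gC; have [_ [r gr]] := tg.
have [I <-] := Int_near_pt xi0 (fin_supp_lattice gr) is_.
have [K [K0 gK]] := test_fun_bounded tg.
have isg : Intg (fun y => s y * g y).
  apply: (@le_Intg _ _ _ (fun y => K * `|s y|)).
  - by apply: MeasM; [exact: Intg_Meas|exact: Intg_Meas (test_fun_Intg tg)].
  - by apply: IntgZ; exact: Intg_norm.
  - by move=> x; rewrite normrM mulrC; apply: ler_wpM2r.
rewrite -IntB//; apply: le_trans (le_norm_Int (IntgB I isg)) _.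
rewrite -IntZ; last exact: Intg_norm.
apply: le_Int; [by apply: Intg_norm; exact: IntgB|by apply: IntgZ; exact: Intg_norm|].
move=> y; rewrite -mulrBr normrM mulrC; apply: ler_wpM2r => //.
by apply: le_trans (gC _ _) _; apply: ler_wpM2l => //; exact: near_pt_dist.
Qed.

Lemma shift_scale_vanish (rho : V -> R) (e lam : R) (x y : V) : 0 < lam ->
  (forall x, e <= enorm x -> rho x = 0) -> (e + enorm x) / lam <= enorm y ->
  rho (x - lam *: y) = 0.
Proof.
move=> l0 re; rewrite ler_pdivrMr// => H; apply: re.
have := enorm_triangle (lam *: y - x) x; rewrite subrK (enormZ _ (ltW l0)) -[enorm (x - _)]enormN opprB.
by move: H; rewrite mulrC; move: (enorm _) (enorm _) (lam * _) => a b c; lra.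
Qed.

(** The integrand and its step version both vanish unless lam y is within e + lam d xi of [x], which
    is a set of volume lam^-d times that of a ball. The bound is therefore uniform in the centre
    [x]. *)
Lemma riemann_sum_mollifier (rho : V -> R) (C e lam : R) (x : V) : 0 <= C -> 0 < lam ->
  test_fun rho -> (forall x, rho (- x) = rho x) -> (forall x, e <= enorm x -> rho x = 0) ->
  (forall x y, `|rho x - rho y| <= C * enorm (x - y)) ->
  `|xi ^+ d * lsum (fun k => rho (x - lam *: lattice_pt xi k)) - lam ^- d * Int rho|
    <= C * (lam * (d%:R * xi)) * (lam ^- d * vol (e + lam * (d%:R * xi))).
Proof.
move=> C0 l0 tr rN re rC.
pose F (y : V) := rho (x - lam *: y).
have FE y : F y = rho (lam *: y + - x) by rewrite /F -rN opprB.
have Fr y : (e + enorm x) / lam <= enorm y -> F y = 0 by exact: shift_scale_vanish.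
have ir := test_fun_Intg tr.
have iF : Intg F by rewrite (_ : F = fun y => rho (lam *: y + - x)); [exact: Intg_affine|exact/funext].
have EF : Int F = lam ^- d * Int rho.
  rewrite (Int_affine (- x) l0 ir) mulrA mulVf ?mul1r ?expf_neq0 ?gt_eqF//.
  by congr Int; apply/funext.
have [I <-] := Int_lsum xi0 (fin_supp_lattice Fr).
rewrite -EF -IntB//; apply: le_trans (le_norm_Int (IntgB I iF)) _.
pose b (y : V) : R := if enorm y < e + lam * (d%:R * xi) then 1 else 0.
have ib : Intg b by exact: Intg_ball.
have Eb : Int (fun y => b (lam *: y + - x)) = lam ^- d * vol (e + lam * (d%:R * xi)).
  by rewrite /vol (Int_affine (- x) l0 ib) mulrA mulVf ?mul1r ?expf_neq0 ?gt_eqF.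
have iba : Intg (fun y => b (lam *: y + - x)) by exact: Intg_affine.
rewrite -Eb -IntZ//; apply: le_Int; [by apply: Intg_norm; exact: IntgB|exact: IntgZ|].
move=> y; set z := lattice_pt xi _.
have zy : enorm (lam *: z - lam *: y) <= lam * (d%:R * xi).
  by rewrite -scalerBr (enormZ _ (ltW l0)); apply: ler_wpM2l; [exact: ltW|exact: near_pt_dist].
have K0 : 0 <= lam * (d%:R * xi) by exact: le_trans (enorm_ge0 _) zy.
rewrite /b; case: ltP => H.
  rewrite mulr1; apply: le_trans (rC _ _) _; apply: ler_wpM2l => //.
  rewrite (_ : _ - _ = - (lam *: z - lam *: y)) ?enormN//.
  by rewrite !opprB addrC addrA subrK.
rewrite mulr0 !FE !re ?subr0 ?normr0//; first by lra.
have := enorm_triangle (lam *: z - x) (- (lam *: z - lam *: y)).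
rewrite enormN opprB addrC addrA subrK => H2; move: H H2 zy.
by move: (enorm _) (enorm _) (enorm _) => p q r; lra.
Qed.

End RiemannSums.

(** * Mollified sources *)

#[local] Opaque Int Intg mollifier.

Section MollifiedSource.
Context (R : realType) (d : nat).
Notation V := 'rV[R]_d.
Notation tup n := (n.-tuple (measurableTypeR R)).
Variables (s : V -> R) (M rad : R).
Hypotheses (rad0 : 0 < rad) (ms : Meas s) (sM : forall x, `|s x| <= M)
  (srad : forall x, rad <= enorm x -> s x = 0).

Let M0 : 0 <= M. Proof. exact: le_trans (normr_ge0 _) (sM 0). Qed.
Let Intg_s : Intg s. Proof. exact: Intg_bounded ms sM srad. Qed.

(** The convolution of [s] with the mollifier, evaluated at [lam x]: what the Laplacian inequality
    for v returns when tested on a mollifier centred at [lam x]. *)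
Definition smear (lam e : R) (x : V) : R := Int (fun y => s y * mollifier e (y - lam *: x)).

Section Fixed.
Variables (lam e : R).
Hypotheses (l0 : 0 < lam) (e0 : 0 < e).

Lemma mollifier_shift_test (z : V) : test_fun (fun y => mollifier e (y - z)).
Proof.
rewrite (_ : (fun _ => _) = fun y => mollifier e (1 *: y + - z)); last first.
  by apply/funext => y; rewrite scale1r.
by apply: test_fun_affine => //; exact: mollifier_test_fun.
Qed.

Lemma Int_mollifier_shift (z : V) : Int (fun y => mollifier e (y - z)) = 1.
Proof.
rewrite (Int_shift (- z) (f := mollifier e)) ?Int_mollifier//.
exact: test_fun_Intg (mollifier_test_fun d e0).
Qed.

Lemma Intg_mul_test (g : V -> R) : test_fun g -> Intg (fun y => s y * g y).
Proof.
move=> tg; have ig := test_fun_Intg tg.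
apply: (le_Intg (MeasM ms (Intg_Meas ig)) (IntgZ M (Intg_norm ig))) => x.
by rewrite normrM; apply: ler_wpM2r.
Qed.

Lemma smear_bound x : `|smear lam e x| <= M.
Proof.
have t := mollifier_shift_test (lam *: x); have ig := test_fun_Intg t.
apply: le_trans (le_norm_Int (Intg_mul_test t)) _.
rewrite -[leRHS]mulr1 -(Int_mollifier_shift (lam *: x)) -(IntZ _ ig).
apply: (le_Int (Intg_norm (Intg_mul_test t)) (IntgZ _ ig)) => y.
by rewrite normrM (ger0_norm (mollifier_ge0 _ _))//; apply: ler_wpM2r => //; exact: mollifier_ge0.
Qed.

Lemma smear_vanish x : (rad + e) / lam <= enorm x -> smear lam e x = 0.
Proof.
rewrite ler_pdivrMr// => H; rewrite /smear (_ : (fun _ => _) = fun=> 0) ?Int0//.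
apply/funext => y; have [yr|yr] := leP rad (enorm y); first by rewrite srad// mul0r.
rewrite mollifier_vanish ?mulr0//.
have := enorm_triangle (lam *: x - y) y; rewrite subrK (enormZ _ (ltW l0)) -opprB enormN.
by move: H yr; rewrite mulrC; move: (enorm _) (enorm _) (lam * _) => a b c; lra.
Qed.

Lemma smear_lipschitz : exists C : R, 0 <= C /\
  forall x y, `|smear lam e x - smear lam e y| <= C * enorm (x - y).
Proof.
have [C [C0 HC]] := test_fun_lipschitz_enorm (mollifier_test_fun d e0).
exists (C * lam * Int (fun y => `|s y|)); split.
  by apply: mulr_ge0; [apply: mulr_ge0 => //; exact: ltW|exact: Int_ge0].
move=> x y; have tx := mollifier_shift_test (lam *: x); have ty := mollifier_shift_test (lam *: y).
have ix := Intg_mul_test tx; have iy := Intg_mul_test ty.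
rewrite /smear -(IntB ix iy); apply: le_trans (le_norm_Int (IntgB ix iy)) _.
rewrite -mulrA [Int _ * _]mulrC mulrA -IntZ; last exact: Intg_norm.
apply: le_Int; [exact: Intg_norm (IntgB ix iy)|by apply: IntgZ; exact: Intg_norm|].
move=> z; rewrite -mulrBr normrM mulrC; apply: ler_wpM2r => //.
apply: le_trans (HC _ _) _; rewrite -mulrA; apply: ler_wpM2l => //.
rewrite (_ : _ - _ = - (lam *: (x - y))) ?enormN ?(enormZ _ (ltW l0))//.
by rewrite scalerBr !opprB addrC addrA subrK.
Qed.

Lemma Intg_smear : Intg (smear lam e).
Proof.
have [C [_ HC]] := smear_lipschitz.
apply: (Intg_bounded _ smear_bound smear_vanish).
by apply: Meas_continuous; exact: lipschitz_enorm_continuous HC.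
Qed.

End Fixed.

Variables (sigma : V -> R) (N : set (tup d)).
Hypotheses (mN : measurable N) (N0 : mu R d N = 0%E)
  (sN : forall t, ~ N t -> s (rv t) = sigma (rv t))
  (cN : forall t, ~ N t -> {for rv t, continuous sigma}).

(** The mollification radius and the displacement (1 - lam) x together must fit in a neighbourhood
    where [sigma] varies by at most [k]. *)
Lemma smear_close t (k : R) : ~ N t -> 0 < k -> exists del : R, 0 < del /\
  forall lam e, 0 < lam -> 0 < e -> e + `|1 - lam| * enorm (rv t) < del ->
    `|smear lam e (rv t) - s (rv t)| <= k.
Proof.
move=> Nt k0; have := cN Nt => /cvgrPdist_le/(_ _ k0)/nbhs_ballP[del /= del0 Hdel].
exists del; split => // lam e l0 e0; set x := rv t in Hdel * => He.
have tm := mollifier_shift_test e0 (lam *: x); have im := test_fun_Intg tm.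
have is_ := Intg_mul_test tm.
have E : smear lam e x - s x = Int (fun y => (s y - s x) * mollifier e (y - lam *: x)).
  rewrite -[s x in LHS]mulr1 -(Int_mollifier_shift e0 (lam *: x)) -(IntZ _ im) -(IntB is_ (IntgZ _ im)).
  by congr Int; apply/funext => y; rewrite mulrBl.
have iI : Intg (fun y => (s y - s x) * mollifier e (y - lam *: x)).
  rewrite (_ : (fun _ => _) = fun y => s y * mollifier e (y - lam *: x) - s x * mollifier e (y - lam *: x)).
    exact: IntgB is_ (IntgZ _ im).
  by apply/funext => y; rewrite mulrBl.
rewrite E; apply: le_trans (le_norm_Int iI) _.
rewrite -[leRHS]mulr1 -(Int_mollifier_shift e0 (lam *: x)) -(IntZ _ im).
(* The integrand involves [s], which follows [sigma] only off [N], so the comparison holds almost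
   everywhere. *)
apply: (le_Int_ae (Intg_norm iI) (IntgZ k im) mN N0) => u Nu; set y := rv u.
rewrite normrM (ger0_norm (mollifier_ge0 _ _))//.
have [ye|ye] := leP e (enorm (y - lam *: x)).
  by rewrite mollifier_vanish// !mulr0.
apply: ler_wpM2r; first exact: mollifier_ge0.
rewrite /x /y !sN// distrC; apply: Hdel; split=> // i j.
rewrite /ball/= (ord1 i) -/x -/y.
have := coord_le_enorm (x - y) j; rewrite !mxE => H; apply: le_lt_trans H _.
have := enorm_triangle ((1 - lam) *: x) (- (y - lam *: x)).
rewrite enormN (_ : (1 - lam) *: x + _ = x - y); last first.
  by rewrite opprB scalerBl scale1r addrA subrK.
have -> : enorm ((1 - lam) *: x) = `|1 - lam| * enorm x.
  have [H|H] := leP 0 (1 - lam); first by rewrite enormZ// ger0_norm.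
  by rewrite -enormN -scaleNr enormZ ?ltr0_norm// oppr_ge0 ltW.
by move: He ye; move: (enorm _) (enorm _) (_ * _) => a b c; lra.
Qed.

(** The gap (1 - lam) rad = rad / (2 (m+1)) is twice the radius [eps_], so lam rad + eps = rad - eps
    stays below rad; moreover lam >= 1/2. *)
Definition lam_ (m : nat) : R := 1 - (2 * m.+1%:R)^-1.
Definition eps_ (m : nat) : R := rad / (4 * m.+1%:R).

Lemma lam_ge m : 2^-1 <= lam_ m.
Proof.
rewrite /lam_; have : (2 * m.+1%:R)^-1 <= 2^-1 :> R; last first.
  by move: ((2 * m.+1%:R)^-1 : R) => a; lra.
by rewrite lef_pV2 ?posrE ?mulr_gt0 ?ltr0n// ler_peMr// ler1n.
Qed.

Lemma lam_le m : lam_ m <= 1.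
Proof. by rewrite /lam_ lerBlDr lerDl invr_ge0 mulr_ge0 ?ler0n. Qed.

Lemma eps_gt0 m : 0 < eps_ m.
Proof. by rewrite divr_gt0// mulr_gt0 ?ltr0n. Qed.

Lemma eps_le m : eps_ m <= rad.
Proof. by rewrite /eps_ ler_pdivrMr ?mulr_gt0 ?ltr0n// ler_peMr ?(ltW rad0)// -natrM ler1n. Qed.

Lemma lam_eps_lt m : lam_ m * rad + eps_ m < rad.
Proof.
have m0 : (0 : R) < m.+1%:R by rewrite ltr0n.
rewrite (_ : lam_ m * rad + eps_ m = rad - eps_ m); last first.
  by rewrite /lam_ /eps_; move: (m.+1%:R : R) m0 => a a0; field; rewrite gt_eqF.
by rewrite ltrBlDr ltrDl; exact: eps_gt0.
Qed.

Lemma lam_cvg : lam_ @ \oo --> (1 : R).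
Proof.
rewrite -[X in _ --> X]subr0; apply: cvgB; first exact: cvg_cst.
have -> : (fun m => (2 * m.+1%:R)^-1) = (fun m => 2^-1 * m.+1%:R^-1 :> R).
  by apply/funext => m; rewrite invfM.
by rewrite -[X in _ --> X](mulr0 (2^-1)); apply: cvgM; [exact: cvg_cst|exact: cvg_harmonic].
Qed.

Lemma eps_cvg : eps_ @ \oo --> (0 : R).
Proof.
have -> : eps_ = (fun m => (rad / 4) * m.+1%:R^-1).
  by apply/funext => m; rewrite /eps_ invfM mulrA.
by rewrite -[X in _ --> X](mulr0 (rad / 4)); apply: cvgM; [exact: cvg_cst|exact: cvg_harmonic].
Qed.

Lemma smear_L1_cvg :
  (fun m => Int (fun x => `|s x - smear (lam_ m) (eps_ m) x|)) @ \oo --> 0.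
Proof.
have l0 m : 0 < lam_ m by apply: lt_le_trans (lam_ge m); rewrite invr_gt0.
pose f_ m x := `|s x - smear (lam_ m) (eps_ m) x|.
(* Radius 4 rad: the smeared source vanishes beyond (rad + eps) / lam, with eps <= rad and lam >=
   1/2. *)
pose g (x : V) : R := 2 * M * (if enorm x < 4 * rad then 1 else 0).
have mf m : Meas (f_ m).
  by apply: Meas_norm; apply: MeasB => //; apply: Intg_Meas; exact: Intg_smear (l0 m) (eps_gt0 m).
have ig : Intg g by apply: IntgZ; exact: Intg_ball.
have cf t : ~ N t -> f_ ^~ (rv t) @ \oo --> (0 : R).
  move=> Nt; apply/cvgrPdist_le => k k0; have [del [del0 H]] := smear_close Nt k0.
  have : (fun m => eps_ m + `|1 - lam_ m| * enorm (rv t)) @ \oo --> (0 : R).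
    rewrite -[X in _ --> X](_ : 0 + `|1 - 1| * enorm (rv t) = 0); last by rewrite subrr normr0 mul0r addr0.
    apply: cvgD; first exact: eps_cvg.
    apply: cvgM; last exact: cvg_cst.
    by apply: cvg_norm; apply: cvgB; [exact: cvg_cst|exact: lam_cvg].
  move=> /(cvgr_lt 0)/(_ _ del0); apply: filterS => m Hm.
  by rewrite sub0r normrN /f_ normr_id distrC; apply: H => //; exact: eps_gt0.
have bf t m : ~ N t -> `|f_ m (rv t)| <= g (rv t).
  move=> _; rewrite /f_ /g normr_id; case: ltP => H.
    rewrite mulr1; apply: le_trans (ler_normB _ _) _.
    by have := sM (rv t); have := smear_bound (lam_ m) (eps_gt0 m) (rv t); move: (`|_|) (`|_|) => a b; lra.
  rewrite mulr0 srad; last by move: rad0 H; lra.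
  rewrite smear_vanish ?subr0 ?normr0 ?eps_gt0//; apply: le_trans _ H.
  rewrite ler_pdivrMr//; have := lam_ge m; have := eps_le m; move: rad0 => ? ? ?.
  apply: (@le_trans _ _ (4 * rad * 2^-1)); first by lra.
  by apply: ler_wpM2l => //; lra.
have [_ ] := Int_dominated_cvg mf (@Meas_cst R d 0) ig mN N0 cf bf.
by rewrite Int0.
Qed.

End MollifiedSource.

(** * The barrier *)

#[local] Opaque Int Intg mollifier.

Section UpperBound.
Context (R : realType) (d : nat).
Hypothesis d0 : (0 < d)%N.
Notation Z := 'rV[int]_d.
Notation V := 'rV[R]_d.
Variables (s : V -> R) (M rad : R).
Hypotheses (rad0 : 0 < rad) (ms : Meas s) (sM : forall x, `|s x| <= M)
  (srad : forall x, rad <= enorm x -> s x = 0).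
Variable v : (V -> R) -> R.
Hypotheses (linv : linear_on_tests v) (posv : positive_on_tests v)
  (vLap : forall f, test_fun_in_ball rad f -> (forall x, 0 <= f x) ->
    v (Lap f) <= - (2 * d%:R) * Int (fun y => s y * f y)).
Variables (lam e X : R).
Hypotheses (l0 : 0 < lam) (l1 : lam <= 1) (e0 : 0 < e) (ler : lam * rad + e < rad).

(** A discrete supersolution obtained by testing the gap functional [v] against
    mollifiers. The dilation by [lam < 1] keeps the mollifiers inside the ball,
    where [v (Lap rho) <= - 2 d Int (s rho)], for every lattice point of the ball. *)
Definition barrier (xi : R) (k : Z) : R :=
  lam ^- 2 * v (fun x => mollifier e (x - lam *: lattice_pt xi k)).

Lemma barrier_ge0 xi k : 0 <= barrier xi k.
Proof.
apply: mulr_ge0; first by rewrite invr_ge0 sqr_ge0.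
by apply: posv => [|x]; [exact: mollifier_shift_test|exact: mollifier_ge0].
Qed.

Let P (z x : V) := mollifier e (x - z).
Let tP z : test_fun (P z). Proof. exact: mollifier_shift_test. Qed.

Let LapP z x : Lap (P z) x = Lap (mollifier e) (x - z).
Proof.
have -> : P z = fun y => mollifier e (1 *: y + - z).
  by apply/funext => y; rewrite scale1r.
rewrite Lap_affine ?expr1n ?mul1r ?scale1r//.
exact: (mollifier_test_fun d e0).1.
Qed.

(** Consistency error of the second differences in the centre [z] with step [t], regarded as a
    function of [x] so that [v] can be applied to it. The coefficients 1 match the form of the lemma
    on linear combinations. *)
Let D (t : R) (z : V) (x : V) : R :=
  \sum_(i < d) 1 * ((P (z + t *: evec R i) x + P (z - t *: evec R i) x) - 2 * P z x)
  - t ^+ 2 * Lap (P z) x.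

Let F (t : R) (z : V) (i : 'I_d) (x : V) : R :=
  (P (z + t *: evec R i) x + P (z - t *: evec R i) x) - 2 * P z x.

Let tF t z i : test_fun (F t z i).
Proof. by apply: test_funB; [apply: test_funD; exact: tP|apply: test_funZ; exact: tP]. Qed.

Let tS t z : test_fun (fun x => \sum_(i < d) 1 * F t z i x).
Proof. by apply: test_fun_sum => i; apply: test_funZ; exact: tF. Qed.

Let tD t z : test_fun (D t z).
Proof. by apply: test_funB; [exact: tS|apply: test_funZ; apply: test_fun_Lap; exact: tP]. Qed.

Let vD t z : v (D t z) = \sum_(i < d) (v (P (z + t *: evec R i)) + v (P (z - t *: evec R i)))
  - 2 * d%:R * v (P z) - t ^+ 2 * v (Lap (P z)).
Proof.
rewrite (linear_testB linv (tS t z) (test_funZ (t ^+ 2) (test_fun_Lap (tP z)))).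
rewrite (linear_testZ linv _ (test_fun_Lap (tP z))); congr (_ - _).
rewrite (linear_test_sum linv _ _ (tF t z)).
have -> : 2 * d%:R * v (P z) = \sum_(i < d) (2 * v (P z)).
  by rewrite sumr_const card_ord -[RHS]mulr_natl; ring.
rewrite -sumrB; apply: eq_bigr => i _; rewrite mul1r.
rewrite (linear_testB linv (test_funD (tP _) (tP _)) (test_funZ 2 (tP z))).
congr (_ - _); last exact: (linear_testZ linv _ (tP z)).
exact: (linear_testD linv (tP _) (tP _)).
Qed.

Let D_bound : exists C : R, 0 <= C /\ forall t z x, 0 <= t -> `|D t z x| <= d%:R * (C * t ^+ 3).
Proof.
have [C [C0 HC]] := test_fun_second_difference (mollifier_test_fun d e0).
exists C; split => // t z x t0.
have -> : D t z x = \sum_(i < d) (mollifier e (x - z + t *: evec R i) + mollifier e (x - z - t *: evec R i)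
    - 2 * mollifier e (x - z) - t ^+ 2 * partial i (partial i (mollifier e)) (x - z)).
  rewrite /D LapP LapE mulr_sumr -sumrB; apply: eq_bigr => i _; rewrite /P mul1r.
  have -> : x - (z + t *: evec R i) = x - z - t *: evec R i by rewrite opprD addrA.
  have -> : x - (z - t *: evec R i) = x - z + t *: evec R i by rewrite opprD opprK addrA.
  by rewrite [X in X - _ - _ = _]addrC.
apply: le_trans (ler_norm_sum _ _ _) _.
have -> : d%:R * (C * t ^+ 3) = \sum_(i < d) (C * t ^+ 3).
  by rewrite sumr_const card_ord mulr_natl.
apply: ler_sum => i _.
exact: HC.
Qed.

(** The extra 1 places [x - z] strictly beyond the support of the mollifier, as the vanishing of its
    second derivatives requires. *)
Let D_vanish t z x : 0 <= t -> e + enorm z + t + 1 <= enorm x -> D t z x = 0.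
Proof.
move=> t0 H; have E y : enorm (y - z) <= t -> P y x = 0.
  move=> yz; apply: mollifier_vanish => //.
  have := enorm_triangle (x - y) y; rewrite subrK.
  have := enorm_triangle (y - z) z; rewrite subrK.
  by move: H yz; move: (enorm _) (enorm _) (enorm _) (enorm _) (enorm _) => a b c q r; lra.
have te i : enorm (t *: evec R i) = t by rewrite enormZ// enorm_evec mulr1.
rewrite /D big1 => [|i _].
  rewrite LapP (_ : Lap _ _ = 0) ?mulr0 ?subr0//.
  have := enorm_triangle (x - z) z; rewrite subrK => H2.
  rewrite /Lap big1// => i _.
  apply: (@iterpartial_vanish _ _ (mollifier e) [:: i; i] e) => [y|]; first exact: mollifier_vanish.
  by move: H H2 t0 ; move: (enorm _) (enorm _) (enorm _) => a b c; lra.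
rewrite !E ?mulr0 ?addr0 ?subr0 ?mulr0//.
- by rewrite subrr enorm0.
- by rewrite addrAC subrr add0r enormN te.
- by rewrite addrAC subrr add0r te.
Qed.

(** With t = lam xi, linearity gives 2 d t^2 dLap(barrier) = v(D) + t^2 v(Lap P). The supremum bound
    on [v] makes the first term O(t^3); the second is controlled because the mollifier is supported
    inside the ball. The prefactor lam^-2 of the barrier converts the step xi into t. *)
Lemma dLap_barrier_le : exists E : R, 0 <= E /\ forall xi k, 0 < xi -> xi <= X ->
  enorm (lattice_pt xi k) < rad ->
  dLap xi (barrier xi) k <= - smear s lam e (lattice_pt xi k) + E * xi.
Proof.
have [C [C0 HC]] := D_bound.
(* One radius containing the supports of all the errors, as |z| <= rad and t <= X. *)
have [K [K0 HK]] := positive_test_bound linv posv (e + rad + X + 1).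
exists (K * C); split; first exact: mulr_ge0.
move=> xi k xi0 xiX kr; set z := lam *: lattice_pt xi k; pose t := lam * xi.
have t0 : 0 < t by exact: mulr_gt0.
have txi : t <= xi by rewrite /t ler_piMl// ltW.
have zr : enorm z <= lam * rad.
  by rewrite /z enormZ ?(ltW l0)//; apply: ler_wpM2l; exact: ltW.
have vDle : v (D t z) <= K * (d%:R * (C * t ^+ 3)).
  apply: le_trans (ler_norm _) _; apply: HK; first exact: tD.
    move=> x H; apply: D_vanish; first exact: ltW.
    have : lam * rad <= rad by rewrite ler_piMl// ltW.
    by move: H zr txi xiX; move: (enorm _) (enorm _) (lam * rad) => a b c; lra.
  by move=> x; apply: HC; exact: ltW.
have vLle : v (Lap (P z)) <= - (2 * d%:R) * smear s lam e (lattice_pt xi k).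
  apply: vLap; last by move=> x; exact: mollifier_ge0.
  split; first exact: (tP z).1.
  exists (lam * rad + e); split => // x H; apply: mollifier_vanish => //.
  have := enorm_triangle (x - z) z; rewrite subrK.
  by move: H zr; move: (enorm _) (enorm _) (enorm _) (lam * rad) => a b c q; lra.
have dd : (0 : R) < d%:R by rewrite ltr0n.
have alg (p q : R) : (2 * d%:R * xi ^+ 2)^-1 * (lam ^- 2 * p - 2 * d%:R * (lam ^- 2 * q)) =
    (2 * d%:R * t ^+ 2)^-1 * (p - 2 * d%:R * q).
  by rewrite /t; field; rewrite !gt_eqF.
have -> : dLap xi (barrier xi) k = (2 * d%:R * t ^+ 2)^-1 * (v (D t z) + t ^+ 2 * v (Lap (P z))).
  have b y : barrier xi y = lam ^- 2 * v (P (lam *: lattice_pt xi y)) by [].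
  rewrite dLapE vD subrK.
  rewrite (eq_bigr (fun i => lam ^- 2 * (v (P (z + t *: evec R i)) + v (P (z - t *: evec R i))))); last first.
    move=> i _; rewrite !b -mulrDr !lattice_ptD lattice_ptN lattice_pt_ievec.
    rewrite (_ : lam *: (lattice_pt xi k + _) = z + t *: evec R i); last by rewrite /z /t scalerDr scalerA.
    rewrite (_ : lam *: (lattice_pt xi k - _) = z - t *: evec R i); last by rewrite /z /t -scalerA; move: (lattice_pt xi k) => y; rewrite scalerBr.
    exact: erefl.
  rewrite -mulr_sumr b; exact: alg.
have [td Hd] : t != 0 /\ d%:R != 0 :> R by rewrite !gt_eqF.
apply: (@le_trans _ _ ((2 * d%:R * t ^+ 2)^-1 * (K * (d%:R * (C * t ^+ 3)) +
    t ^+ 2 * (- (2 * d%:R) * smear s lam e (lattice_pt xi k))))).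
  apply: ler_wpM2l.
    by rewrite invr_ge0; apply: mulr_ge0; [apply: mulr_ge0; exact: ler0n|exact: sqr_ge0].
  by apply: lerD => //; apply: ler_wpM2l => //; exact: sqr_ge0.
have -> : (2 * d%:R * t ^+ 2)^-1 * (K * (d%:R * (C * t ^+ 3)) +
    t ^+ 2 * (- (2 * d%:R) * smear s lam e (lattice_pt xi k))) =
    K * C * t / 2 - smear s lam e (lattice_pt xi k).
  by move: (smear _ _ _ _) => a; field; rewrite Hd td.
rewrite addrC lerD2l.
have KC : 0 <= K * C by exact: mulr_ge0.
have : K * C * t <= K * C * xi by apply: ler_wpM2l.
have : 0 <= K * C * t by apply: mulr_ge0 => //; exact: ltW.
by move: (K * C * t) (K * C * xi) => a b; lra.
Qed.

End UpperBound.

#[local] Opaque Int Intg mollifier.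

Section BarrierSum.
Context (R : realType) (d : nat).
Notation Z := 'rV[int]_d.
Notation V := 'rV[R]_d.
Variable v : (V -> R) -> R.
Hypotheses (linv : linear_on_tests v).
Variables (lam e X : R).
Hypotheses (l2 : 2^-1 <= lam) (l1 : lam <= 1) (e0 : 0 < e).
Variables (g : V -> R) (K Cg rg r1 Cv : R).
Hypotheses (tg : test_fun g) (gK : forall x, `|g x| <= K) (gr : forall x, rg <= enorm x -> g x = 0)
  (Cg0 : 0 <= Cg) (gC : forall x y, `|g x - g y| <= Cg * enorm (x - y)) (hr : rg + e <= r1)
  (r10 : 0 <= r1)
  (vC : forall f K, test_fun f -> (forall x, r1 <= enorm x -> f x = 0) ->
    (forall x, `|f x| <= K) -> `|v f| <= Cv * K).

Let l0 : 0 < lam. Proof. by apply: lt_le_trans l2; rewrite invr_gt0. Qed.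

Let q : R := Cg * (2 * (e + (1 - lam) * r1)).
Let q0 : 0 <= q.
Proof.
apply: mulr_ge0 => //; apply: mulr_ge0 => //; apply: addr_ge0; first exact: ltW.
by apply: mulr_ge0 => //; rewrite subr_ge0.
Qed.

Let K0 : 0 <= K. Proof. exact: le_trans (normr_ge0 _) (gK 0). Qed.

(** lam (y - x) = -(x - lam y) + (1 - lam) x, and dividing by lam >= 1/2 costs the factor 2. *)
Let g_near (x y : V) : enorm x <= r1 -> enorm (x - lam *: y) <= e -> `|g y - g x| <= q.
Proof.
move=> xr xy; apply: le_trans (gC _ _) _; apply: ler_wpM2l => //.
rewrite -[enorm _]mul1r -[X in X * _](mulVf (_ : lam != 0)) ?gt_eqF// -mulrA.
rewrite -(enormZ _ (ltW l0)) mulrC [2 * _]mulrC; apply: ler_pM.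
- exact: enorm_ge0.
- by rewrite invr_ge0 ltW.
- have -> : lam *: (y - x) = - (x - lam *: y) + (1 - lam) *: x.
    by rewrite opprB scalerBr scalerBl scale1r addrA subrK.
  apply: le_trans (enorm_triangle _ _) _; rewrite enormN enormZ ?subr_ge0//.
  by apply: lerD => //; apply: ler_wpM2l; rewrite ?subr_ge0.
- by rewrite -[leRHS]invrK lef_pV2// posrE invr_gt0.
Qed.

(** Uniform bound on [int rho_e (x - lam y) g(y) dy - g(x)]: the first term is
    the oscillation of [g] over the support of the mollifier, the second comes
    from the total mass [lam^-d] of [y |-> rho_e (x - lam y)]. *)
Definition kappa : R := Cg * (2 * (e + (1 - lam) * r1)) * lam ^- d + K * (lam ^- d - 1).

(** Linearity turns the sum into [v] applied to a Riemann sum [G], a discretised mollification of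
    [g]; the supremum bound on [v] reduces the claim to a uniform estimate of G - g. *)
Lemma lsum_barrier : exists E : R, 0 <= E /\ forall xi, 0 < xi -> xi <= X ->
  `|xi ^+ d * lsum (fun k => barrier v lam e xi k * g (lattice_pt xi k)) - lam ^- 2 * v g|
    <= lam ^- 2 * (Cv * (kappa + E * xi)).
Proof.
have tm := mollifier_test_fun d e0.
have [C [C0 HC]] := test_fun_lipschitz_enorm tm.
pose E0 := C * (d%:R * (lam ^- d * vol d (e + d%:R * X))).
have ld0 : 0 <= lam ^- d by rewrite invr_ge0 exprn_ge0// ltW.
have E00 : 0 <= E0.
  apply: mulr_ge0 => //; apply: mulr_ge0; first exact: ler0n.
  by apply: mulr_ge0 => //; exact: vol_ge0.
exists ((q + K) * E0); split; first by apply: mulr_ge0 => //; exact: addr_ge0.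
move=> xi xi0 xiX.
pose P (k : Z) (x : V) := mollifier e (x - lam *: lattice_pt xi k).
have tP k : test_fun (P k) by exact: mollifier_shift_test.
have [A HA] := fin_supp_lattice xi0 gr.
pose G x := \sum_(k <- A) (xi ^+ d * g (lattice_pt xi k)) * P k x.
have tG : test_fun G by apply: test_fun_sum => k; exact: test_funZ (tP k).
have EG x : G x = xi ^+ d * lsum (fun k => P k x * g (lattice_pt xi k)).
  rewrite (@lsumE _ _ _ A) => [|k kA]; last by rewrite HA// mulr0.
  by rewrite mulr_sumr; apply: eq_bigr => k _; rewrite -mulrA [g _ * _]mulrC.
have -> : xi ^+ d * lsum (fun k => barrier v lam e xi k * g (lattice_pt xi k)) = lam ^- 2 * v G.
  rewrite (@lsumE _ _ _ A) => [|k kA]; last by rewrite HA// mulr0.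
  rewrite (linear_test_sum linv _ _ tP) !mulr_sumr; apply: eq_bigr => k _.
  rewrite /barrier -/(P k); move: (v (P k)) (g _) => a b; ring.
rewrite -mulrBr normrM ger0_norm ?invr_ge0 ?sqr_ge0//; apply: ler_wpM2l.
  by rewrite invr_ge0 sqr_ge0.
have vG x : r1 <= enorm x -> G x - g x = 0.
  move=> xr; rewrite gr; last by move: hr xr e0 => ? ? ?; lra.
  rewrite subr0 /G big1// => k _.
  have [kr|kr] := leP rg (enorm (lattice_pt xi k)); first by rewrite gr// mulr0 mul0r.
  rewrite /P mollifier_vanish ?mulr0//.
  have := enorm_triangle (x - lam *: lattice_pt xi k) (lam *: lattice_pt xi k).
  rewrite subrK (enormZ _ (ltW l0)).
  have : lam * enorm (lattice_pt xi k) <= enorm (lattice_pt xi k).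
    by apply: ler_piMl => //; exact: enorm_ge0.
  by move: hr xr kr; move: (enorm _) (enorm _) (enorm _) (_ * _) => a b c r; lra.
rewrite -(linear_testB linv tG tg); apply: vC; [exact: test_funB|exact: vG|].
have kp0 : 0 <= kappa + (q + K) * E0 * xi.
  apply: addr_ge0; last by apply: mulr_ge0; [apply: mulr_ge0 => //; exact: addr_ge0|exact: ltW].
  apply: addr_ge0; first exact: mulr_ge0.
  apply: mulr_ge0 => //; rewrite subr_ge0 -invr1 lef_pV2 ?posrE ?exprn_gt0//.
  by apply: exprn_ile1 => //; exact: ltW.
move=> x; have [xr|xr] := leP r1 (enorm x).
  by rewrite vG// normr0.
pose S := xi ^+ d * lsum (P ^~ x).
have fP : fin_supp (P ^~ x).
  apply: (@fin_supp_lattice _ _ _ xi0 (fun y => mollifier e (x - lam *: y)) ((e + enorm x) / lam)) => y.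
  exact: shift_scale_vanish l0 (fun y => @mollifier_vanish _ _ _ e0 y).
have S1 : `|S - lam ^- d| <= E0 * xi.
  have := riemann_sum_mollifier xi0 x C0 l0 tm (mollifierN e) (fun y => @mollifier_vanish _ _ _ e0 y) HC.
  rewrite (Int_mollifier d e0) mulr1 => H; apply: le_trans H _.
  rewrite (_ : E0 * xi = C * (d%:R * xi) * (lam ^- d * vol d (e + d%:R * X))); last first.
    by rewrite /E0; move: (vol _ _) (lam ^- d) => a b; ring.
  have dx : 0 <= d%:R * xi by apply: mulr_ge0; [exact: ler0n|exact: ltW].
  have ldx : lam * (d%:R * xi) <= d%:R * xi by rewrite ler_piMl.
  have ldx0 : 0 <= lam * (d%:R * xi) by apply: mulr_ge0 => //; exact: ltW.
  apply: ler_pM.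
  - exact: mulr_ge0.
  - by apply: mulr_ge0 => //; exact: vol_ge0.
  - exact: ler_wpM2l.
  - apply: ler_wpM2l => //; apply: vol_le; rewrite lerD2l; apply: le_trans ldx _.
    by apply: ler_wpM2l => //; exact: ler0n.
have S0 : 0 <= S.
  apply: mulr_ge0; first by rewrite exprn_ge0// ltW.
  by apply: lsum_ge0 => k; exact: mollifier_ge0.
(* Oscillation of [g] near [x], plus the defect of the total mass [S] of the discretised mollifier,
   which is close to lam^-d rather than to 1. *)
have -> : G x - g x = xi ^+ d * lsum (fun k => P k x * (g (lattice_pt xi k) - g x)) + g x * (S - 1).
  rewrite EG (_ : (fun k => P k x * (g (lattice_pt xi k) - g x)) =
      fun k => P k x * g (lattice_pt xi k) - g x * P k x); last first.
    by apply/funext => k; move: (P k x) (g _) (g x) => a b c; ring.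
  rewrite lsumB; [|exact: fin_suppMl|exact: fin_suppMr].
  rewrite lsumZ /S; move: (lsum _) (lsum _) (g x) => a b c; ring.
apply: le_trans (ler_normD _ _) _.
have xd0 : 0 <= xi ^+ d by rewrite exprn_ge0// ltW.
have H1 : `|xi ^+ d * lsum (fun k => P k x * (g (lattice_pt xi k) - g x))| <= q * S.
  rewrite normrM ger0_norm// /S mulrCA -lsumZ; apply: ler_wpM2l => //.
  have fPg : fin_supp (fun k => P k x * (g (lattice_pt xi k) - g x)) by exact: fin_suppMl.
  apply: le_trans (lsum_norm fPg) _; apply: lsum_le; [exact: fin_supp_norm|exact: fin_suppMr|].
  move=> k; rewrite normrM ger0_norm; last exact: mollifier_ge0.
  have [ke|ke] := leP e (enorm (x - lam *: lattice_pt xi k)).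
    by rewrite /P mollifier_vanish// mul0r mulr0.
  rewrite mulrC; apply: ler_wpM2r; first exact: mollifier_ge0.
  by apply: g_near; exact: ltW.
have H2 : `|g x * (S - 1)| <= K * (lam ^- d - 1 + E0 * xi).
  rewrite normrM; apply: ler_pM => //.
  have L1 : 1 <= lam ^- d.
    by rewrite -[leLHS]invr1 lef_pV2 ?posrE ?exprn_gt0//; apply: exprn_ile1 => //; exact: ltW.
  have aux (a b c : R) : `|c - a| <= b -> 1 <= a -> `|c - 1| <= a - 1 + b.
    by rewrite !ler_norml; lra.
  exact: aux.
apply: le_trans (lerD H1 H2) _.
have H3 : q * S <= q * (lam ^- d + E0 * xi).
  by apply: ler_wpM2l => //; rewrite -lerBlDl; apply: le_trans S1; exact: ler_norm.
apply: le_trans (lerD H3 (lexx _)) _; rewrite /kappa le_eqVlt; apply/orP; left; apply/eqP.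
have aux (a b : R) : q * (a + b * xi) + K * (a - 1 + b * xi) = q * a + K * (a - 1) + (q + K) * b * xi by ring.
exact: aux.
Qed.

End BarrierSum.

#[local] Opaque Int Intg mollifier cell_ind smear barrier.

(** * Cell averages compared with a Lipschitz function *)

Section CellAverages.
Context (R : realType) (d : nat).
Notation Z := 'rV[int]_d.
Notation V := 'rV[R]_d.
Variables (xi : R) (s h : V -> R) (L : R).
Hypotheses (xi0 : 0 < xi) (is_ : Intg s) (ih : Intg h) (L0 : 0 <= L)
  (hL : forall x y, `|h x - h y| <= L * enorm (x - y)).

Lemma cell_ind_ge0 k (y : V) : 0 <= cell_ind xi k y.
Proof. by rewrite cell_indE; case: ifP. Qed.

Lemma cell_avg_close k :
  `|xi ^- d * Int (fun y => s y * cell_ind xi k y) - h (lattice_pt xi k)|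
    <= xi ^- d * Int (fun y => `|s y - h y| * cell_ind xi k y) + L * (d%:R * xi).
Proof.
have ic : Intg (cell_ind xi k) := Intg_cell_ind xi0 k.
have isc := Intg_mul_cell_ind xi0 k is_.
have isb := Intg_norm (IntgB is_ ih).
have isbc := Intg_mul_cell_ind xi0 k isb.
set hk := h (lattice_pt xi k).
have xd : xi ^+ d != 0 by rewrite expf_neq0// gt_eqF.
have xd0 : 0 <= xi ^- d by rewrite invr_ge0 exprn_ge0// ltW.
have E c : c = xi ^- d * Int (fun y => c * cell_ind xi k y).
  by rewrite (IntZ _ ic) Int_cell_ind// mulrCA mulVf ?mulr1.
rewrite [hk]E [L * _]E -mulrBr -mulrDr normrM ger0_norm//; apply: ler_wpM2l => //.
rewrite -(IntB isc (IntgZ hk ic)) -(IntD isbc (IntgZ _ ic)).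
apply: le_trans (le_norm_Int (IntgB isc (IntgZ hk ic))) _.
apply: (le_Int (Intg_norm (IntgB isc (IntgZ hk ic))) (IntgD isbc (IntgZ _ ic))) => y.
rewrite -mulrBl -mulrDl normrM (ger0_norm (cell_ind_ge0 k y)).
have [E0|E0] := eqVneq (cell_ind xi k y) 0; first by rewrite E0 !mulr0.
apply: ler_wpM2r; first exact: cell_ind_ge0.
have yk : near_pt xi y = k.
  by apply/eqP; move: E0; rewrite cell_indE; case: ifP => //; rewrite eqxx.
have H : `|h y - hk| <= L * (d%:R * xi).
  apply: le_trans (hL _ _) _; apply: ler_wpM2l => //.
  by rewrite -enormN opprB -yk; exact: near_pt_dist.
apply: le_trans (lerD (lexx _) H).
by rewrite (le_trans _ (ler_normD _ _))// addrA subrK.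
Qed.

(** Integrals over disjoint cells add up to at most the L^1 distance; the constant errors are
    multiplied by the rescaled number of lattice points in the ball. *)
Lemma lsum_cell_avg_close (B : {fset Z}) rad c : 0 <= c ->
  (forall k, (k \in B) = (enorm (lattice_pt xi k) < rad)) ->
  xi ^+ d * lsum (fun k => if k \in B then
    `|xi ^- d * Int (fun y => s y * cell_ind xi k y) - h (lattice_pt xi k)| + c else 0)
  <= Int (fun y => `|s y - h y|) + (L * (d%:R * xi) + c) * vol d (rad + d%:R * xi).
Proof.
move=> c0 HB; set T := L * (d%:R * xi).
have isb := Intg_norm (IntgB is_ ih).
have xd0 : 0 < xi ^+ d by rewrite exprn_gt0.
pose F (k : Z) : R := if k \in B then 1 else 0.
have fF : fin_supp F by exists B => k /negPf; rewrite /F => ->.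
have T0 : 0 <= T by apply: mulr_ge0 => //; apply: mulr_ge0; [exact: ler0n|exact: ltW].
pose a k := Int (fun y => `|s y - h y| * cell_ind xi k y).
have [iF EF] := Int_near_pt xi0 fF isb.
have Ha : lsum (fun k => F k * a k) <= Int (fun y => `|s y - h y|).
  rewrite -EF; apply: (le_Int iF isb) => y.
  by rewrite /F; case: ifP => _; rewrite ?mulr1 ?mulr0//; exact: normr_ge0.
have HF : xi ^+ d * lsum F <= vol d (rad + d%:R * xi).
  have := lattice_ball_count d xi0 rad; rewrite (_ : (fun _ => _) = F)//.
  by apply/funext => k; rewrite /F HB.
have fFa : fin_supp (fun k => F k * a k) by exact: fin_suppMl.
have fTF : fin_supp (fun k => (xi ^+ d * (T + c)) * F k) by exact: fin_suppMr.
rewrite -lsumZ.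
apply: (@le_trans _ _ (lsum (fun k => F k * a k + (xi ^+ d * (T + c)) * F k))).
  apply: lsum_le; [by exists B => k /negPf ->; rewrite mulr0|exact: fin_suppD|].
  move=> k; rewrite /F; case: ifP => kB; last by rewrite !mulr0 mul0r addr0.
  rewrite mul1r mulr1; have := ler_wpM2l (ltW xd0) (lerD (cell_avg_close k) (lexx c)).
  rewrite -/T -/(a k) => H; apply: le_trans H _.
  by rewrite -addrA mulrDr mulrA mulfV ?gt_eqF// mul1r.
rewrite lsumD// lsumZ; apply: lerD => //.
rewrite [xi ^+ d * _]mulrC -mulrA; apply: ler_wpM2l => //; exact: addr_ge0.
Qed.

End CellAverages.

(** * Upper bound for the odometer *)

Section OdometerUpperBound.
Context (R : realType) (d : nat).
Hypothesis d0 : (0 < d)%N.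
Notation Z := 'rV[int]_d.
Notation V := 'rV[R]_d.
Variables (s : V -> R) (M rad : R).
Hypotheses (rad0 : 0 < rad) (ms : Meas s) (sM : forall x, `|s x| <= M)
  (srad : forall x, rad <= enorm x -> s x = 0).
Variable v : (V -> R) -> R.
Hypotheses (linv : linear_on_tests v) (posv : positive_on_tests v)
  (vLap : forall f, test_fun_in_ball rad f -> (forall x, 0 <= f x) ->
    v (Lap f) <= - (2 * d%:R) * Int (fun y => s y * f y)).
Variables (lam e X : R).
Hypotheses (l2 : 2^-1 <= lam) (l1 : lam <= 1) (e0 : 0 < e) (ler : lam * rad + e < rad).
Variables (g : V -> R) (K Cg rg r1 Cv : R).
Hypotheses (tg : test_fun g) (g0 : forall x, 0 <= g x) (gK : forall x, `|g x| <= K)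
  (gr : forall x, rg <= enorm x -> g x = 0)
  (Cg0 : 0 <= Cg) (gC : forall x y, `|g x - g y| <= Cg * enorm (x - y)) (hr : rg + e <= r1)
  (r10 : 0 <= r1)
  (vC : forall f (K : R), test_fun f -> (forall x, r1 <= enorm x -> f x = 0) ->
    (forall x, `|f x| <= K) -> `|v f| <= Cv * K).

(** From u <= w + (u - w)^+ with [w] the barrier: the first term pairs to nearly [v g], the second
    is bounded by the sandpile comparison with b = |tau - smear| + E1 xi on the ball. [E] may depend
    on [lam] and [e] but not on xi. *)
Lemma odometer_upper_bound : exists E : R, 0 <= E /\
  forall (xi : R) (B : {fset Z}) (tau u : Z -> R), 0 < xi -> xi <= X ->
  (forall k, (k \in B) = (enorm (lattice_pt xi k) < rad)) ->
  (forall k, tau k = xi ^- d * Int (fun y => s y * cell_ind xi k y)) ->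
  (forall k, 0 <= u k) -> (forall k, k \notin B -> u k = 0) ->
  (forall k, 0 < u k -> 0 <= tau k + dLap xi u k) ->
  xi ^+ d * lsum (fun k => u k * g (lattice_pt xi k)) <=
    lam ^- 2 * (v g + Cv * kappa d lam e K Cg r1)
    + K * ((rad + X) ^+ 2 * Int (fun x => `|s x - smear s lam e x|)) + E * xi.
Proof.
have l0 : 0 < lam by apply: lt_le_trans l2; rewrite invr_gt0.
have K0 : 0 <= K by exact: le_trans (normr_ge0 _) (gK 0).
have is_ : Intg s by exact: Intg_bounded ms sM srad.
have ih := Intg_smear ms sM srad l0 e0.
have [L [L0 HL]] := smear_lipschitz ms sM srad l0 e0.
have [E1 [E10 HE1]] := dLap_barrier_le d0 rad0 linv posv vLap X l0 l1 e0 ler.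
have [E2 [E20 HE2]] := lsum_barrier linv X l2 l1 e0 tg gK gr Cg0 gC hr r10 vC.
have Cv0 : 0 <= Cv.
  have H : `|v (fun=> 0)| <= Cv * 1.
    by apply: vC => [|//|x]; [exact: test_fun0|rewrite normr0].
  by rewrite mulr1 in H; exact: le_trans (normr_ge0 _) H.
have li0 : 0 <= lam ^- 2 by rewrite invr_ge0 sqr_ge0.
pose VV := vol d (rad + d%:R * X).
have VV0 : 0 <= VV by exact: vol_ge0.
have Ld0 : 0 <= L * d%:R by apply: mulr_ge0 => //; exact: ler0n.
exists (lam ^- 2 * (Cv * E2) + K * ((rad + X) ^+ 2 * ((L * d%:R + E1) * VV))); split.
  apply: addr_ge0; first by apply: mulr_ge0 => //; exact: mulr_ge0.
  apply: mulr_ge0 => //; apply: mulr_ge0; first exact: sqr_ge0.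
  by apply: mulr_ge0 => //; exact: addr_ge0.
move=> xi B tau u xi0 xiX HB Htau u0 uB ue.
pose w := barrier v lam e xi; pose h := smear s lam e.
pose b k := if k \in B then `|tau k - h (lattice_pt xi k)| + E1 * xi else 0.
have Ex0 : 0 <= E1 * xi by apply: mulr_ge0 => //; exact: ltW.
have comp : lsum (fun k => Num.max (u k - w k) 0) <= (rad + xi) ^+ 2 * lsum b.
  apply: (sandpile_comparison d0 xi0 rad0 HB u0 uB ue).
  - by move=> k; exact: barrier_ge0.
  - by move=> k; rewrite /b; case: ifP => // _; apply: addr_ge0.
  - by move=> k /negPf kB; rewrite /b kB.
  - move=> k kB; rewrite /b kB.
    have kr : enorm (lattice_pt xi k) < rad by rewrite -HB.
    apply: le_trans (lerD (lexx (tau k)) (HE1 xi k xi0 xiX kr)) _.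
    by rewrite addrA lerD2r; exact: ler_norm.
have xd0 : 0 <= xi ^+ d by rewrite exprn_ge0// ltW.
have bb : xi ^+ d * lsum b <= Int (fun y => `|s y - h y|) + (L * (d%:R * xi) + E1 * xi) * VV.
  have := lsum_cell_avg_close xi0 is_ ih L0 HL Ex0 HB.
  rewrite -/h (_ : (fun k => _) = b); last by apply/funext => k; rewrite /b Htau.
  move=> H; apply: le_trans H _; rewrite lerD2l; apply: ler_wpM2l.
    apply: addr_ge0 => //; apply: mulr_ge0 => //; apply: mulr_ge0; [exact: ler0n|exact: ltW].
  by apply: vol_le; rewrite lerD2l; apply: ler_wpM2l => //; exact: ler0n.
have fm : fin_supp (fun k => Num.max (u k - w k) 0).
  exists B => k kB; rewrite uB// sub0r; apply/max_idPr; rewrite oppr_le0.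
  exact: barrier_ge0.
have fg := fin_supp_lattice xi0 gr.
have split_u : lsum (fun k => u k * g (lattice_pt xi k)) <=
    lsum (fun k => w k * g (lattice_pt xi k)) + K * lsum (fun k => Num.max (u k - w k) 0).
  rewrite -lsumZ -lsumD; [|exact: fin_suppMr|exact: fin_suppMr].
  apply: lsum_le; [exact: fin_suppMr|by apply: fin_suppD; exact: fin_suppMr|].
  move=> k; rewrite -lerBlDl -mulrBl.
  apply: (@le_trans _ _ (Num.max (u k - w k) 0 * g (lattice_pt xi k))).
    by apply: ler_wpM2r => //; rewrite le_max lexx.
  rewrite mulrC; apply: ler_wpM2r; first by rewrite le_max lexx orbT.
  by apply: le_trans (gK _); exact: ler_norm.
have I0 : 0 <= Int (fun y => `|s y - h y|) by apply: Int_ge0.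
have P1 : xi ^+ d * lsum (fun k => w k * g (lattice_pt xi k)) <=
    lam ^- 2 * (v g + Cv * (kappa d lam e K Cg r1 + E2 * xi)).
  have := le_trans (ler_norm _) (HE2 xi xi0 xiX); rewrite -/w lerBlDr => H.
  by rewrite [leRHS]mulrDr addrC.
have P2 : xi ^+ d * lsum (fun k => Num.max (u k - w k) 0) <=
    (rad + X) ^+ 2 * (Int (fun y => `|s y - h y|) + (L * (d%:R * xi) + E1 * xi) * VV).
  apply: le_trans (ler_wpM2l xd0 comp) _; rewrite mulrCA; apply: ler_pM.
  - exact: sqr_ge0.
  - by apply: mulr_ge0 => //; apply: lsum_ge0 => k; rewrite /b; case: ifP => // _; apply: addr_ge0.
  - have p0 : 0 <= rad + xi by apply: addr_ge0; exact: ltW.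
    by rewrite ler_sqr ?nnegrE ?lerD2l//; apply: le_trans p0 _; rewrite lerD2l.
  - exact: bb.
apply: le_trans (ler_wpM2l xd0 split_u) _; rewrite mulrDr [xi ^+ d * (K * _)]mulrCA.
apply: le_trans (lerD P1 (ler_wpM2l K0 P2)) _.
rewrite le_eqVlt; apply/orP; left; apply/eqP; rewrite -/h.
by move: (Int _) (v g) (kappa _ _ _ _ _ _) (lam ^- 2) => a1 a2 a3 a4; ring.
Qed.

End OdometerUpperBound.

(** * Passage to the limit *)

#[local] Opaque Int Intg mollifier cell_ind smear barrier.

(** The image ultrafilter contains a compact interval, hence has a cluster point, and an ultrafilter
    converges to each of its cluster points. *)
Lemma ultra_bounded_cvg (R : realType) (T : Type) (G : set_system T) (a : T -> R) (c : R) :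
  UltraFilter G -> (forall n, `|a n| <= c) -> exists l : R, a @ G --> l.
Proof.
move=> UG ac; have PG : ProperFilter G := ultra_proper.
have FA : (a @ G) `[- c, c]%classic.
  apply: (@filterS _ G _ setT) => [n _|]; last exact: filterT.
  by rewrite /= in_itv/= -ler_norml.
have [l [_ Hl]] := @segment_compact R (- c) c (a @ G) _ FA.
exists l => B nB; have [//|H] := in_ultra_setVsetC (a @^-1` B) UG.
by have [x [/= Bx nBx]] := Hl (~` B) B H nB; case: Bx.
Qed.

Section Pairing.
Context (R : realType) (d : nat).
Hypothesis d0 : (0 < d)%N.
Notation Z := 'rV[int]_d.
Notation V := 'rV[R]_d.

Definition pairing (xi : R) (u : Z -> R) (f : V -> R) : R :=
  xi ^+ d * lsum (fun k => u k * f (lattice_pt xi k)).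

Section Fixed.
Variables (xi : R) (u : Z -> R).
Hypotheses (xi0 : 0 < xi) (fu : fin_supp u).

Let fM (f : V -> R) : fin_supp (fun k => u k * f (lattice_pt xi k)).
Proof. exact: fin_suppMl. Qed.

Lemma pairing_linear a (f g : V -> R) :
  pairing xi u (fun x => a * f x + g x) = a * pairing xi u f + pairing xi u g.
Proof.
rewrite /pairing mulrCA -mulrDr; congr (_ * _); rewrite -lsumZ -lsumD//; last exact: fin_suppMr.
by congr lsum; apply/funext => k; move: (f _) (g _) => p q; ring.
Qed.

Lemma pairing_bound (f g : V -> R) c : (forall k, 0 <= u k) ->
  (forall k, `|f (lattice_pt xi k) - g (lattice_pt xi k)| <= c) ->
  `|pairing xi u f - pairing xi u g| <= c * (xi ^+ d * lsum u).
Proof.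
move=> u0 fg; have xd0 : 0 <= xi ^+ d by rewrite exprn_ge0// ltW.
rewrite /pairing -mulrBr -lsumB// normrM ger0_norm// mulrCA; apply: ler_wpM2l => //.
rewrite -lsumZ.
have fs : fin_supp (fun k => u k * f (lattice_pt xi k) - u k * g (lattice_pt xi k)).
  have [B HB] := fu; exists B => k kB; rewrite HB//; ring.
apply: le_trans (lsum_norm fs) _; apply: lsum_le; [exact: fin_supp_norm|exact: fin_suppMr|].
by move=> k; rewrite -mulrBr normrM ger0_norm// mulrC; apply: ler_wpM2r.
Qed.

Lemma pairing_ge0 (f : V -> R) : (forall k, 0 <= u k) -> (forall x, 0 <= f x) ->
  0 <= pairing xi u f.
Proof.
move=> u0 f0; apply: mulr_ge0; first by rewrite exprn_ge0// ltW.
by apply: lsum_ge0 => k; exact: mulr_ge0.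
Qed.

End Fixed.

(** [dLap] carries the factor 1/(2 d xi^2), so Lap is the limit of 2 d dLap; the rate comes from
    bounds on third derivatives. *)
Lemma dLap_test_fun (f : V -> R) : test_fun f -> exists C : R, 0 <= C /\ forall xi k, 0 < xi ->
  `|Lap f (lattice_pt xi k) - 2 * d%:R * dLap xi (fun k => f (lattice_pt xi k)) k| <= C * xi.
Proof.
move=> tf; have [C [C0 HC]] := test_fun_second_difference tf.
exists (d%:R * C); split; first by apply: mulr_ge0 => //; exact: ler0n.
move=> xi k xi0; rewrite /dLap.
have -> : 2 * d%:R * ((2 * d%:R * xi ^+ 2)^-1 *
   \sum_(i < d) (f (lattice_pt xi (k + ievec i)) - f (lattice_pt xi k) +
     (f (lattice_pt xi (k - ievec i)) - f (lattice_pt xi k)))) =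
   \sum_(i < d) xi ^- 2 * (f (lattice_pt xi k + xi *: evec R i) + f (lattice_pt xi k - xi *: evec R i)
     - 2 * f (lattice_pt xi k)).
  rewrite -mulr_sumr mulrA; congr (_ * _).
    by field; rewrite gt_eqF//= pnatr_eq0 -lt0n.
  apply: eq_bigr => i _; rewrite !lattice_ptD lattice_ptN lattice_pt_ievec.
  by move: (f _) (f _) (f _) => p q r; ring.
rewrite LapE -sumrB; apply: le_trans (ler_norm_sum _ _ _) _.
have -> : d%:R * C * xi = \sum_(i < d) (C * xi) by rewrite sumr_const card_ord -mulrA mulr_natl.
apply: ler_sum => i _; have := HC (lattice_pt xi k) i xi (ltW xi0).
move: (f (lattice_pt xi k + _)) (f (lattice_pt xi k - _)) (f (lattice_pt xi k)) (partial _ _ _) => p q r t H.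
have -> : t - xi ^- 2 * (p + q - 2 * r) = - (xi ^- 2 * (p + q - 2 * r - xi ^+ 2 * t)).
  by field; rewrite gt_eqF.
rewrite normrN normrM ger0_norm ?invr_ge0 ?sqr_ge0//.
rewrite ler_pdivrMl ?exprn_gt0//; apply: le_trans H _.
by rewrite le_eqVlt; apply/orP; left; apply/eqP; ring.
Qed.

End Pairing.

(** * Convergence of the odometers to an extremal functional *)

Section Limit.
Context (R : realType) (d : nat).
Hypothesis d0 : (0 < d)%N.
Notation Z := 'rV[int]_d.
Notation V := 'rV[R]_d.
Variables (sigma s : V -> R) (M rad : R) (N : set (d.-tuple (measurableTypeR R))).
Hypotheses (rad0 : 0 < rad) (ms : Meas s) (sM : forall x, `|s x| <= M)
  (srad : forall x, rad <= enorm x -> s x = 0)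
  (mN : measurable N) (N0 : mu R d N = 0%E)
  (sN : forall t, ~ N t -> s (rv t) = sigma (rv t))
  (cN : forall t, ~ N t -> {for rv t, continuous sigma}).
Variable v : (V -> R) -> R.
Hypotheses (linv : linear_on_tests v) (posv : positive_on_tests v)
  (vLap : forall f, test_fun_in_ball rad f -> (forall x, 0 <= f x) ->
    v (Lap f) <= - (2 * d%:R) * Int (fun y => s y * f y))
  (vmin : forall T, linear_on_tests T -> positive_on_tests T ->
    (forall f, test_fun_in_ball rad f -> (forall x, 0 <= f x) ->
      T (Lap f) <= - (2 * d%:R) * Int (fun y => s y * f y)) ->
    forall f, test_fun f -> (forall x, 0 <= f x) -> v f <= T f).
Variables (xi : nat -> R) (B : nat -> {fset Z}) (tau u eta : nat -> Z -> R).
Hypotheses (xi0 : forall n, 0 < xi n) (xidec : forall n, xi n.+1 <= xi n)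
  (xilim : xi @ \oo --> 0)
  (HB : forall n k, (k \in B n) = (enorm (lattice_pt (xi n) k) < rad))
  (tauE : forall n k, tau n k = xi n ^- d * Int (fun y => s y * cell_ind (xi n) k y))
  (tauB : forall n k, k \notin B n -> tau n k = 0)
  (u0 : forall n k, 0 <= u n k) (uB : forall n k, k \notin B n -> u n k = 0)
  (etaE : forall n k, eta n k = tau n k + dLap (xi n) (u n) k)
  (etaB : forall n k, k \in B n -> eta n k <= 0)
  (etau : forall n k, 0 < u n k -> 0 <= eta n k).

Let X := xi 0%N.

Lemma xi_le n : xi n <= X.
Proof. by elim: n => [|n IH]; [exact: lexx|exact: le_trans (xidec n) IH]. Qed.

Let M0 : 0 <= M. Proof. exact: le_trans (normr_ge0 _) (sM 0). Qed.
Let Intg_s : Intg s. Proof. exact: Intg_bounded ms sM srad. Qed.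
Let fu n : fin_supp (u n). Proof. by exists (B n) => k; exact: uB. Qed.
Let ftau n : fin_supp (tau n). Proof. by exists (B n) => k; exact: tauB. Qed.
Let xd0 n : 0 <= xi n ^+ d. Proof. by rewrite exprn_ge0// ltW. Qed.

Lemma tau_bound n k : `|tau n k| <= M.
Proof.
have xn := exprn_gt0 d (xi0 n).
rewrite tauE normrM ger0_norm ?invr_ge0// ler_pdivrMl// mulrC.
have ic := Intg_cell_ind (xi0 n) k; have isc := Intg_mul_cell_ind (xi0 n) k Intg_s.
apply: le_trans (le_norm_Int isc) _; rewrite -(Int_cell_ind (xi0 n) k) -(IntZ _ ic).
apply: (le_Int (Intg_norm isc) (IntgZ _ ic)) => y.
by rewrite normrM (ger0_norm (cell_ind_ge0 _ _ _)); apply: ler_wpM2r => //; exact: cell_ind_ge0.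
Qed.

(** Cell averages are bounded by [M] and the rescaled number of lattice points in the ball is
    bounded, so the paraboloid estimate is uniform in n. *)
Lemma odometer_mass : exists C : R, 0 <= C /\ forall n, xi n ^+ d * lsum (u n) <= C.
Proof.
pose W := vol d (rad + d%:R * X).
have W0 : 0 <= W by exact: vol_ge0.
exists ((rad + X) ^+ 2 * (M * W)); split.
  by apply: mulr_ge0; [exact: sqr_ge0|exact: mulr_ge0].
move=> n.
have H : lsum (u n) <= (rad + xi n) ^+ 2 * lsum (fun k => `|tau n k|).
  apply: (lsum_le_superharmonic (xi0 n) d0 rad0 (HB n)).
  - exact: u0.
  - exact: uB.
  - by move=> k; exact: normr_ge0.
  - by move=> k /tauB ->; rewrite normr0.
  - move=> k /etau; rewrite etaE => H; apply: le_trans (ler_norm _).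
    by rewrite lerNl -subr_ge0 opprK addrC.
pose F (k : Z) : R := if enorm (lattice_pt (xi n) k) < rad then 1 else 0.
have fF : fin_supp F by exists (B n) => k; rewrite /F HB => /negPf ->.
have HF : xi n ^+ d * lsum F <= W.
  apply: le_trans (lattice_ball_count d (xi0 n) rad) _; apply: vol_le; rewrite lerD2l.
  by apply: ler_wpM2l; [exact: ler0n|exact: xi_le].
have Ht : lsum (fun k => `|tau n k|) <= M * lsum F.
  rewrite -lsumZ; apply: lsum_le; [exact: fin_supp_norm (ftau n)|exact: fin_suppMr|].
  move=> k; rewrite /F -HB; have [kB|kB] := boolP (k \in B n).
    by rewrite mulr1; exact: tau_bound.
  by rewrite tauB// normr0 mulr0.
apply: le_trans (ler_wpM2l (xd0 n) H) _; rewrite mulrCA; apply: ler_pM.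
- exact: sqr_ge0.
- by apply: mulr_ge0 => //; apply: lsum_ge0 => k; exact: normr_ge0.
- have p0 : 0 <= rad + xi n by apply: addr_ge0; exact: ltW.
  have px : rad + xi n <= rad + X by rewrite lerD2l; exact: xi_le.
  by rewrite ler_sqr ?nnegrE//; exact: le_trans p0 px.
- apply: le_trans (ler_wpM2l (xd0 n) Ht) _; rewrite mulrCA.
  exact: ler_wpM2l.
Qed.

Let a n f := pairing (xi n) (u n) f.

Lemma pairing_seq_bounded (f : V -> R) : test_fun f -> exists c : R, forall n, `|a n f| <= c.
Proof.
move=> tf; have [K [K0 fK]] := test_fun_bounded tf; have [C [C0 HC]] := odometer_mass.
exists (K * C) => n.
have := @pairing_bound _ _ _ _ (xi0 n) (fu n) f (fun=> 0) K (u0 n) (fun k => _).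
rewrite (_ : pairing _ _ (fun=> 0) = 0); last first.
  rewrite /pairing (_ : (fun _ => _) = fun=> 0); last by apply/funext => k; rewrite mulr0.
  rewrite (@lsumE _ _ _ fset0)// ?big_seq_fset0 ?mulr0//.
rewrite subr0 => H; apply: le_trans (H _) _.
  by move=> k; rewrite subr0.
by apply: ler_wpM2l.
Qed.

Lemma pairing_tau_cvg f : test_fun f ->
  (fun n => pairing (xi n) (tau n) f) @ \oo --> Int (fun y => s y * f y).
Proof.
move=> tf; have [C [C0 HC]] := test_fun_lipschitz_enorm tf.
pose I1 := Int (fun y => `|s y|).
have E n : pairing (xi n) (tau n) f =
    lsum (fun k => f (lattice_pt (xi n) k) * Int (fun y => s y * cell_ind (xi n) k y)).
  rewrite /pairing -lsumZ; congr lsum; apply/funext => k; rewrite tauE.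
  by rewrite !mulrA mulfV ?mul1r ?expf_neq0 ?gt_eqF// mulrC.
apply/cvgrPdist_le => e e0.
have : (fun n => C * (d%:R * xi n) * I1) @ \oo --> (0 : R).
  rewrite -[X in _ --> X](_ : C * (d%:R * 0) * I1 = 0); last by rewrite !mulr0 mul0r.
  by apply: cvgM; [apply: cvgM; [exact: cvg_cst|apply: cvgM => //; exact: cvg_cst]|exact: cvg_cst].
move=> /(cvgr_lt 0)/(_ _ e0); apply: filterS => n Hn.
rewrite E distrC; apply: le_trans (riemann_sum_weighted (xi0 n) C0 Intg_s tf HC) _.
exact: ltW.
Qed.

Lemma pairing_eta n f : pairing (xi n) (eta n) f = pairing (xi n) (tau n) f +
  xi n ^+ d * lsum (fun k => u n k * dLap (xi n) (fun k => f (lattice_pt (xi n) k)) k).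
Proof.
rewrite /pairing -mulrDr -(lsum_dLap (xi n) (fun k => f (lattice_pt (xi n) k)) (fu n)).
rewrite -lsumD; [|exact: fin_suppMl|by apply: fin_suppMl; exact: fin_supp_dLap].
by congr (_ * lsum _); apply/funext => k; rewrite etaE mulrDl.
Qed.

(** Summation by parts in eta = tau + dLap u; replacing the discrete Laplacian of the sampled [f] by
    Lap f costs O(xi) times the bounded mass of the odometer. *)
Lemma pairing_Lap f : test_fun f -> exists C : R, 0 <= C /\ forall n,
  `|a n (Lap f) - 2 * d%:R * (pairing (xi n) (eta n) f - pairing (xi n) (tau n) f)| <= C * xi n.
Proof.
move=> tf; have [C [C0 HC]] := dLap_test_fun d0 tf; have [D [D0 HD]] := odometer_mass.
exists (C * D); split; first exact: mulr_ge0.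
move=> n; rewrite pairing_eta [X in _ * X]addrAC subrr add0r mulrCA -lsumZ.
have fl : fin_supp (fun k => u n k * Lap f (lattice_pt (xi n) k)) by exact: fin_suppMl.
have fr : fin_supp (fun k => 2 * d%:R * (u n k * dLap (xi n) (fun k => f (lattice_pt (xi n) k)) k)).
  by apply: fin_suppMr; exact: fin_suppMl.
rewrite /a /pairing -mulrBr -lsumB// normrM ger0_norm//.
have fs : fin_supp (fun k => u n k * Lap f (lattice_pt (xi n) k) -
    2 * d%:R * (u n k * dLap (xi n) (fun k => f (lattice_pt (xi n) k)) k)).
  by exists (B n) => k kB; rewrite uB// !mul0r mulr0 subr0.
apply: (@le_trans _ _ (xi n ^+ d * ((C * xi n) * lsum (u n)))).
  apply: ler_wpM2l => //; apply: le_trans (lsum_norm fs) _; rewrite -lsumZ.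
  apply: lsum_le; [exact: fin_supp_norm|exact: fin_suppMr|].
  move=> k; rewrite (_ : _ - _ = u n k * (Lap f (lattice_pt (xi n) k) -
    2 * d%:R * dLap (xi n) (fun k => f (lattice_pt (xi n) k)) k)); last first.
    by move: (dLap _ _ _) (Lap _ _) => p q; ring.
  by rewrite normrM ger0_norm// mulrC; apply: ler_wpM2r => //; exact: HC.
rewrite mulrCA mulrAC; apply: ler_wpM2r; first exact: ltW.
exact: ler_wpM2l.
Qed.

Lemma pairing_eta_le0 n f : test_fun_in_ball rad f -> (forall x, 0 <= f x) ->
  pairing (xi n) (eta n) f <= 0.
Proof.
move=> [_ [r [rr fr]]] f0; rewrite -oppr_ge0 /pairing -mulrN; apply: mulr_ge0 => //.
rewrite -mulN1r -lsumZ; apply: lsum_ge0 => k.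
have [kB|kB] := boolP (k \in B n).
  by rewrite mulN1r -mulNr; apply: mulr_ge0 => //; rewrite oppr_ge0; exact: etaB.
rewrite fr ?mulr0//; move: kB; rewrite HB -leNgt; exact: le_trans (ltW rr).
Qed.

(** The limit along an ultrafilter is a linear functional on all test functions,
    hence a competitor in the definition of the balayage. *)
Section Ultra.
Variable G : set_system nat.
Hypotheses (UG : UltraFilter G) (Goo : \oo `<=` G).

Let PG : ProperFilter G. Proof. exact: ultra_proper. Qed.

Let T (f : V -> R) : R := lim ((fun n => a n f) @ G).

Let T_cvg f : test_fun f -> (fun n => a n f) @ G --> T f.
Proof.
move=> tf; have [c Hc] := pairing_seq_bounded tf.
by have [l Hl] := ultra_bounded_cvg UG Hc; apply/cvg_ex; exists l.
Qed.

Let cvg_G (b : nat -> R) (l : R) : b @ \oo --> l -> b @ G --> l.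
Proof. by move=> bl A /bl H; exact: Goo H. Qed.

Lemma ultra_limit_ge f : test_fun f -> (forall x, 0 <= f x) -> v f <= T f.
Proof.
apply: vmin.
- move=> c f1 f2 t1 t2.
  have H : (fun n => a n (fun x => c * f1 x + f2 x)) @ G --> c * T f1 + T f2.
    under eq_fun do rewrite /a pairing_linear//.
    by apply: cvgD; [apply: cvgM; [exact: cvg_cst|exact: T_cvg]|exact: T_cvg].
  exact: cvg_lim H.
- move=> f1 t1 f10; apply: (cvgr_to_ge (T_cvg t1)); near=> n.
  exact: pairing_ge0.
- move=> f1 t1 f10; have tf := test_fun_in_ballW t1.
  have [C [C0 HC]] := pairing_Lap tf.
  (* Since eta pairs nonpositively with [f1], this expression is at most 0 for every n, and its
     limit is the required inequality. *)
  have H : (fun n => a n (Lap f1) + (2 * d%:R * pairing (xi n) (tau n) f1 - C * xi n)) @ G -->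
      T (Lap f1) + (2 * d%:R * Int (fun y => s y * f1 y) - C * 0).
    apply: cvgD; first by apply: T_cvg; exact: test_fun_Lap.
    apply: cvg_G; apply: cvgB; apply: cvgM; try exact: cvg_cst; last exact: xilim.
    exact: pairing_tau_cvg.
  rewrite mulNr -subr_le0 opprK -[_ * Int _]subr0 -[X in _ - X](mulr0 C).
  apply: (cvgr_to_le H); near=> n.
  have := pairing_eta_le0 n t1 f10; have := HC n; rewrite ler_norml.
  have dd : 0 <= 2 * d%:R :> R by rewrite mulr_ge0 ?ler0n.
  move: (a n _) (pairing _ (eta n) _) (pairing _ (tau n) _) (C * xi n) => p q r t /andP[_ H1] H2.
  have : 2 * d%:R * q <= 0 by rewrite mulr_ge0_le0.
  by move: H1; rewrite mulrBr; move: (2 * d%:R * q) (2 * d%:R * r) => x y; lra.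
Unshelve. all: by end_near. Qed.

End Ultra.

(** Otherwise the failing indices meet every tail, so the tail filter restricted to them is proper
    and extends to an ultrafilter. The limit along it is at most v f - e, against the minimality of
    [v]. *)
Lemma pairing_lower f (e : R) : test_fun f -> (forall x, 0 <= f x) -> 0 < e ->
  \forall n \near \oo, v f - e <= a n f.
Proof.
move=> tf f0 e0; apply: contrapT => H.
pose A := [set n | ~ (v f - e <= a n f)].
have PF : ProperFilter (within A \oo).
  apply: Build_ProperFilter => W; apply: H; move: W; rewrite /within /=.
  by apply: filterS => n An; apply: contrapT => /An.
have [G [UG FG]] := ultraFilterLemma PF.
have Goo : \oo `<=` G.
  by move=> W oW; apply: FG; rewrite /within /=; apply: filterS oW.
have GA : G A by apply: FG; rewrite /within /=; near=> n.
have := ultra_limit_ge UG Goo tf f0; apply/negP; rewrite -ltNge.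
have [c Hc] := pairing_seq_bounded tf; have [l Hl] := ultra_bounded_cvg UG Hc.
have PG : ProperFilter G := ultra_proper.
rewrite (cvg_lim _ Hl)//; apply: (@le_lt_trans _ _ (v f - e)); last by rewrite ltrBlDr ltrDl.
apply: (cvgr_to_le Hl); apply: filterS GA => n /= /negP; rewrite -ltNge; exact: ltW.
Unshelve. all: by end_near. Qed.

Lemma lam_expn_cvg j : (fun m => lam_ R m ^- j) @ \oo --> (1 : R).
Proof.
have H : (fun m => lam_ R m ^+ j) @ \oo --> (1 : R).
  elim: j => [|j IH]; first by under eq_fun do rewrite expr0; exact: cvg_cst.
  have -> : (fun m => lam_ R m ^+ j.+1) = (fun m => lam_ R m * lam_ R m ^+ j).
    by apply/funext => m; rewrite exprS.
  have H : (fun m => lam_ R m * lam_ R m ^+ j) @ \oo --> (1 * 1 : R).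
    by apply: cvgM; [exact: lam_cvg|exact: IH].
  by rewrite mulr1 in H.
rewrite -[X in _ --> X]invr1; apply: cvgV => //; exact: oner_neq0.
Qed.

Lemma kappa_cvg K Cg r1 :
  (fun m => kappa d (lam_ R m) (eps_ rad m) K Cg r1) @ \oo --> (0 : R).
Proof.
rewrite -[X in _ --> X](_ : Cg * (2 * (0 + (1 - 1) * r1)) * 1 + K * (1 - 1) = 0); last by ring.
apply: cvgD; apply: cvgM; try exact: cvg_cst; try exact: lam_expn_cvg.
  apply: cvgM; first exact: cvg_cst.
  apply: cvgM; first exact: cvg_cst.
  apply: cvgD; first exact: eps_cvg.
  by apply: cvgM; [apply: cvgB; [exact: cvg_cst|exact: lam_cvg]|exact: cvg_cst].
by apply: cvgB; [exact: lam_expn_cvg|exact: cvg_cst].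
Qed.

(** [m] is fixed first, so that the mollification errors in [P m] are below e / 2; only then is n
    taken large, because the constant in the remaining error E xi_n depends on [m]. *)
Lemma pairing_upper f (e : R) : test_fun f -> (forall x, 0 <= f x) -> 0 < e ->
  \forall n \near \oo, a n f <= v f + e.
Proof.
move=> tf f0 e0; have [K [K0 fK]] := test_fun_bounded tf.
have [C [C0 HC]] := test_fun_lipschitz_enorm tf; have [_ [rg fr]] := tf.
(* Large enough for every [m] at once, as eps <= rad, so the constant [Cv] does not depend on
   [m]. *)
pose r1 := `|rg| + rad.
have [Cv [Cv0 HCv]] := positive_test_bound linv posv r1.
pose I_ m := Int (fun x => `|s x - smear s (lam_ R m) (eps_ rad m) x|).
pose P m := lam_ R m ^- 2 * (v f + Cv * kappa d (lam_ R m) (eps_ rad m) K C r1)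
  + K * ((rad + X) ^+ 2 * I_ m).
have cP : P @ \oo --> v f.
  rewrite -[X in _ --> X](_ : 1 * (v f + Cv * 0) + K * ((rad + X) ^+ 2 * 0) = v f); last by ring.
  apply: cvgD.
    apply: cvgM; first exact: lam_expn_cvg.
    apply: cvgD; first exact: cvg_cst.
    by apply: cvgM; [exact: cvg_cst|exact: kappa_cvg].
  apply: cvgM; first exact: cvg_cst.
  apply: cvgM; first exact: cvg_cst.
  exact: (smear_L1_cvg rad0 ms sM srad mN N0 sN cN).
have [m Pm] : exists m, P m < v f + e / 2.
  have e2 : v f < v f + e / 2 by rewrite ltrDl divr_gt0.
  have [m _ Hm] := cvgr_lt (v f) cP _ e2; exists m.
  by apply: Hm; exact: leqnn.
have hr : rg + eps_ rad m <= r1.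
  by apply: lerD; [exact: ler_norm|exact: eps_le].
have r10 : 0 <= r1 by apply: addr_ge0; [exact: normr_ge0|exact: ltW].
have [E [E0 HE]] := odometer_upper_bound d0 rad0 ms sM srad linv posv vLap
  X (lam_ge R m) (lam_le R m) (eps_gt0 rad0 m) (lam_eps_lt rad0 m)
  tf f0 fK fr C0 HC hr r10 HCv.
have e2 : 0 < e / 2 by rewrite divr_gt0.
have : (fun n => E * xi n) @ \oo --> (0 : R).
  by rewrite -[X in _ --> X](mulr0 E); apply: cvgM; [exact: cvg_cst|exact: xilim].
move=> /(cvgr_lt 0)/(_ _ e2); apply: filterS => n Hn.
have ue k : 0 < u n k -> 0 <= tau n k + dLap (xi n) (u n) k.
  by rewrite -etaE; exact: etau.
have H := HE (xi n) (B n) (tau n) (u n) (xi0 n) (xi_le n) (HB n) (tauE n) (u0 n) (@uB n) ue.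
apply: le_trans H _; rewrite -/(P m).
by move: Pm Hn; move: (P m) (E * xi n) (v f) => p q r; lra.
Qed.

Lemma pairing_cvg_ge0 f : test_fun f -> (forall x, 0 <= f x) ->
  (fun n => a n f) @ \oo --> v f.
Proof.
move=> tf f0; apply/cvgrPdist_le => e e0; near=> n.
rewrite ler_norml; apply/andP; split.
  have : a n f <= v f + e by near: n; exact: pairing_upper.
  by move: (a n f) (v f) => p q; lra.
have : v f - e <= a n f by near: n; exact: pairing_lower.
by move: (a n f) (v f) => p q; lra.
Unshelve. all: by end_near. Qed.

(** A signed test function is the difference of the nonnegative ones K chi + f and K chi. *)
Lemma pairing_cvg f : test_fun f -> (fun n => a n f) @ \oo --> v f.
Proof.
move=> tf; have [K [K0 fK]] := test_fun_bounded tf; have [_ [r fr]] := tf.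
have [chi [tc c0 c1]] := plateau d r.
pose g x := K * chi x + f x.
have tg : test_fun g by apply: test_funD => //; exact: test_funZ.
have g0 x : 0 <= g x.
  have [rx|xr] := leP r (enorm x); first by rewrite /g fr// addr0; exact: mulr_ge0.
  have := fK x; rewrite ler_norml => /andP[H _]; rewrite /g -lerBlDr sub0r.
  by apply: le_trans (_ : K <= _); [rewrite lerNl|rewrite ler_peMr// c1// ltW].
have E : (fun n => a n f) = fun n => a n g - K * a n chi.
  by apply/funext => n; rewrite /a /g pairing_linear// addrAC subrr add0r.
rewrite E (_ : v f = v g - K * v chi); last by rewrite /g linv// addrAC subrr add0r.
by apply: cvgB; [exact: pairing_cvg_ge0|apply: cvgM; [exact: cvg_cst|exact: pairing_cvg_ge0]].
Qed.

(** In the limit of eta = tau + dLap u, the last term contributes (2 d)^-1 v(Lap f) by the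
    normalisation of [dLap]. *)
Lemma pairing_eta_cvg f : test_fun f ->
  (fun n => pairing (xi n) (eta n) f) @ \oo --> Int (fun y => s y * f y) + (2 * d%:R)^-1 * v (Lap f).
Proof.
move=> tf; have [C [C0 HC]] := pairing_Lap tf.
have dd : 0 < 2 * d%:R :> R by rewrite mulr_gt0 ?ltr0n.
pose b n := pairing (xi n) (tau n) f + (2 * d%:R)^-1 * a n (Lap f).
have cb : b @ \oo --> Int (fun y => s y * f y) + (2 * d%:R)^-1 * v (Lap f).
  apply: cvgD; first exact: pairing_tau_cvg.
  by apply: cvgM; [exact: cvg_cst|apply: pairing_cvg; exact: test_fun_Lap].
have cz : (fun n => (2 * d%:R)^-1 * (C * xi n)) @ \oo --> (0 : R).
  rewrite -[X in _ --> X](_ : (2 * d%:R)^-1 * (C * 0) = 0); last by rewrite !mulr0.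
  by apply: cvgM; [exact: cvg_cst|apply: cvgM; [exact: cvg_cst|exact: xilim]].
have H n : `|b n - pairing (xi n) (eta n) f| <= (2 * d%:R)^-1 * (C * xi n).
  have -> : b n - pairing (xi n) (eta n) f =
      (2 * d%:R)^-1 * (a n (Lap f) - 2 * d%:R * (pairing (xi n) (eta n) f - pairing (xi n) (tau n) f)).
    rewrite /b; move: (a n _) (pairing _ (eta n) _) (pairing _ (tau n) _) dd => p q r dd.
    by field; rewrite pnatr_eq0 -lt0n.
  rewrite normrM ger0_norm ?invr_ge0 ?(ltW dd)//; apply: ler_wpM2l; last exact: HC.
  by rewrite invr_ge0 ltW.
rewrite -[X in _ --> X]subr0.
have -> : (fun n => pairing (xi n) (eta n) f) = fun n => b n - (b n - pairing (xi n) (eta n) f).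
  by apply/funext => n; rewrite opprB addrC subrK.
apply: cvgB => //; apply/norm_cvg0P/(squeeze_cvgr _ (cvg_cst 0) cz).
by near=> n; rewrite normr_ge0 H.
Unshelve. all: by end_near. Qed.

End Limit.

(* The gap between the potential and its largest subharmonic minorant *)
#[local] Opaque Int Intg pot.

Section BalayageFunctional.
Context (R : realType) (d : nat).
Hypothesis d2 : (2 <= d)%N.
Notation V := 'rV[R]_d.
Notation tup n := (n.-tuple (measurableTypeR R)).
Variables (sigma s : V -> R) (M rad : R) (N : set (tup d)).
Hypotheses (ms : Meas s) (sM : forall x, `|s x| <= M)
  (srad : forall x, rad <= enorm x -> s x = 0)
  (mN : measurable N) (N0 : mu R d N = 0%E)
  (sN : forall t, ~ N t -> s (rv t) = sigma (rv t)).

(** For each fixed [x] the two integrands agree off the null set, so the potentials coincide at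
    every point. *)
Lemma newton_potE x : newton_pot sigma x = pot s x.
Proof.
rewrite pot_def; congr (_ * _).
apply: (intRdE (Intg_pot_integrand d2 ms sM srad x) mN N0) => t Nt.
by rewrite sN.
Qed.

Lemma Intg_pot_test f : test_fun f -> Intg (fun x => pot s x * f x).
Proof.
move=> tf; have [C [C0 fC]] := test_fun_bounded tf; have [_ [r fr]] := tf.
exact: (Intg_pot_mul d2 ms sM srad (Intg_Meas (test_fun_Intg tf)) fC fr).
Qed.

Lemma intRd_newton_pot f : test_fun f ->
  intRd (fun x => newton_pot sigma x * f x) = Int (fun x => pot s x * f x).
Proof.
move=> tf; rewrite -intRd_Int; last exact: Intg_pot_test.
by congr intRd; apply/funext => x; rewrite newton_potE.
Qed.

Lemma linear_pot : linear_on_tests (fun f => Int (fun x => pot s x * f x)).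
Proof.
move=> a f g tf tg; rewrite -IntZ; last exact: Intg_pot_test.
rewrite -IntD; [|by apply: IntgZ; exact: Intg_pot_test|exact: Intg_pot_test].
by congr Int; apply/funext => x; move: (pot s x) (f x) (g x) => p q r; ring.
Qed.

Variable Bal : (V -> R) -> R.
Hypothesis HBal : bal_largest sigma rad Bal.

(** The functional [U^sigma - V^{sigma,R}], of which the rescaled odometers are
    discretizations. *)
Definition balayage_gap (f : V -> R) : R := Int (fun x => pot s x * f x) - Bal f.

Lemma linear_gap : linear_on_tests balayage_gap.
Proof.
move=> a f g tf tg; rewrite /balayage_gap (HBal.1.1.1 a f g tf tg) linear_pot//.
by move: (Int _) (Int _) (Bal f) (Bal g) => p q r t; ring.
Qed.

Lemma positive_gap : positive_on_tests balayage_gap.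
Proof.
move=> f tf f0; rewrite /balayage_gap subr_ge0 -intRd_newton_pot//.
exact: HBal.1.2.1.
Qed.

Lemma gap_Lap f : test_fun f ->
  balayage_gap (Lap f) = - (2 * d%:R) * Int (fun y => s y * f y) - Bal (Lap f).
Proof. by move=> tf; rewrite /balayage_gap (Int_pot_Lap d2 ms sM srad tf). Qed.

Lemma gap_Lap_le f : test_fun_in_ball rad f -> (forall x, 0 <= f x) ->
  balayage_gap (Lap f) <= - (2 * d%:R) * Int (fun y => s y * f y).
Proof.
move=> tb f0; rewrite gap_Lap; last exact: test_fun_in_ballW tb.
by rewrite gerBl; exact: HBal.1.2.2.
Qed.

(** The inequality on [T] compensates exactly the Laplacian -2 d sigma of U^sigma, and positivity of
    [T] gives both the obstacle condition and the seminorm estimate for [W]. *)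
Lemma gap_le (T : (V -> R) -> R) : linear_on_tests T -> positive_on_tests T ->
  (forall f, test_fun_in_ball rad f -> (forall x, 0 <= f x) ->
    T (Lap f) <= - (2 * d%:R) * Int (fun y => s y * f y)) ->
  forall f, test_fun f -> (forall x, 0 <= f x) -> balayage_gap f <= T f.
Proof.
move=> linT posT TLap f tf f0.
pose W g := Int (fun x => pot s x * g x) - T g.
rewrite /balayage_gap lerBlDr -lerBlDl; apply: (HBal.2 W) => //.
split; [split|split].
- move=> a g h tg th; rewrite /W linear_pot// linT//.
  by move: (Int _) (Int _) (T g) (T h) => p q r t; ring.
- move=> r; have [C [C0 HC]] := positive_test_bound linT posT r.
  (* Order 0: the seminorm estimate is read at the empty list of derivatives. *)
  exists (2 * d%:R * (M * loc_mass d (r + rad) * Int (fun x : V => if enorm x < rad then 1 else 0)) + C), 0%N.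
  move=> g K tg gr gK.
  have {}gK x : `|g x| <= K by exact: (gK [::]).
  rewrite mulrDl; apply: le_trans (ler_normB _ _) _; apply: lerD; last exact: HC.
  exact: (pot_mul_bound d2 ms sM srad (Intg_Meas (test_fun_Intg tg)) gK gr).
- move=> g tg g0; rewrite intRd_newton_pot// /W gerBl; exact: posT.
- move=> g tb g0; have tg := test_fun_in_ballW tb.
  rewrite /W (Int_pot_Lap d2 ms sM srad tg) subr_ge0; exact: TLap.
Qed.

Lemma bal_pairE f : test_fun f ->
  bal_pair Bal f = Int (fun y => s y * f y) + (2 * d%:R)^-1 * balayage_gap (Lap f).
Proof.
move=> tf; rewrite gap_Lap// /bal_pair; move: (Int _) (Bal _) => p q.
by field; rewrite pnatr_eq0 -lt0n; apply: leq_trans d2.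
Qed.

End BalayageFunctional.

Theorem theorem3p5 (R : realType) (d : nat) (hd : (2 <= d)%N)
  (sigma : 'rV[R]_d -> R)
  (hbounded : exists M : R, forall x, `|sigma x| <= M)
  (haecont : lebesgue_null [set x | ~ {for x, continuous sigma}])
  (hcpt : compact (closure [set x | sigma x != 0]))
  (hint : intRd sigma < 0)
  (xi : nat -> R)
  (hxipos : forall n, 0 < xi n)
  (hxidec : forall n, xi n.+1 <= xi n)
  (hxilim : xi @ \oo --> 0)
  (rad : R) (hrad : 0 < rad)
  (hsupp : closure [set x | sigma x != 0] `<=` oball rad)
  (hsuppn : forall n k, cell_avg (xi n) sigma k != 0 ->
              enorm (lattice_pt (xi n) k) < rad)
  (eta : nat -> 'rV[int]_d -> R)
  (heta : forall n, is_GDS (xi n) rad (cell_avg (xi n) sigma) (eta n))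
  (V : ('rV[R]_d -> R) -> R)
  (hV : bal_largest sigma rad V) :
  forall f, test_fun f ->
    (fun n => disc_pair (xi n) (eta n) f) @ \oo --> bal_pair V f.
Proof.
move=> f tf; have [M sM] := hbounded.
(* [A] is a Borel null set containing all discontinuities of [sigma]; resetting [sigma] to 0 on it
   gives the Borel version. *)
have [A [mA A0 ms cA]] := ae_continuous_borel_version haecont.
set s := (fun x : 'rV[R]_d => if tv x \in A then 0 else sigma x) in ms.
have sA t : ~ A t -> s (rv t) = sigma (rv t).
  by move=> At; rewrite /s rvK memNset.
have M0 : 0 <= M by exact: le_trans (normr_ge0 _) (sM 0).
have {}sM x : `|s x| <= M by rewrite /s; case: ifP => // _; rewrite normr0.
have srad x : rad <= enorm x -> s x = 0.
  move=> xr; rewrite /s; case: ifP => // _; apply/eqP/negPn/negP => sx.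
  have /hsupp : closure [set x | sigma x != 0] x by exact: subset_closure.
  by rewrite /oball /= ltNge xr.
have d0 : (0 < d)%N by exact: leq_trans hd.
have is_ : Intg s by exact: Intg_bounded ms sM srad.
have /choice[B HB] : forall n, exists B : {fset 'rV[int]_d},
    forall k, (k \in B) = (enorm (lattice_pt (xi n) k) < rad).
  by move=> n; exact: finite_lattice_ball.
have tauB n k : k \notin B n -> cell_avg (xi n) sigma k = 0.
  by rewrite HB; apply: contraNeq; exact: hsuppn.
have sA' t : ~ A t -> sigma (rv t) = s (rv t) by move=> /sA.
have tauE n k := cell_avgE (hxipos n) mA A0 sA' is_ k.
(* The balance equation, the support and the signs of these odometers are all that the limit
   argument takes from the toppling dynamics. *)
have /choice[u Hu] n := GDS_odometer d0 (hxipos n) hrad (HB n) (@tauB n) (heta n).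
rewrite (bal_pairE hd ms sM srad V tf).
apply: (pairing_eta_cvg d0 hrad ms sM srad mA A0 sA cA
  (linear_gap hd ms sM srad hV) (positive_gap hd ms sM srad mA A0 sA hV)
  (gap_Lap_le hd ms sM srad hV) (gap_le hd ms sM srad mA A0 sA hV)
  hxipos hxidec hxilim HB tauE tauB (u := u)) => //.
- by move=> n; have [] := Hu n.
- by move=> n; have [] := Hu n.
- by move=> n; have [] := Hu n.
- by move=> n k; have [_ _ _ []] := Hu n => H _; exact: H.
- by move=> n k; have [_ _ _ []] := Hu n => _ H; exact: H.
Qed.
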